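(* There exists a constant $C\ge 0$ such that for every smooth solution $(u,b)$ of the magnetohydrodynamics system $$\partial_t u+(u\cdot\nabla)u+\nabla\pi=\Delta u+(b\cdot\nabla)b,\qquad \partial_t b+(u\cdot\nabla)b=\Delta b+(b\cdot\nabla)u,\qquad \nabla\cdot u=\nabla\cdot b=0$$ on $\mathbb{R}^3$, at every time of existence one has, with $\omega_3=\partial_1u_2-\partial_2u_1$, $$\begin{aligned} &\int_{\mathbb{R}^3} (u\cdot\nabla)u\cdot\Delta_h u-(b\cdot\nabla)b\cdot\Delta_h u+(u\cdot\nabla)b\cdot\Delta_h b-(b\cdot\nabla)u\cdot\Delta_h b\;dx\\ &\le C\int_{\mathbb{R}^3}\Big[\,|u_3|\big(|\nabla u||\nabla\nabla_h u|+|\nabla b||\nabla\nabla_h b|\big)+|b_3|\big(|\nabla u||\nabla\nabla_h b|+|\nabla b||\nabla\nabla_h u|\big)\\ &\qquad\qquad+|\nabla_h b|^2\,|\nabla_h^2\Delta_h^{-1}\omega_3|+|\nabla_h^2\Delta_h^{-1}u_3|\,|\nabla\nabla_h b|\,|\nabla_h b|\,\Big]\,dx . \end{aligned}$$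
   Context: Here $u=(u_1,u_2,u_3)$, $b=(b_1,b_2,b_3):\mathbb{R}^3\times\mathbb{R}^+\to\mathbb{R}^3$ are the velocity and magnetic fields, $\pi$ is the pressure, and $\omega=\nabla\times u$ has third component $\omega_3$. Viscosity and magnetic diffusivity are normalized to $1$. Notation: $\partial_i=\partial/\partial x_i$, $\nabla_h=(\partial_1,\partial_2,0)$, $\Delta_h=\partial_1^2+\partial_2^2$. The operator $\nabla_h^2\Delta_h^{-1}$ denotes the collection of operators $\partial_i\partial_j\Delta_h^{-1}$, $i,j\in\{1,2\}$, which are the Fourier multipliers with symbol $\xi_i\xi_j/(\xi_1^2+\xi_2^2)$; $|\nabla_h^2\Delta_h^{-1}f|$ is the Euclidean norm of the collection $(\partial_i\partial_j\Delta_h^{-1}f)_{i,j=1,2}$, and similarly $|\nabla u|$, $|\nabla\nabla_h u|$, $|\nabla_h b|$, etc. are Euclidean norms of all the corresponding derivatives of all components. ''Smooth solution'' means that $u$ and $b$ are smooth and, at each time, $u$, $b$ and all their spatial derivatives lie in $L^2(\mathbb{R}^3)$. *)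

(* Defs.v *)
From HB Require Import structures.
From mathcomp Require Import all_boot all_order all_algebra.
From mathcomp Require Import all_classical all_reals all_analysis.

Set Implicit Arguments.
Unset Strict Implicit.
Unset Printing Implicit Defensive.

Import Order.TTheory GRing.Theory Num.Theory numFieldNormedType.Exports.

Local Open Scope classical_set_scope.
Local Open Scope ring_scope.

(* R^3 is the normed space R * R * R, so that the product Lebesgue measure and
   the library's derivatives are available on the same type.  The indices
   1, 2, 3 are the elements 0, 1, 2 of 'I_3; an index i is horizontal when
   (i < 2)%N. *)
Notation space3 R := (R * R * R)%type.

Definition leb3 (R : realType) :
  {measure set (measurableTypeR R * measurableTypeR R * measurableTypeR R)%type
     -> \bar R} :=
  ((@lebesgue_measure R \x @lebesgue_measure R) \x @lebesgue_measure R)%E.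

Definition c1 : 'I_3 := @Ordinal 3 0 isT.
Definition c2 : 'I_3 := @Ordinal 3 1 isT.
Definition c3 : 'I_3 := @Ordinal 3 2 isT.

Definition xcoord (R : realType) (x : space3 R) (i : 'I_3) : R :=
  tnth [tuple x.1.1; x.1.2; x.2] i.

Definition ebasis (R : realType) (i : 'I_3) : space3 R :=
  ((i == c1)%:R, (i == c2)%:R, (i == c3)%:R).

Definition pder (R : realType) (i : 'I_3) (f : space3 R -> R) : space3 R -> R :=
  fun x => 'D_(ebasis R i) f x.

Definition pders (R : realType) (s : seq 'I_3) (f : space3 R -> R) :
  space3 R -> R := foldr (@pder R) f s.

Definition lapl (R : realType) (f : space3 R -> R) : space3 R -> R :=
  fun x => \sum_(i < 3) pder i (pder i f) x.

Definition lapl_h (R : realType) (f : space3 R -> R) : space3 R -> R :=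
  fun x => \sum_(i < 3 | (i < 2)%N) pder i (pder i f) x.

Definition L2 (R : realType) (f : space3 R -> R) : Prop :=
  f \in Lfun (leb3 R) 2%:E.

(* At an endpoint of J belonging to J the time derivative is one-sided. *)
Definition tquot (R : realType) (f : R -> space3 R -> R) (t : R) (x : space3 R) :
  R -> R := fun s => (s - t)^-1 * (f s x - f t x).

Definition tderivable (R : realType) (J : interval R) (f : R -> space3 R -> R)
    (t : R) (x : space3 R) : Prop :=
  cvg (tquot f t x s @[s --> within [set` J] t^']).

Definition tpartial (R : realType) (J : interval R) (f : R -> space3 R -> R) :
  R -> space3 R -> R :=
  fun t x => lim (tquot f t x s @[s --> within [set` J] t^']).

(* Class C^k on J x R^3, jointly in time and space. *)
Fixpoint Ck (R : realType) (J : interval R) (k : nat) (f : R -> space3 R -> R) :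
  Prop :=
  {within [set p : R * space3 R | p.1 \in J],
     continuous (fun p : R * space3 R => f p.1 p.2)} /\
  if k is k'.+1 then
    [/\ forall t x, t \in J -> tderivable J f t x,
        Ck J k' (tpartial J f) &
        forall i : 'I_3,
          (forall t x, t \in J -> derivable (f t) x (ebasis R i)) /\
          Ck J k' (fun t => pder i (f t))]
  else True.

Definition smooth (R : realType) (J : interval R) (f : R -> space3 R -> R) :
  Prop := forall k, Ck J k f.

Definition vfield (R : realType) : Type := 'I_3 -> space3 R -> R.

(* advect v w is (v . nabla) w. *)
Definition advect (R : realType) (v w : vfield R) : vfield R :=
  fun k x => \sum_(i < 3) v i x * pder i (w k) x.

Definition divergence (R : realType) (v : vfield R) : space3 R -> R :=
  fun x => \sum_(i < 3) pder i (v i) x.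

Definition omega3 (R : realType) (v : vfield R) : space3 R -> R :=
  fun x => pder c1 (v c2) x - pder c2 (v c1) x.

Definition smooth_field (R : realType) (J : interval R) (v : R -> vfield R) :
  Prop :=
  (forall k, smooth J (fun t => v t k)) /\
  forall t k (s : seq 'I_3), t \in J -> L2 (pders s (v t k)).

(* J is an arbitrary nondegenerate time interval, which covers [0, T), (0, T),
   [0, T] and the half line. *)
Definition smooth_MHD_solution (R : realType) (J : interval R)
    (u b : R -> vfield R) (p : R -> space3 R -> R) : Prop :=
  [/\ exists s t, [/\ s \in J, t \in J & s < t],
      smooth_field J u /\ smooth_field J b,
      forall t x, t \in J -> differentiable (p t) x,
      forall t x, t \in J -> divergence (u t) x = 0 /\ divergence (b t) x = 0 &
      forall t x k, t \in J ->
        tpartial J (fun s => u s k) t x + advect (u t) (u t) k x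
          + pder k (p t) x
          = lapl (u t k) x + advect (b t) (b t) k x
        /\
        tpartial J (fun s => b s k) t x + advect (u t) (b t) k x
          = lapl (b t k) x + advect (b t) (u t) k x].

(* Euclidean norms |nabla v|, |nabla_h v|, |nabla nabla_h v|. *)
Definition norm_grad (R : realType) (v : vfield R) (x : space3 R) : R :=
  Num.sqrt (\sum_(k < 3) \sum_(i < 3) pder i (v k) x ^+ 2).

Definition norm_grad_h (R : realType) (v : vfield R) (x : space3 R) : R :=
  Num.sqrt (\sum_(k < 3) \sum_(i < 3 | (i < 2)%N) pder i (v k) x ^+ 2).

Definition norm_grad_grad_h (R : realType) (v : vfield R) (x : space3 R) : R :=
  Num.sqrt (\sum_(k < 3) \sum_(i < 3) \sum_(j < 3 | (j < 2)%N)
              pder i (pder j (v k)) x ^+ 2).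

(* Fourier transform on L^2(R^3) of a real-valued f: fre + i fim is the L^2
   limit, as n tends to infinity, of the integral of f(x) exp(- i x.xi) over
   the cube [-n, n]^3. *)
Definition phase (R : realType) (x xi : space3 R) : R :=
  \sum_(i < 3) xcoord x i * xcoord xi i.

Definition cube (R : realType) (n : nat) : set (space3 R) :=
  [set x | forall i, `|xcoord x i| <= n%:R].

Definition tfourier_re (R : realType) (f : space3 R -> R) (n : nat)
    (xi : space3 R) : R :=
  (\int[leb3 R]_(x in cube n) (f x * cos (phase x xi)))%R.

Definition tfourier_im (R : realType) (f : space3 R -> R) (n : nat)
    (xi : space3 R) : R :=
  - (\int[leb3 R]_(x in cube n) (f x * sin (phase x xi)))%R.

Definition L2_cvg (R : realType) (h : nat -> space3 R -> R) (g : space3 R -> R) :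
  Prop :=
  (\int[leb3 R]_x ((h n x - g x) ^+ 2)%:E)%E @[n --> \oo] --> (0 : \bar R).

Definition is_fourier (R : realType) (f fre fim : space3 R -> R) : Prop :=
  [/\ L2 f, L2 fre, L2 fim,
      L2_cvg (tfourier_re f) fre & L2_cvg (tfourier_im f) fim].

(* g is the image of f under the Fourier multiplier with real symbol m; as an
   element of L^2, g is determined by f up to a null set only. *)
Definition is_multiplier (R : realType) (m f g : space3 R -> R) : Prop :=
  exists fre fim : space3 R -> R,
    is_fourier f fre fim /\
    is_fourier g (fun xi => m xi * fre xi) (fun xi => m xi * fim xi).

Definition symb_h (R : realType) (i j : 'I_3) (xi : space3 R) : R :=
  xcoord xi i * xcoord xi j / (xcoord xi c1 ^+ 2 + xcoord xi c2 ^+ 2).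

(* G represents the collection nabla_h^2 Delta_h^-1 f. *)
Definition is_riesz_h (R : realType) (f : space3 R -> R)
    (G : 'I_3 -> 'I_3 -> space3 R -> R) : Prop :=
  forall i j : 'I_3, (i < 2)%N -> (j < 2)%N ->
    is_multiplier (symb_h i j) f (G i j).

Definition norm_riesz_h (R : realType) (G : 'I_3 -> 'I_3 -> space3 R -> R)
    (x : space3 R) : R :=
  Num.sqrt (\sum_(i < 3 | (i < 2)%N) \sum_(j < 3 | (j < 2)%N) G i j x ^+ 2).

Definition mhd_lhs (R : realType) (u b : vfield R) (x : space3 R) : R :=
  \sum_(k < 3)
    (advect u u k x * lapl_h (u k) x - advect b b k x * lapl_h (u k) x
     + advect u b k x * lapl_h (b k) x - advect b u k x * lapl_h (b k) x).

(* Gw and Gu3 stand for nabla_h^2 Delta_h^-1 applied to omega_3 and u_3. *)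
Definition mhd_rhs (R : realType) (u b : vfield R)
    (Gw Gu3 : 'I_3 -> 'I_3 -> space3 R -> R) (x : space3 R) : R :=
  `|u c3 x| * (norm_grad u x * norm_grad_grad_h u x
               + norm_grad b x * norm_grad_grad_h b x)
  + `|b c3 x| * (norm_grad u x * norm_grad_grad_h b x
                 + norm_grad b x * norm_grad_grad_h u x)
  + norm_grad_h b x ^+ 2 * norm_riesz_h Gw x
  + norm_riesz_h Gu3 x * norm_grad_grad_h b x * norm_grad_h b x.

(* Main.v *)
Require Import Defs.
From HB Require Import structures.
From mathcomp Require Import all_boot all_order all_algebra.
From mathcomp Require Import all_classical all_reals all_analysis.
From mathcomp Require Import measurable_realfun ring lra.
Import Order.TTheory GRing.Theory Num.Theory numFieldNormedType.Exports.
Local Open Scope classical_set_scope.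
Local Open Scope ring_scope.

(** Integrating by parts once in every term with a horizontal Laplacian, and using
that [u] and [b] are divergence-free, turns the left-hand side into a sum of
integrals of products of three first derivatives, at least two of them horizontal
([energy_identity]). Every such integral has to be bounded by the right-hand side.

If one of the factors is a derivative of [u c3] or [b c3], a further integration
by parts frees that component; the second derivatives that arise contain a
horizontal one, and the pointwise Cauchy-Schwarz inequality finishes the estimate
([controlled_third]). If no third component occurs, there are two cases. The terms
in [u] alone add up, by the Cayley-Hamilton identity for the horizontal gradient,
to products with the horizontal divergence of [u], which is [- d_3 u_3]
([controlled_uuu_horizontal]). Each of the other terms contains exactly one
horizontal derivative of a horizontal component of [u], which the horizontal
Biot-Savart law

  [d_a u_k = +- R_aj omega_3 - d_3 R_ak u_3],  with [R_ij = d_i d_j / Delta_h],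

expresses through the Riesz transforms of the right-hand side; the vertical
derivative is moved onto the two factors from [b] ([controlled_horizontal]).

The Biot-Savart law is the analytic core ([biot_savart]). The transforms are
given only by their symbols, through Fourier transforms that are limits in [L2].
The multiplication formula ([fourier_pairing]), applied to monomials times
Gaussians, shows that the two sides of the law have the same horizontal Laplacian
when tested against Gaussians ([riesz_even], [riesz_odd]). Their difference is
thus harmonic in the horizontal variables and built from square-integrable
functions. Pairing it with a Gaussian whose horizontal width grows by the heat
flow gives a constant that tends to zero ([heat_liouville]), so the difference
vanishes on all Gaussians, and by mollification on all test functions
([gauss_duality]).

The integrations by parts are justified in the class [Hinf] of functions all of
whose derivatives are continuous and square-integrable. A Sobolev inequality makes
its elements bounded ([Hreg_bounded]), hence the class is an algebra ([HinfM]), and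
derivatives of integrable functions have integral zero ([Int_pder0]), a quadratic
cutoff taking the place of decay at infinity. *)

Set Implicit Arguments.
Unset Strict Implicit.
Unset Printing Implicit Defensive.

(** * Integrable and square-integrable functions *)

Lemma sqr_le_norm (R : realDomainType) (a b : R) :
  `|a| <= b -> a ^+ 2 <= b ^+ 2.
Proof.
move=> ab; rewrite -(real_normK (num_real a)) lerXn2r ?nnegrE//.
exact: le_trans ab.
Qed.

Section square_integrable.
Context d (T : measurableType d) (R : realType) (mu : {measure set T -> \bar R}).
Implicit Types f g h : T -> R.

Definition intgr f := mu.-integrable setT (EFin \o f).
Definition msbl f := measurable_fun [set: T] f.
Definition sqint f := msbl f /\ intgr (fun x => f x ^+ 2).

Lemma intgr_msbl f : intgr f -> msbl f.
Proof. by move=> /measurable_int /measurable_EFinP. Qed.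

Lemma intgr_le f g : msbl f -> (forall x, `|f x| <= g x) -> intgr g -> intgr f.
Proof.
move=> mf fg; apply: le_integrable => //.
- exact/measurable_EFinP.
- by move=> x _ /=; rewrite lee_fin (le_trans (fg x))// ler_norm.
Qed.

Lemma intgrD f g : intgr f -> intgr g -> intgr (fun x => f x + g x).
Proof. by move=> fi gi; have := integrableD measurableT fi gi. Qed.

Lemma intgrB f g : intgr f -> intgr g -> intgr (fun x => f x - g x).
Proof. by move=> fi gi; have := integrableB measurableT fi gi. Qed.

Lemma intgrZ k f : intgr f -> intgr (fun x => k * f x).
Proof. by move=> fi; have := integrableZl measurableT k fi. Qed.

Lemma intgrN f : intgr f -> intgr (fun x => - f x).
Proof. by move=> /(intgrZ (-1)); congr intgr; apply/funext => x; rewrite mulN1r. Qed.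

Lemma intgr_norm f : intgr f -> intgr (fun x => `|f x|).
Proof. by move=> fi; have := integrable_abse fi. Qed.

Lemma intgr0 : intgr (fun=> 0).
Proof. exact: integrable0. Qed.

Lemma intgr_sum (I : Type) (s : seq I) (P : pred I) (F : I -> T -> R) :
  (forall i, P i -> intgr (F i)) -> intgr (fun x => \sum_(i <- s | P i) F i x).
Proof.
move=> iF; elim: s => [|i s IH].
  by have := intgr0; congr intgr; apply/funext => x; rewrite big_nil.
case: (boolP (P i)) => Pi; last first.
  by move: IH; congr intgr; apply/funext => x; rewrite big_cons (negbTE Pi).
have := intgrD (iF i Pi) IH; congr intgr.
by apply/funext => x; rewrite big_cons Pi.
Qed.

Lemma msblM f g : msbl f -> msbl g -> msbl (fun x => f x * g x).
Proof. exact: measurable_funM. Qed.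
Lemma msblD f g : msbl f -> msbl g -> msbl (fun x => f x + g x).
Proof. exact: measurable_funD. Qed.
Lemma msblN f : msbl f -> msbl (fun x => - f x).
Proof. by move=> mf; apply: measurableT_comp. Qed.
Lemma msblB f g : msbl f -> msbl g -> msbl (fun x => f x - g x).
Proof. exact: measurable_funB. Qed.
Lemma msbl_cst (c : R) : msbl (fun=> c).
Proof. exact: measurable_cst. Qed.
Lemma msbl_norm f : msbl f -> msbl (fun x => `|f x|).
Proof. by move=> mf; apply: measurableT_comp. Qed.
Lemma msbl_sum (I : Type) (s : seq I) (P : pred I) (F : I -> T -> R) :
  (forall i, P i -> msbl (F i)) -> msbl (fun x => \sum_(i <- s | P i) F i x).
Proof.
move=> iF; elim: s => [|i s IH].
  by have := msbl_cst 0; congr msbl; apply/funext => x; rewrite big_nil.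
case: (boolP (P i)) => Pi; last first.
  by move: IH; congr msbl; apply/funext => x; rewrite big_cons (negbTE Pi).
have := msblD (iF i Pi) IH; congr msbl.
by apply/funext => x; rewrite big_cons Pi.
Qed.

Lemma sqint_mul f g : sqint f -> sqint g -> intgr (fun x => f x * g x).
Proof.
move=> [mf f2] [mg g2]; apply: (intgr_le (g := fun x => f x ^+ 2 + g x ^+ 2)).
- exact: msblM.
- move=> x; have := sqr_ge0 (`|f x| - `|g x|).
  have := sqr_ge0 (`|f x|); have := sqr_ge0 (`|g x|).
  by rewrite normrM -(real_normK (num_real (f x))) -(real_normK (num_real (g x))); nra.
- exact: intgrD.
Qed.

Lemma sqintM_bounded f g (C : R) :
  msbl f -> (forall x, `|f x| <= C) -> sqint g -> sqint (fun x => f x * g x).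
Proof.
move=> mf fC [mg g2]; split; first exact: msblM.
apply: (intgr_le (g := fun x => C ^+ 2 * g x ^+ 2)).
- by under eq_fun do rewrite expr2; apply: msblM; apply: msblM.
- move=> x; rewrite ger0_norm ?sqr_ge0// exprMn.
  by rewrite ler_wpM2r ?sqr_ge0// sqr_le_norm.
- exact: intgrZ.
Qed.

Lemma sqintD f g : sqint f -> sqint g -> sqint (fun x => f x + g x).
Proof.
move=> fL gL; have fg := sqint_mul fL gL; move: fL gL => [mf f2] [mg g2].
split; first exact: msblD.
have := intgrD (intgrD f2 g2) (intgrZ 2 fg); congr intgr.
by apply/funext => x /=; ring.
Qed.

Lemma sqintZ k f : sqint f -> sqint (fun x => k * f x).
Proof.
move=> fL; apply: (@sqintM_bounded (fun=> k) f `|k|) => //; exact: msbl_cst.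
Qed.

Lemma sqintN f : sqint f -> sqint (fun x => - f x).
Proof. by move=> /(sqintZ (-1)); congr sqint; apply/funext => x; rewrite mulN1r. Qed.

Lemma sqintB f g : sqint f -> sqint g -> sqint (fun x => f x - g x).
Proof. by move=> fL gL; apply: sqintD fL (sqintN gL). Qed.

Lemma sqint_le f g : msbl f -> (forall x, `|f x| <= `|g x|) -> sqint g -> sqint f.
Proof.
move=> mf fg [mg g2]; split=> //; apply: intgr_le g2.
- by under eq_fun do rewrite expr2; apply: msblM.
- move=> x; rewrite ger0_norm ?sqr_ge0// -[leRHS]real_normK ?num_real//.
  exact: sqr_le_norm.
Qed.

Local Notation I f := (\int[mu]_x (f x))%R.

Lemma IntD f g : intgr f -> intgr g -> I (fun x => f x + g x) = I f + I g.
Proof. by move=> fi gi; rewrite RintegralD. Qed.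
Lemma IntB f g : intgr f -> intgr g -> I (fun x => f x - g x) = I f - I g.
Proof. by move=> fi gi; rewrite RintegralB. Qed.
Lemma IntZ k f : intgr f -> I (fun x => k * f x) = k * I f.
Proof. by move=> fi; rewrite RintegralZl. Qed.
Lemma IntN f : intgr f -> I (fun x => - f x) = - I f.
Proof.
move=> fi; rewrite -mulN1r -IntZ//; congr Rintegral.
by apply/funext => x; rewrite mulN1r.
Qed.
Lemma Int_sum (J : Type) (s : seq J) (P : pred J) (F : J -> T -> R) :
  (forall i, P i -> intgr (F i)) ->
  I (fun x => \sum_(i <- s | P i) F i x) = \sum_(i <- s | P i) I (F i).
Proof.
move=> iF; elim: s => [|i s IH].
  rewrite big_nil; under eq_Rintegral do rewrite big_nil.
  by rewrite /Rintegral integral0.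
rewrite big_cons; under eq_Rintegral do rewrite big_cons.
case: ifP => // Pi; rewrite IntD ?IH//; first exact: iF.
exact: intgr_sum.
Qed.

Lemma eq_Int f g : f =1 g -> I f = I g.
Proof. by move=> fg; congr Rintegral; apply/funext. Qed.

Lemma le_Int f g : intgr f -> intgr g -> (forall x, f x <= g x) -> I f <= I g.
Proof. by move=> fi gi fg; apply: le_Rintegral. Qed.

Lemma le_abs_Int f g : intgr f -> intgr g -> (forall x, `|f x| <= g x) ->
  `|I f| <= I g.
Proof.
move=> fi gi fg; apply: (le_trans (le_normr_Rintegral measurableT fi)).
by apply: le_Rintegral => //; exact: intgr_norm.
Qed.

Lemma Int_EFin f : intgr f -> (\int[mu]_x (f x)%:E)%E = (I f)%:E.
Proof.
by move=> fi; rewrite /Rintegral fineK//; exact: integrable_fin_num.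
Qed.

Lemma Int_cvg (f_ : nat -> T -> R) f g : (forall n, msbl (f_ n)) ->
  (forall x, f_ n x @[n --> \oo] --> f x) -> intgr g ->
  (forall n x, `|f_ n x| <= g x) -> I (f_ n) @[n --> \oo] --> I f.
Proof.
move=> mf_ ff gi fg.
have mf : msbl f.
  by apply: (measurable_fun_cvg (h := f_)) => // x _; exact: ff.
have fi : intgr f.
  apply: intgr_le gi => // x.
  have cf : `|f_ n x| @[n --> \oo] --> `|f x| by apply: cvg_norm; exact: ff.
  rewrite -(cvg_lim _ cf)//; apply: limr_le; first by apply/cvg_ex; eexists; exact: cf.
  by apply: nearW => n; exact: fg.
apply: fine_cvg; rewrite -Int_EFin//.
apply: (@dominated_cvg _ _ _ mu _ measurableT (fun n x => (f_ n x)%:E) (EFin \o f) (EFin \o g)) => //.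
- by move=> n; apply/measurable_EFinP; exact: mf_.
- by move=> x _; apply: cvg_EFin; [exact: nearW|exact: ff].
- by move=> n x _; rewrite lee_fin; exact: fg.
Qed.

(** The weighted arithmetic-geometric form of the Cauchy-Schwarz inequality:
with [l] free it yields every limiting argument below without square roots. *)
Lemma Int_mul_le (l : R) f g : 0 < l -> sqint f -> sqint g ->
  `|I (fun x => f x * g x)| <=
    l * I (fun x => f x ^+ 2) + l^-1 * I (fun x => g x ^+ 2).
Proof.
move=> l0 fL gL; have fgi := sqint_mul fL gL; move: fL gL => [mf f2] [mg g2].
rewrite -!IntZ// -IntD; [|exact: intgrZ..].
apply: le_abs_Int => //; first by apply: intgrD; exact: intgrZ.
move=> x; rewrite normrM.
have l10 : 0 < l^-1 by rewrite invr_gt0.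
have ll : l * l^-1 = 1 by rewrite divff// gt_eqF.
rewrite -(real_normK (num_real (f x))) -(real_normK (num_real (g x))).
have f0 := normr_ge0 (f x); have g0 := normr_ge0 (g x).
have h : 0 <= l^-1 * (l * `|f x| - `|g x|) ^+ 2 by rewrite mulr_ge0 ?sqr_ge0 ?ltW.
have e : l^-1 * (l * `|f x| - `|g x|) ^+ 2 =
  l * `|f x| ^+ 2 - 2 * `|f x| * `|g x| + l^-1 * `|g x| ^+ 2 by field; rewrite gt_eqF.
rewrite e in h.
have := mulr_ge0 f0 g0; nra.
Qed.

End square_integrable.

Arguments intgr {d T R} mu f.
Arguments sqint {d T R} mu f.
Arguments msbl {d T R} f.

(** * Lines and integrals in three-dimensional space *)

Notation mspace3 R := (measurableTypeR R * measurableTypeR R * measurableTypeR R)%type.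
Notation leb1 R := (@lebesgue_measure R).
Notation intgr1 R := (@intgr _ (measurableTypeR R) R (@lebesgue_measure R)).
Notation intgr3 R := (@intgr _ (mspace3 R) R (leb3 R)).
Notation sqint1 R := (@sqint _ (measurableTypeR R) R (@lebesgue_measure R)).
Notation sqint3 R := (@sqint _ (mspace3 R) R (leb3 R)).
Notation msbl1 R := (@msbl _ (measurableTypeR R) R).
Notation msbl3 R := (@msbl _ (mspace3 R) R).

Lemma ord3P (i : 'I_3) : [\/ i = c1, i = c2 | i = c3].
Proof.
by case: i => [[|[|[|//]]]] p; [apply: Or31|apply: Or32|apply: Or33]; apply: val_inj.
Qed.

Lemma sum3E (V : nmodType) (F : 'I_3 -> V) :
  \sum_(i < 3) F i = F c1 + F c2 + F c3.
Proof.
rewrite !big_ord_recr big_ord0 /= add0r.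
by congr (F _ + F _ + F _); apply: val_inj.
Qed.

Lemma sum3hE (V : nmodType) (F : 'I_3 -> V) :
  \sum_(i < 3 | (i < 2)%N) F i = F c1 + F c2.
Proof. by rewrite big_mkcond sum3E /= addr0. Qed.

Section product_sigma_finite.
Local Open Scope ereal_scope.
Context d1 d2 (T1 : measurableType d1) (T2 : measurableType d2) (R : realType).
Variable m1 : {sigma_finite_measure set T1 -> \bar R}.
Variable m2 : {sigma_finite_measure set T2 -> \bar R}.

Lemma sigma_finite_product : sigma_finite setT (m1 \x m2).
Proof.
have /sigma_finiteP[F [FT ndF Foo]] := sigma_finiteT m1.
have /sigma_finiteP[G [GT ndG Goo]] := sigma_finiteT m2.
exists (fun n => F n `*` G n).
  rewrite -setXTT FT GT; apply/seteqP; split=> [[x y] /= [[n _ Fx] [k _ Gy]]|].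
    exists (maxn n k) => //; split.
    - by move: x Fx; exact/subsetPset/ndF/leq_maxl.
    - by move: y Gy; exact/subsetPset/ndG/leq_maxr.
  by move=> [x y] /= [n _ [Fx Gy]]; split; exists n.
move=> k; have [mF Fk] := Foo k; have [mG Gk] := Goo k.
split; first exact: measurableX.
by rewrite product_measure1E// lte_mul_pinfty// ge0_fin_numE.
Qed.
End product_sigma_finite.

(** The product measures are renamed so that they can carry the
sigma-finiteness that Fubini's theorem asks for. *)
Definition leb2s (R : realType) :
  set (measurableTypeR R * measurableTypeR R)%type -> \bar R :=
  (@lebesgue_measure R \x @lebesgue_measure R)%E.
HB.instance Definition _ (R : realType) := Measure.on (@leb2s R).
HB.instance Definition _ (R : realType) := Measure_isSigmaFinite.Build _ _ _
  (@leb2s R) (sigma_finite_product (@lebesgue_measure R) (@lebesgue_measure R)).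

Definition leb3s (R : realType) : set (mspace3 R) -> \bar R :=
  (@leb2s R \x @lebesgue_measure R)%E.
HB.instance Definition _ (R : realType) := Measure.on (@leb3s R).
HB.instance Definition _ (R : realType) := Measure_isSigmaFinite.Build _ _ _
  (@leb3s R) (sigma_finite_product (@leb2s R) (@lebesgue_measure R)).

Section slices.
Context {R : realType}.
Implicit Types (x y : space3 R) (i : 'I_3).

(** Replacing one coordinate parametrizes the line through [x] parallel to the
[i]-th axis. *)
Definition upd x i (z : R) : space3 R :=
  (if i == c1 then z else x.1.1, if i == c2 then z else x.1.2,
   if i == c3 then z else x.2).

Lemma xcoord_upd x i z : xcoord (upd x i z) i = z.
Proof. by case: (ord3P i) => ->. Qed.

Lemma upd_shift x i (z t : R) :
  upd x i (t *: (1 : R) + z) = t *: ebasis R i + upd x i z.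
Proof.
transitivity (t * (ebasis R i).1.1 + (upd x i z).1.1,
  t * (ebasis R i).1.2 + (upd x i z).1.2, t * (ebasis R i).2 + (upd x i z).2) => //.
have e : t *: (1 : R) = t by exact: mulr1.
by case: (ord3P i) => -> /=; rewrite /upd /= e !mulr0 !mulr1 !add0r.
Qed.

Lemma upd_xcoord x i : upd x i (xcoord x i) = x.
Proof. by case: x => [[a b] c]; case: (ord3P i) => ->. Qed.

Lemma continuous_upd x i : continuous (upd x i).
Proof.
have -> : upd x i = fun z => z *: ebasis R i + upd x i 0.
  by apply/funext => z; rewrite -upd_shift addr0 /GRing.scale /= mulr1.
by move=> z; apply: cvgD; [apply: cvgZr_tmp; exact: cvg_id|exact: cvg_cst].
Qed.

Lemma slice_is_derive (h : space3 R -> R) x i z :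
  derivable h (upd x i z) (ebasis R i) ->
  is_derive z 1 (fun z => h (upd x i z)) (pder i h (upd x i z)).
Proof.
move=> dh.
have e : (fun t : R => t^-1 *: (h (upd x i (t *: (1 : R) + z)) - h (upd x i z))) =
   (fun t : R => t^-1 *: (h (t *: ebasis R i + upd x i z) - h (upd x i z))).
  by apply/funext => t; rewrite upd_shift.
apply: DeriveDef.
- by rewrite /derivable /=; move: dh; rewrite /derivable /= -e.
- by rewrite /pder /derive /= -e.
Qed.

Lemma measurable_xcoord i : msbl3 R (fun x => xcoord x i).
Proof.
case: (ord3P i) => ->; rewrite /xcoord /= /tnth /=.
- by apply: (measurableT_comp measurable_fst); exact: measurable_fst.
- by apply: (measurableT_comp measurable_snd); exact: measurable_fst.
- exact: measurable_snd.
Qed.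

Local Open Scope ereal_scope.

Local Notation l1 := (@lebesgue_measure R).
Local Notation l2 := (@leb2s R).

Lemma tonelli3 (F : mspace3 R -> \bar R) : measurable_fun setT F -> (forall x, 0 <= F x) ->
  \int[leb3 R]_x F x =
  \int[leb1 R]_a \int[leb1 R]_b \int[leb1 R]_c F ((a, b), c).
Proof.
move=> mF F0.
transitivity (\int[l2]_p fubini_F l1 F p).
  exact: (fubini_tonelli1 (m1 := l2) (m2 := l1) F).
rewrite (fubini_tonelli1 (m1 := l1) (m2 := l1))//.
- exact: (measurable_fun_fubini_tonelli_F (m2 := l1)).
- by move=> x; apply: integral_ge0 => y _; exact: F0.
Qed.

Lemma tonelli3_last_outer (F : mspace3 R -> \bar R) : measurable_fun setT F -> (forall x, 0 <= F x) ->
  \int[leb3 R]_x F x = \int[l1]_c \int[l2]_p F (p, c).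
Proof.
by move=> mF F0; exact: (fubini_tonelli2 (m1 := l2) (m2 := l1) F).
Qed.

(** Fubini's theorem along an arbitrary axis, phrased without naming the plane of
lines parallel to it. *)
Lemma tonelli_slice i (F G : mspace3 R -> \bar R) :
  measurable_fun setT F -> (forall x, 0 <= F x) ->
  measurable_fun setT G -> (forall x, 0 <= G x) ->
  (forall x, \int[leb1 R]_z F (upd x i z) = \int[leb1 R]_z G (upd x i z)) ->
  \int[leb3 R]_x F x = \int[leb3 R]_x G x.
Proof.
move=> mF F0 mG G0 FG.
have ms (H : mspace3 R -> \bar R) (c : R) : measurable_fun setT H ->
    measurable_fun [set: measurableTypeR R * measurableTypeR R] (fun p => H (p, c)).
  by move=> mH; apply: (measurableT_comp mH); exact: pair2_measurable.
case: (ord3P i) FG => -> FG.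
- rewrite (tonelli3_last_outer mF F0) (tonelli3_last_outer mG G0); apply: eq_integral => c _.
  transitivity (\int[l1]_b \int[l1]_a F ((a, b), c)).
    exact: (fubini_tonelli2 (m1 := l1) (m2 := l1) (fun p => F (p, c)) (ms _ _ mF)).
  transitivity (\int[l1]_b \int[l1]_a G ((a, b), c)); last first.
    apply/esym; exact: (fubini_tonelli2 (m1 := l1) (m2 := l1) (fun p => G (p, c)) (ms _ _ mG)).
  by apply: eq_integral => b _; exact: (FG ((0%R, b), c)).
- rewrite (tonelli3_last_outer mF F0) (tonelli3_last_outer mG G0); apply: eq_integral => c _.
  transitivity (\int[l1]_a \int[l1]_b F ((a, b), c)).
    exact: (fubini_tonelli1 (m1 := l1) (m2 := l1) (fun p => F (p, c)) (ms _ _ mF)).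
  transitivity (\int[l1]_a \int[l1]_b G ((a, b), c)); last first.
    apply/esym; exact: (fubini_tonelli1 (m1 := l1) (m2 := l1) (fun p => G (p, c)) (ms _ _ mG)).
  by apply: eq_integral => a _; exact: (FG ((a, 0%R), c)).
- rewrite (tonelli3 mF F0) (tonelli3 mG G0); apply: eq_integral => a _; apply: eq_integral => b _.
  exact: (FG ((a, b), 0%R)).
Qed.

End slices.

(** * The divergence theorem on the whole space *)

Section line_calculus.
Context {R : realType}.
Implicit Types F f s : R -> R.

Lemma is_derive_continuous F f : (forall z : R, is_derive z 1 F (f z)) -> continuous F.
Proof.
move=> dF z; apply: differentiable_continuous; apply/derivable1_diffP.
by have [] := dF z.
Qed.

Lemma FTC_line F f (a b : R) : a < b -> (forall z : R, is_derive z 1 F (f z)) ->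
  continuous f -> (\int[leb1 R]_(z in `[a, b]) (f z)%:E = (F b - F a)%:E)%E.
Proof.
move=> ab dF cf; have cF := is_derive_continuous dF.
rewrite EFinB; apply: continuous_FTC2 => //.
- exact: continuous_subspaceT.
- split; first by move=> z _; have [] := dF z.
  + by apply: cvg_at_right_filter; exact: cF.
  + by apply: cvg_at_left_filter; exact: cF.
- by move=> z _; rewrite derive1E; apply: (@derive_val _ _ _ _ _ _ _ (dF z)).
Qed.

Definition cutoff (N z : R) : R := \1_(`[- N, N]%classic) z.

(** The factor [1 - (z / N) ^+ 2] vanishes at both ends of [[- N, N]], so that
integrating its product with [s'] by parts leaves no boundary term, however large
[s] is. *)
Lemma cutoff_line s s' (N : R) : 0 < N ->
  (forall z : R, is_derive z 1 s (s' z)) -> continuous s' ->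
  let q z := cutoff N z * (s' z * (1 - (z / N) ^+ 2) - s z * (2 * z / N ^+ 2)) in
  intgr1 R q /\ (\int[leb1 R]_z (q z)%:E = 0)%E.
Proof.
move=> N0 ds cs' q.
pose F z := s z * (1 - (z / N) ^+ 2).
pose f z := s' z * (1 - (z / N) ^+ 2) - s z * (2 * z / N ^+ 2).
have cs := is_derive_continuous ds.
have dF (z : R) : is_derive z 1 F (f z).
  apply: is_derive_eq; rewrite /GRing.scale /=; rewrite /f.
  by field; rewrite gt_eqF.
have cf : continuous f.
  move=> z; rewrite /f.
  apply: cvgB; apply: cvgM; [exact: cs'| |exact: cs|].
  - apply: cvgB; first exact: cvg_cst.
    rewrite expr2; under eq_fun do rewrite expr2.
    by apply: cvgM; apply: cvgM; [exact: cvg_id|exact: cvg_cst|exact: cvg_id|exact: cvg_cst].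
  - by apply: cvgM; [apply: cvgM; [exact: cvg_cst|exact: cvg_id]|exact: cvg_cst].
have qE : (EFin \o q) = ((EFin \o f) \_ `[- N, N]).
  by apply/funext => z; rewrite patchE /q /cutoff /= indicE; case: ifP => _; rewrite ?mul1r ?mul0r.
split.
  rewrite /intgr qE -integrable_mkcond; last exact: measurable_itv.
  apply: continuous_compact_integrable; first exact: segment_compact.
  exact: continuous_subspaceT.
transitivity (\int[leb1 R]_(z in `[(- N)%R, N]) (f z)%:E)%E.
  by rewrite [RHS]integral_mkcond -qE.
rewrite (FTC_line _ dF cf) ?gtrN//.
by rewrite /F mulNr sqrrN divff ?gt_eqF// expr1n subrr !mulr0 subrr.
Qed.

End line_calculus.

Lemma cutoffE {R : realType} (N z : R) : cutoff N z = (`|z| <= N)%R%:R.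
Proof. by rewrite /cutoff indicE mem_setE in_itv /= ler_norml. Qed.

Lemma measurable_cutoff {R : realType} (N : R) : msbl1 R (cutoff N).
Proof. by apply: measurable_indic. Qed.

Section integration_by_parts.
Context {R : realType}.
Implicit Types (h : space3 R -> R) (x : space3 R).

Lemma eq_int_pos_neg d (T : measurableType d) (mu : {measure set T -> \bar R})
    (f : T -> \bar R) : mu.-integrable setT f -> (\int[mu]_z f z = 0)%E ->
  (\int[mu]_z f^\+ z = \int[mu]_z f^\- z)%E.
Proof.
move=> qi; rewrite integralE => /eqP; rewrite sube_eq ?add0e; first by move/eqP.
- exact: integrable_pos_fin_num.
- by rewrite fin_num_adde_defl// integrable_neg_fin_num.
Qed.

Lemma integral_slice0 i (f : mspace3 R -> \bar R) : (leb3 R).-integrable setT f ->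
  (forall x, (leb1 R).-integrable setT (fun z => f (upd x i z)) /\
     (\int[leb1 R]_z f (upd x i z) = 0)%E) ->
  (\int[leb3 R]_x f x = 0)%E.
Proof.
move=> fi fl; have mf := measurable_int _ fi.
rewrite integralE (tonelli_slice (i := i) (G := (f^\-)%E)).
- by rewrite subee// integrable_neg_fin_num.
- exact: measurable_funepos.
- by move=> x; exact: funepos_ge0.
- exact: measurable_funeneg.
- by move=> x; exact: funeneg_ge0.
move=> x; have [li l0] := fl x.
under eq_integral do rewrite funeposE.
under [RHS]eq_integral do rewrite funenegE.
have := eq_int_pos_neg li l0.
under eq_integral do rewrite funeposE.
by under [X in _ = X -> _]eq_integral do rewrite funenegE.
Qed.

(** The divergence theorem on the whole space, for a single direction. Cutting
off in the [i]-th coordinate makes the integral vanish along every line, hence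
altogether by Tonelli's theorem for the positive and negative parts; the cutoff
is then removed by dominated convergence. *)
Lemma Int_pder0 i h : (forall x, derivable h x (ebasis R i)) ->
  (forall x, continuous (fun z => pder i h (upd x i z))) ->
  intgr3 R h -> intgr3 R (pder i h) -> \int[leb3 R]_x (pder i h x) = 0.
Proof.
move=> dh ch hi dhi.
pose q (N : R) x := cutoff N (xcoord x i) *
  (pder i h x * (1 - (xcoord x i / N) ^+ 2) - h x * (2 * xcoord x i / N ^+ 2)).
have mx : msbl3 R (fun x => xcoord x i) by exact: measurable_xcoord.
have mq N : msbl3 R (q N).
  apply: msblM; first exact: (measurableT_comp (measurable_cutoff N) mx).
  apply: msblB; apply: msblM; [exact: intgr_msbl dhi| |exact: intgr_msbl hi|].
  - apply: msblB; first exact: msbl_cst.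
    by apply: measurable_funX; apply: msblM; [exact: mx|exact: msbl_cst].
  - by apply: msblM; [apply: msblM; [exact: msbl_cst|exact: mx]|exact: msbl_cst].
pose g x := `|pder i h x| + 2 * `|h x|.
have gi : intgr3 R g by apply: intgrD; [exact: intgr_norm|apply: intgrZ; exact: intgr_norm].
(* On the support of the cutoff both weights are bounded, uniformly in [N]. *)
have qg N x : 1 <= N -> `|q N x| <= g x.
  move=> N1; rewrite /q cutoffE; set z := xcoord x i.
  have N0 : 0 < N by rewrite (lt_le_trans ltr01).
  case: (leP `|z| N) => zN; last by rewrite mul0r normr0 addr_ge0// mulr_ge0.
  rewrite mul1r; apply: (le_trans (ler_normB _ _)); rewrite /g !normrM.
  have zN1 : (z / N) ^+ 2 <= 1.
    rewrite -(real_normK (num_real (z / N))) expr_le1// normrM normfV.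
    by rewrite (gtr0_norm N0) ler_pdivrMr// mul1r.
  apply: lerD.
  - rewrite -[leRHS]mulr1 ler_wpM2l// ger0_norm ?subr_ge0// lerBlDr lerDl.
    exact: sqr_ge0.
  - rewrite mulrC ler_wpM2r// normfV normrX (gtr0_norm N0) normr_nat.
    rewrite ler_pdivrMr ?exprn_gt0// ler_pM2l// expr2.
    by rewrite (le_trans zN)// ler_peMr// ltW.
(* Along each line [q N] is the derivative of a function vanishing at both ends. *)
have q0 N : 1 <= N -> \int[leb3 R]_x (q N x) = 0.
  move=> N1; have N0 : 0 < N by rewrite (lt_le_trans ltr01).
  have qi : intgr3 R (q N) by apply: (intgr_le (mq N) _ gi) => x; exact: qg.
  rewrite /Rintegral (integral_slice0 (i := i))// => x.
  pose s z := h (upd x i z).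
  have ds (z : R) : is_derive z 1 s (pder i h (upd x i z)) by exact: slice_is_derive.
  have := cutoff_line N0 ds (ch x).
  set q' := (fun z : R => _) => -[q'i q'0].
  have -> : (fun z => (EFin \o q N) (upd x i z)) = EFin \o q'.
    by apply/funext => z; rewrite /= /q xcoord_upd.
  by split.
have cvg_q x : q n.+1%:R x @[n --> \oo] --> pder i h x.
  set z := xcoord x i; pose e n : R := harmonic n.
  have e0 : e n @[n --> \oo] --> (0 : R) by exact: cvg_harmonic.
  have : pder i h x * (1 - (z * e n) * (z * e n)) - h x * (2 * z * (e n * e n)) @[n --> \oo]
     --> pder i h x * (1 - (z * 0) * (z * 0)) - h x * (2 * z * (0 * 0)).
    apply: cvgB; apply: cvgM; try exact: cvg_cst.
    - apply: cvgB; first exact: cvg_cst.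
      by apply: cvgM; apply: cvgM => //; exact: cvg_cst.
    - by apply: cvgM; [exact: cvg_cst|exact: cvgM].
  rewrite !mulr0 !subr0 mulr1; apply: cvg_trans.
  apply: near_eq_cvg; near=> n.
  have zn : `|z| <= n.+1%:R.
    rewrite (@le_trans _ _ n%:R) ?ler_nat//; near: n; exact: nbhs_infty_ger.
  by rewrite /q cutoffE zn mul1r /e /harmonic -exprVn -!expr2.
have qg1 (n : nat) x : `|q n.+1%:R x| <= g x by apply: qg; rewrite ler1n.
have := Int_cvg (fun n => mq n.+1%:R) cvg_q gi qg1.
rewrite (_ : (fun n : nat => _) = fun=> 0).
  by move=> /(@cvg_lim _ _) <- //; apply/cvg_lim => //; exact: cvg_cst.
by apply/funext => n; apply: q0; rewrite ler1n.
Unshelve. all: by end_near.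
Qed.
End integration_by_parts.

(** * A Sobolev bound *)

Section sobolev_line.
Context {R : realType}.

(** A one-dimensional Sobolev inequality, obtained by integrating the derivative
of [(z - a - 1) * S z] over [[a, a + 1]]. *)
Lemma sobolev_line (S S' G : R -> R) (a : R) :
  (forall z : R, is_derive z 1 S (S' z)) -> continuous S' -> continuous G ->
  (forall z, 0 <= S z) -> (forall z, S z + `|S' z| <= G z) ->
  ((S a)%:E <= \int[leb1 R]_z (G z)%:E)%E.
Proof.
move=> dS cS' cG S0 SG; have cS := is_derive_continuous dS.
pose F z := (z - (a + 1)) * S z.
pose f z := S z + (z - (a + 1)) * S' z.
have dF (z : R) : is_derive z 1 F (f z).
  by apply: is_derive_eq; rewrite /GRing.scale /= /f; ring.
have cf : continuous f.
  move=> z; apply: cvgD; first exact: cS.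
  by apply: cvgM; [apply: cvgB; [exact: cvg_id|exact: cvg_cst]|exact: cS'].
have aa : a < a + 1 by rewrite ltrDl.
have FE : F (a + 1) - F a = S a by rewrite /F; ring.
rewrite -FE -(FTC_line aa dF cf).
apply: (@le_trans _ _ (\int[leb1 R]_(z in `[a, (a + 1)%R]) (G z)%:E)%E).
  apply: le_integral => //.
  - by apply: continuous_compact_integrable; [exact: segment_compact|exact: continuous_subspaceT].
  - by apply: continuous_compact_integrable; [exact: segment_compact|exact: continuous_subspaceT].
  move=> z; rewrite inE /= in_itv /= => /andP[az za].
  rewrite lee_fin (le_trans _ (SG z))// lerD2l (le_trans (ler_norm _))// normrM.
  by rewrite ler_piMl// ler_norml; apply/andP; split; lra.
apply: ge0_subset_integral => //.
- by apply/measurable_EFinP; exact: continuous_measurable_fun.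
- by move=> z _; rewrite lee_fin (le_trans _ (SG z))// addr_ge0.
Qed.

End sobolev_line.

Section sobolev.
Context {R : realType}.
Implicit Types (f g h : space3 R -> R) (fs : seq (space3 R -> R)).

(** Classical derivatives up to order [k], continuous and square-integrable. *)
Fixpoint Hreg (k : nat) f : Prop := [/\ continuous f, sqint3 R f &
  if k is k'.+1 then forall i : 'I_3, (forall x, derivable f x (ebasis R i)) /\
     Hreg k' (pder i f) else True].

Lemma Hreg_continuous k f : Hreg k f -> continuous f.
Proof. by case: k => [|k] []. Qed.
Lemma Hreg_sqint k f : Hreg k f -> sqint3 R f.
Proof. by case: k => [|k] []. Qed.
Lemma Hreg_derivable k f i x : Hreg k.+1 f -> derivable f x (ebasis R i).
Proof. by case=> _ _ /(_ i)[]. Qed.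
Lemma Hreg_pder k f i : Hreg k.+1 f -> Hreg k (pder i f).
Proof. by case=> _ _ /(_ i)[]. Qed.
Lemma HregW k f : Hreg k.+1 f -> Hreg k f.
Proof.
elim: k f => [|k IH] f [cf sf df] //=; split=> // i; have [d dd] := df i.
by split=> //; exact: IH.
Qed.
Lemma Hreg_msbl k f : Hreg k f -> msbl3 R f.
Proof. by move=> /Hreg_sqint[]. Qed.

Lemma continuous_slice f i x : continuous f -> continuous (fun z => f (upd x i z)).
Proof. by move=> cf z; apply: continuous_comp; [exact: continuous_upd|exact: cf]. Qed.

Lemma Hreg_slice k f i x (z : R) : Hreg k.+1 f ->
  is_derive z 1 (fun z => f (upd x i z)) (pder i f (upd x i z)).
Proof. by move=> Hf; apply: slice_is_derive; exact: Hreg_derivable Hf. Qed.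

Definition sumsq fs x : R := \sum_(f <- fs) f x ^+ 2.
(** Each further direction of integration in the Sobolev bound costs the
derivatives in that direction of all the functions collected so far. *)
Definition add_pder i fs := fs ++ map (pder i) fs.

Lemma sumsq_ge0 fs x : 0 <= sumsq fs x.
Proof. by apply: sumr_ge0 => f _; exact: sqr_ge0. Qed.

Lemma add_pder_Hreg k i fs : (forall f, List.In f fs -> Hreg k.+1 f) ->
  forall f, List.In f (add_pder i fs) -> Hreg k f.
Proof.
move=> H f fin; have [/H /HregW //|] := List.in_app_or _ _ _ fin.
move=> /(proj1 (List.in_map_iff _ _ _)) [g [<- /H]]; exact: Hreg_pder.
Qed.

Arguments add_pder_Hreg {k} i {fs}.

Lemma continuous_sumsq k fs : (forall f, List.In f fs -> Hreg k f) ->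
  continuous (sumsq fs).
Proof.
elim: fs => [|f fs IH] H x.
  by rewrite (_ : sumsq [::] = fun=> 0); [exact: cvg_cst|apply/funext => y; rewrite /sumsq big_nil].
rewrite (_ : sumsq (f :: fs) = fun y => f y * f y + sumsq fs y); last first.
  by apply/funext => y; rewrite /sumsq big_cons expr2.
have cf : continuous f by apply: (@Hreg_continuous k); apply: H; left.
apply: cvgD; first by apply: cvgM; exact: cf.
by apply: IH => g Hg; apply: H; right.
Qed.

Lemma intgr_sumsq k fs : (forall f, List.In f fs -> Hreg k f) ->
  intgr3 R (sumsq fs).
Proof.
elim: fs => [|f fs IH] H.
  rewrite (_ : sumsq [::] = fun=> 0); first exact: intgr0.
  by apply/funext => y; rewrite /sumsq big_nil.
rewrite (_ : sumsq (f :: fs) = fun y => f y ^+ 2 + sumsq fs y); last first.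
  by apply/funext => y; rewrite /sumsq big_cons.
apply: intgrD; first by have [] : sqint3 R f by apply: (@Hreg_sqint k); apply: H; left.
by apply: IH => g Hg; apply: H; right.
Qed.

(** The one-dimensional Sobolev inequality for a sum of squares, whose derivative
[2 f f'] is at most [f ^+ 2 + f' ^+ 2]. *)
Lemma sumsq_slice k i fs x : (forall f, List.In f fs -> Hreg k.+1 f) ->
  ((sumsq fs x)%:E <= \int[leb1 R]_z (2 * sumsq (add_pder i fs) (upd x i z))%:E)%E.
Proof.
move=> H.
pose S z := sumsq fs (upd x i z).
pose S' z := \sum_(f <- fs) 2 * f (upd x i z) * pder i f (upd x i z).
have dS (z : R) : is_derive z 1 S (S' z).
  rewrite /S /S' /sumsq; elim: fs H {S S'} => [|f fs IH] H.
    rewrite big_nil (_ : (fun _ => _) = cst 0); first exact: is_derive_cst.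
    by apply/funext => y; rewrite big_nil.
  rewrite big_cons (_ : (fun _ => _) = (fun y => f (upd x i y) ^+ 2) +
     (fun y => \sum_(f0 <- fs) f0 (upd x i y) ^+ 2)); last first.
    by apply/funext => y; rewrite big_cons.
  apply: is_deriveD; last by apply: IH => g Hg; apply: H; right.
  have Hf : Hreg k.+1 f by apply: H; left.
  have df := Hreg_slice i x z Hf.
  by apply: is_derive_eq; rewrite /GRing.scale /=; ring.
have cS' : continuous S'.
  rewrite /S'; elim: fs H {S S' dS} => [|f fs IH] H z.
    rewrite (_ : (fun _ => _) = cst 0); first exact: cvg_cst.
    by apply/funext => y; rewrite big_nil.
  rewrite (_ : (fun _ => _) = (fun y => 2 * f (upd x i y) * pder i f (upd x i y) +
     \sum_(f0 <- fs) 2 * f0 (upd x i y) * pder i f0 (upd x i y))); last first.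
    by apply/funext => y; rewrite big_cons.
  have Hf : Hreg k.+1 f by apply: H; left.
  apply: cvgD; last by apply: IH => g Hg; apply: H; right.
  apply: cvgM; last exact: (continuous_slice (Hreg_continuous (Hreg_pder i Hf))).
  apply: cvgM; first exact: cvg_cst.
  exact: (continuous_slice (Hreg_continuous Hf)).
have e : sumsq fs x = S (xcoord x i) by rewrite /S upd_xcoord.
rewrite e; apply: (sobolev_line (S' := S')) => //.
- move=> z; apply: cvgM; first exact: cvg_cst.
  exact: (continuous_slice (continuous_sumsq (add_pder_Hreg i H))).
- by move=> z; exact: sumsq_ge0.
move=> z; rewrite /S /S' /sumsq big_cat /= big_map.
have := sumsq_ge0 fs (upd x i z); have := sumsq_ge0 (map (pder i) fs) (upd x i z).
rewrite /sumsq big_map => h1 h2.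
suff : `|\sum_(f <- fs) 2 * f (upd x i z) * pder i f (upd x i z)| <=
   \sum_(f <- fs) f (upd x i z) ^+ 2 + \sum_(f <- fs) pder i f (upd x i z) ^+ 2 by lra.
rewrite (le_trans (ler_norm_sum _ _ _))// -big_split /=; apply: ler_sum => f _.
set p := f _; set q := pder i f _; rewrite ler_norml; apply/andP; split.
  by have := sqr_ge0 (p + q); nra.
by have := sqr_ge0 (p - q); nra.
Qed.

(** Functions with three square-integrable derivatives are bounded: the
one-dimensional inequality is applied once in each direction. *)
Lemma Hreg_bounded f : Hreg 3 f -> exists C, forall x, `|f x| <= C.
Proof.
move=> Hf.
pose l0 := [:: f]; pose l1 := add_pder c1 l0; pose l2 := add_pder c2 l1; pose l3 := add_pder c3 l2.
have H0 g : List.In g l0 -> Hreg 3 g by move=> [<-|[]]; exact: Hf.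
have H1 := add_pder_Hreg c1 H0; have H2 := add_pder_Hreg c2 H1; have H3 := add_pder_Hreg c3 H2.
pose G c l : mspace3 R -> \bar R := fun x => (c * sumsq l x)%:E.
have G0 c l x : 0 <= c -> (0 <= G c l x)%E by move=> c0; rewrite lee_fin mulr_ge0// sumsq_ge0.
have mG k c l : (forall f, List.In f l -> Hreg k f) -> measurable_fun setT (G c l).
  by move=> H; apply: measurable_int (leb3 R) _ _ _; apply: intgrZ; exact: intgr_sumsq H.
have st k c i l x : 0 <= c -> (forall f, List.In f l -> Hreg k.+1 f) ->
    (G c l x <= \int[leb1 R]_z G (c * 2)%R (add_pder i l) (upd x i z))%E.
  move=> c0 H; have := @lee_wpmul2l _ c%:E _ _ _ (sumsq_slice i x H).
  rewrite -ge0_integralZl_EFin//.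
  - rewrite /G; under [X in _ -> (_ <= X)%E]eq_integral do rewrite -mulrA EFinM.
    by rewrite -EFinM; apply; rewrite lee_fin.
  - by move=> z _; rewrite lee_fin mulr_ge0// sumsq_ge0.
  - apply/measurable_EFinP; apply: continuous_measurable_fun => z.
    apply: cvgM; first exact: cvg_cst.
    exact: (continuous_slice (continuous_sumsq (add_pder_Hreg i H))).
pose h3 : measurableTypeR R * measurableTypeR R -> \bar R :=
  fun p => (\int[leb1 R]_c G 8%R l3 (p, c))%E.
have h30 p : (0 <= h3 p)%E by apply: integral_ge0 => c _; exact: G0.
have mh3 : measurable_fun setT h3.
  by apply: (measurable_fun_fubini_tonelli_F (m2 := @lebesgue_measure R) (G 8%R l3)) => //; [exact: mG H3|move=> x; exact: G0].
(* The constant [8] collects a factor [2] for each of the three directions. *)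
have bound x : ((f x ^+ 2)%:E <= \int[leb3 R]_x G 8%R l3 x)%E.
  case: x => -[x1 x2] x3.
  have -> : (f (x1, x2, x3) ^+ 2)%:E = G 1%R l0 (x1, x2, x3).
    by rewrite /G /l0 /sumsq big_seq1 mul1r.
  have m2 : measurable_fun [set: measurableTypeR R * measurableTypeR R] (fun p => G 4%R l2 (p, x3)).
    by apply: (measurableT_comp (mG _ 4 _ H2)); exact: pair2_measurable.
  have mI2 : measurable_fun setT (fun a => (\int[leb1 R]_b G 4%R l2 ((a, b), x3))%E).
    apply: (measurable_fun_fubini_tonelli_F (m2 := @lebesgue_measure R) (fun p => G 4%R l2 (p, x3))) => //.
    by move=> p; exact: G0.
  have mI3 : measurable_fun setT (fun a => (\int[leb1 R]_b h3 (a, b))%E).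
    by apply: (measurable_fun_fubini_tonelli_F (m2 := @lebesgue_measure R) h3).
  have m1 : measurable_fun [set: measurableTypeR R] (fun a => G 2%R l1 ((a, x2), x3)).
    have m1' : measurable_fun [set: measurableTypeR R * measurableTypeR R] (fun p => G 2%R l1 (p, x3)).
      by apply: (measurableT_comp (mG _ 2 _ H1)); exact: pair2_measurable.
    by apply: (measurableT_comp m1'); exact: pair2_measurable.
  rewrite (tonelli3 (mG _ 8 _ H3)); last by move=> x; exact: G0.
  apply: (le_trans (st _ 1 c1 l0 (x1, x2, x3) ler01 H0)); rewrite mul1r.
  apply: (@le_trans _ _ (\int[leb1 R]_a \int[leb1 R]_b G 4%R l2 ((a, b), x3))%E).
    apply: ge0_le_integral => //.
    - by move=> a _; apply: G0.
    - move=> a _; have := st _ 2 c2 l1 (a, x2, x3) (ler0n _ _) H1.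
      by rewrite (_ : 2 * 2 = 4 :> R)// -natrM.
  apply: ge0_le_integral => //.
  - by move=> a _; apply: integral_ge0 => b _; exact: G0.
  - move=> a _; apply: ge0_le_integral => //.
    + by move=> b _; apply: G0.
    + by apply: (measurableT_comp m2); exact: pair1_measurable.
    + by apply: (measurableT_comp mh3); exact: pair1_measurable.
    + move=> b _; have := st _ 4 c3 l2 (a, b, x3) (ler0n _ _) H2.
      by rewrite (_ : 4 * 2 = 8 :> R)// -natrM.
have Gi : (leb3 R).-integrable setT (G 8%R l3) by apply: intgrZ; exact: intgr_sumsq H3.
exists (1 + fine (\int[leb3 R]_x G 8%R l3 x)%E) => x.
have := bound x; rewrite -[X in (_ <= X)%E]fineK ?integrable_fin_num// lee_fin.
rewrite -(real_normK (num_real (f x))).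
have := normr_ge0 (f x); nra.
Qed.
End sobolev.

(** * Smooth functions with square-integrable derivatives *)

Section schwarz.
Context {R : realType}.
Implicit Types (f : space3 R -> R) (x v w : space3 R).

Lemma line_is_derive f v y (s : R) : derivable f (s *: v + y) v ->
  is_derive s 1 (fun s => f (s *: v + y)) ('D_v f (s *: v + y)).
Proof.
move=> df.
have e : (fun t : R => t^-1 *: (f ((t *: (1 : R) + s) *: v + y) - f (s *: v + y))) =
   (fun t : R => t^-1 *: (f (t *: v + (s *: v + y)) - f (s *: v + y))).
  by apply/funext => t; rewrite scalerDl -addrA [t *: (1 : R)](mulr1 t).
apply: DeriveDef.
- by rewrite /derivable /=; move: df; rewrite /derivable /= -e.
- by rewrite /derive /= -e.
Qed.

Lemma second_difference f v w x (h : R) : 0 < h ->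
  (forall y, derivable f y v) -> (forall y, derivable ('D_v f) y w) ->
  exists s t, [/\ 0 < s < h, 0 < t < h &
   f (h *: v + (h *: w + x)) - f (h *: v + x) - (f (h *: w + x) - f x) =
   h ^+ 2 * 'D_w ('D_v f) (t *: w + (s *: v + x))].
Proof.
move=> h0 df ddf.
pose phi s := f (s *: v + (h *: w + x)) - f (s *: v + x).
have dphi (s : R) : is_derive s 1 phi ('D_v f (s *: v + (h *: w + x)) - 'D_v f (s *: v + x)).
  by apply: is_deriveB; exact: line_is_derive.
(* The mean value theorem in the direction [v], then in the direction [w]. *)
have [s sh es] := MVT h0 (fun s _ => dphi s) (continuous_subspaceT (is_derive_continuous dphi)).
pose psi t := 'D_v f (t *: w + (s *: v + x)).
have dpsi (t : R) : is_derive t 1 psi ('D_w ('D_v f) (t *: w + (s *: v + x))).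
  exact: line_is_derive.
have [t th et] := MVT h0 (fun t _ => dpsi t) (continuous_subspaceT (is_derive_continuous dpsi)).
exists s, t; split; [by move: sh; rewrite in_itv|by move: th; rewrite in_itv|].
move: es; rewrite /phi !scale0r !add0r subr0 => ->.
move: et; rewrite /psi !scale0r !add0r subr0 addrCA => ->.
by rewrite ?subr0; ring.
Qed.

(** Schwarz's theorem: both mixed derivatives are limits of the same second
difference quotient. *)
Lemma schwarz f v w : (forall y, derivable f y v) -> (forall y, derivable f y w) ->
  (forall y, derivable ('D_v f) y w) -> (forall y, derivable ('D_w f) y v) ->
  continuous ('D_w ('D_v f)) -> continuous ('D_v ('D_w f)) ->
  'D_w ('D_v f) = 'D_v ('D_w f).
Proof.
move=> fv fw fvw fwv c1 c2; apply/funext => x.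
have hn n : 0 < harmonic n :> R by exact: harmonic_gt0.
(* The second difference is symmetric in [v] and [w], hence equal to [h ^+ 2] times
either mixed derivative, at two points which depend on [h] and tend to [x]. *)
have /choice[st Hst] : forall n : nat, exists st : (R * R) * (R * R),
    [/\ 0 < st.1.1 < harmonic n, 0 < st.1.2 < harmonic n,
        0 < st.2.1 < harmonic n, 0 < st.2.2 < harmonic n &
     'D_w ('D_v f) (st.1.2 *: w + (st.1.1 *: v + x)) =
     'D_v ('D_w f) (st.2.2 *: v + (st.2.1 *: w + x))].
  move=> n; have [s [t [sh th e]]] := second_difference x (hn n) fv fvw.
  have [s' [t' [sh' th' e']]] := second_difference x (hn n) fw fwv.
  exists ((s, t), (s', t')); split; [exact: sh|exact: th|exact: sh'|exact: th'|].
  have h2 : harmonic n ^+ 2 != 0 :> R by rewrite expf_neq0// gt_eqF.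
  have E : f (harmonic n *: v + (harmonic n *: w + x)) =
           f (harmonic n *: w + (harmonic n *: v + x)) by rewrite addrCA.
  suff H : harmonic n ^+ 2 * 'D_w ('D_v f) (t *: w + (s *: v + x)) =
         harmonic n ^+ 2 * 'D_v ('D_w f) (t' *: v + (s' *: w + x)) by exact: (mulfI h2 H).
  rewrite -[LHS]e -[RHS]e' E.
  by move: (f _) (f _) (f _) (f _) => a b c d; ring.
have c0 (s : nat -> R) : (forall n, 0 < s n < harmonic n) -> s n @[n --> \oo] --> (0 : R).
  move=> sh; apply: (@squeeze_cvgr _ _ _ _ (cst 0) harmonic).
  - by apply: nearW => n; have /andP[a b] := sh n; rewrite (ltW a) (ltW b).
  - exact: cvg_cst.
  - exact: cvg_harmonic.
have cp (s t : nat -> R) a b : (forall n, 0 < s n < harmonic n) ->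
   (forall n, 0 < t n < harmonic n) -> s n *: a + (t n *: b + x) @[n --> \oo] --> x.
  move=> /c0 s0 /c0 t0.
  rewrite -[X in _ --> X]add0r -[X in _ --> _ + X]add0r -{1}(scale0r a) -{1}(scale0r b).
  by apply: cvgD; [exact: cvgZr_tmp|apply: cvgD; [exact: cvgZr_tmp|exact: cvg_cst]].
have l1 : 'D_w ('D_v f) ((st n).1.2 *: w + ((st n).1.1 *: v + x)) @[n --> \oo] --> 'D_w ('D_v f) x.
  apply: (cvg_comp _ ('D_w ('D_v f)) _ (c1 x)).
  by apply: cp => n; have [] := Hst n.
have l2 : 'D_v ('D_w f) ((st n).2.2 *: v + ((st n).2.1 *: w + x)) @[n --> \oo] --> 'D_v ('D_w f) x.
  apply: (cvg_comp _ ('D_v ('D_w f)) _ (c2 x)).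
  by apply: cp => n; have [] := Hst n.
have e : (fun n => 'D_w ('D_v f) ((st n).1.2 *: w + ((st n).1.1 *: v + x))) =
         (fun n => 'D_v ('D_w f) ((st n).2.2 *: v + ((st n).2.1 *: w + x))).
  by apply/funext => n; have [_ _ _ _ ->] := Hst n.
rewrite e in l1; exact: (cvg_unique (@Rhausdorff R) l1 l2).
Qed.

End schwarz.

Section Hinf.
Context {R : realType}.
Implicit Types (f g h : space3 R -> R) (x : space3 R) (i j : 'I_3).

Definition Hinf f := forall k, Hreg k f.

Lemma Hinf_sqint f : Hinf f -> sqint3 R f. Proof. by move=> /(_ 0%N)/Hreg_sqint. Qed.
Lemma Hinf_msbl f : Hinf f -> msbl3 R f. Proof. by move=> /(_ 0%N)/Hreg_msbl. Qed.
Lemma Hinf_continuous f : Hinf f -> continuous f.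
Proof. by move=> /(_ 0%N)/Hreg_continuous. Qed.
Lemma Hinf_derivable f i x : Hinf f -> derivable f x (ebasis R i).
Proof. by move=> /(_ 1%N) H; exact: Hreg_derivable H. Qed.
Lemma Hinf_pder f i : Hinf f -> Hinf (pder i f).
Proof. by move=> H k; apply: Hreg_pder; exact: H. Qed.
Lemma Hinf_bounded f : Hinf f -> exists C, forall x, `|f x| <= C.
Proof. by move=> /(_ 3)/Hreg_bounded. Qed.

Lemma pderD_fun f g i : (forall x, derivable f x (ebasis R i)) ->
  (forall x, derivable g x (ebasis R i)) ->
  pder i (fun x => f x + g x) = fun x => pder i f x + pder i g x.
Proof. by move=> df dg; apply/funext => x; rewrite /pder; exact: (deriveD (df x) (dg x)). Qed.

Lemma pderZ_fun k f i : (forall x, derivable f x (ebasis R i)) ->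
  pder i (fun x => k * f x) = fun x => k * pder i f x.
Proof. by move=> df; apply/funext => x; rewrite /pder (deriveZ k (df x)). Qed.

Lemma pderM_fun f g i : (forall x, derivable f x (ebasis R i)) ->
  (forall x, derivable g x (ebasis R i)) ->
  pder i (fun x => f x * g x) = fun x => pder i f x * g x + f x * pder i g x.
Proof.
move=> df dg; apply/funext => x; rewrite /pder deriveM// addrC.
by rewrite /GRing.scale /= mulrC.
Qed.

Lemma HregD k f g : Hreg k f -> Hreg k g -> Hreg k (fun x => f x + g x).
Proof.
elim: k f g => [|k IH] f g [cf sf df] [cg sg dg] /=; (split;
  [by move=> x; apply: cvgD; [exact: cf|exact: cg]|exact: sqintD|]) => // i.
have [df1 df2] := df i; have [dg1 dg2] := dg i; split.
  by move=> x; apply: derivableD.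
by rewrite (pderD_fun df1 dg1); exact: IH.
Qed.

Lemma HregZ k c f : Hreg k f -> Hreg k (fun x => c * f x).
Proof.
elim: k f => [|k IH] f [cf sf df] /=; (split;
  [by move=> x; apply: cvgM; [exact: cvg_cst|exact: cf]|exact: sqintZ|]) => // i.
have [df1 df2] := df i; split; first by move=> x; apply: derivableM; [exact: derivable_cst|exact: df1].
by rewrite (pderZ_fun c df1); exact: IH.
Qed.

Lemma HinfD f g : Hinf f -> Hinf g -> Hinf (fun x => f x + g x).
Proof. by move=> Hf Hg k; exact: HregD. Qed.
Lemma HinfZ c f : Hinf f -> Hinf (fun x => c * f x).
Proof. by move=> Hf k; exact: HregZ. Qed.
Lemma HinfN f : Hinf f -> Hinf (fun x => - f x).
Proof. by move=> /(HinfZ (-1)); congr Hinf; apply/funext => x; rewrite mulN1r. Qed.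
Lemma HinfB f g : Hinf f -> Hinf g -> Hinf (fun x => f x - g x).
Proof. by move=> Hf Hg; apply: HinfD => //; exact: HinfN. Qed.

(** Boundedness is what makes this class an algebra. *)
Lemma HinfM f g : Hinf f -> Hinf g -> Hinf (fun x => f x * g x).
Proof.
move=> Hf Hg k; elim: k f g Hf Hg => [|k IH] f g Hf Hg;
  have [C fC] := Hinf_bounded Hf; (split;
  [by move=> x; apply: cvgM; [exact: (Hinf_continuous Hf)|exact: (Hinf_continuous Hg)]
  |by apply: (sqintM_bounded (Hinf_msbl Hf) fC); exact: Hinf_sqint|]) => // i.
split; first by move=> x; apply: derivableM; exact: Hinf_derivable.
rewrite pderM_fun; try by move=> x; exact: Hinf_derivable.
by apply: HregD; apply: IH => //; exact: Hinf_pder.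
Qed.

Lemma Hinf_intgr2 f g : Hinf f -> Hinf g -> intgr3 R (fun x => f x * g x).
Proof. by move=> Hf Hg; apply: sqint_mul; exact: Hinf_sqint. Qed.
Lemma Hinf_intgr3 f g h : Hinf f -> Hinf g -> Hinf h ->
  intgr3 R (fun x => f x * g x * h x).
Proof. by move=> Hf Hg Hh; apply: Hinf_intgr2 => //; exact: HinfM. Qed.

Lemma pderM f g i x : Hinf f -> Hinf g ->
  pder i (fun x => f x * g x) x = pder i f x * g x + f x * pder i g x.
Proof. by move=> Hf Hg; rewrite pderM_fun// => y; exact: Hinf_derivable. Qed.
Lemma pderD f g i x : Hinf f -> Hinf g ->
  pder i (fun x => f x + g x) x = pder i f x + pder i g x.
Proof. by move=> Hf Hg; rewrite pderD_fun// => y; exact: Hinf_derivable. Qed.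
Lemma pderZ c f i x : Hinf f -> pder i (fun x => c * f x) x = c * pder i f x.
Proof. by move=> Hf; rewrite pderZ_fun// => y; exact: Hinf_derivable. Qed.
Lemma pderN f i x : Hinf f -> pder i (fun x => - f x) x = - pder i f x.
Proof.
move=> Hf; rewrite -mulN1r -pderZ//; congr pder.
by apply/funext => y; rewrite mulN1r.
Qed.
Lemma pderB f g i x : Hinf f -> Hinf g ->
  pder i (fun x => f x - g x) x = pder i f x - pder i g x.
Proof. by move=> Hf Hg; rewrite pderD ?pderN//; exact: HinfN. Qed.

Lemma pderC i j f : Hinf f -> pder i (pder j f) = pder j (pder i f).
Proof.
move=> Hf; apply: (@schwarz _ f (ebasis R j) (ebasis R i));
  try by [move=> y; exact: Hinf_derivable|move=> y; apply: Hinf_derivable; exact: Hinf_pder].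
- by apply: Hinf_continuous; apply: Hinf_pder; exact: Hinf_pder.
- by apply: Hinf_continuous; apply: Hinf_pder; exact: Hinf_pder.
Qed.

Lemma Int_pder_Hinf i f g : Hinf f -> Hinf g ->
  \int[leb3 R]_x (pder i (fun x => f x * g x) x) = 0.
Proof.
move=> Hf Hg; have Hfg := HinfM Hf Hg; apply: Int_pder0.
- by move=> x; exact: Hinf_derivable.
- by move=> x; apply: continuous_slice; apply: Hinf_continuous; exact: Hinf_pder.
- exact: Hinf_intgr2.
- rewrite (_ : pder i _ = fun x => pder i f x * g x + f x * pder i g x).
    by apply: intgrD; apply: Hinf_intgr2 => //; exact: Hinf_pder.
  by apply/funext => x; exact: pderM.
Qed.

Lemma Int_by_parts i f g : Hinf f -> Hinf g ->
  \int[leb3 R]_x (pder i f x * g x) = - \int[leb3 R]_x (f x * pder i g x).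
Proof.
move=> Hf Hg; apply/eqP; rewrite -addr_eq0 -IntD; last 2 first.
- by apply: Hinf_intgr2 => //; exact: Hinf_pder.
- by apply: Hinf_intgr2 => //; exact: Hinf_pder.
apply/eqP; rewrite -[RHS](Int_pder_Hinf i Hf Hg); apply: eq_Int => x.
by rewrite pderM.
Qed.

End Hinf.

(** * Gaussians on the line *)

Section gauss_line.
Context {R : realType}.
Implicit Types (a x y : R) (p : {poly R}).

Definition gs a x : R := expR (- (x ^+ 2) / (2 * a)).

(** The total mass of [gs a], that is [Num.sqrt (2 * pi * a)]. *)
Definition gmass a : R := (normal_peak (Num.sqrt a))^-1.

Definition pg a p y x : R := p.[x - y] * gs a (x - y).

(** The polynomial factor of the derivative of [pg a p y]. *)
Definition dpg a p : {poly R} := p^`() - (a^-1)%:P * 'X * p.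

Lemma gs_gt0 a x : 0 < gs a x. Proof. exact: expR_gt0. Qed.
Lemma gsN a x : gs a (- x) = gs a x. Proof. by rewrite /gs sqrrN. Qed.

Lemma sqrt_neq0 a : 0 < a -> Num.sqrt a != 0 :> R.
Proof. by move=> a0; rewrite gt_eqF// sqrtr_gt0. Qed.

Lemma gmass_gt0 a : 0 < a -> 0 < gmass a.
Proof. by move=> a0; rewrite invr_gt0 normal_peak_gt0 ?sqrt_neq0. Qed.

Lemma gs_normal a y : 0 < a ->
  (fun x => gs a (x - y)) = fun x => gmass a * normal_pdf y (Num.sqrt a) x.
Proof.
move=> a0; apply/funext => x; have s0 := sqrt_neq0 a0.
rewrite normal_pdfE// /gmass mulrA mulVf ?gt_eqF ?normal_peak_gt0//.
by rewrite mul1r /normal_fun /gs sqr_sqrtr ?ltW// mulr_natl.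
Qed.

Lemma gs_intgr a y : 0 < a -> intgr1 R (fun x => gs a (x - y)).
Proof.
by move=> a0; rewrite gs_normal//; apply: intgrZ; exact: integrable_normal_pdf.
Qed.

Lemma Int_gs a y : 0 < a -> \int[leb1 R]_x (gs a (x - y)) = gmass a.
Proof.
move=> a0; rewrite gs_normal// IntZ; last exact: integrable_normal_pdf.
by rewrite /Rintegral integral_normal_pdf mulr1.
Qed.

Lemma gs_half a x : 0 < a -> gs a x = gs (2 * a) x * gs (2 * a) x.
Proof.
move=> a0; rewrite /gs -expRD; congr expR; field.
by rewrite gt_eqF.
Qed.

Lemma gs_le1 a x : 0 < a -> gs a x <= 1.
Proof.
move=> a0; rewrite /gs -expR0 ler_expR mulNr oppr_le0 divr_ge0 ?sqr_ge0//.
by rewrite mulr_ge0// ltW.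
Qed.

(** [1 + t <= expR t] at [t = x ^+ 2 / (2 * a)] bounds [x ^+ 2 * gs a x]. *)
Lemma norm_gs_bounded a : 0 < a -> exists C, forall x, `|x| * gs a x <= C.
Proof.
move=> a0; exists (1 + 2 * a) => x.
have g0 := gs_gt0 a x.
have h : x ^+ 2 * gs a x <= 2 * a.
  have e : gs a x * expR (x ^+ 2 / (2 * a)) = 1.
    by rewrite /gs -expRD mulNr addNr expR0.
  have := expR_ge1Dx (x ^+ 2 / (2 * a)).
  set E := expR _ in e * => hE.
  have a2 : 0 < 2 * a by rewrite mulr_gt0.
  have : x ^+ 2 / (2 * a) <= E by lra.
  rewrite ler_pdivrMr// => hx.
  have := ler_wpM2l (ltW g0) hx; rewrite [leRHS]mulrA e mul1r.
  by rewrite mulrC.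
have g1 := gs_le1 x a0.
have : `|x| <= 1 + x ^+ 2.
  have := sqr_ge0 (`|x| - 1); rewrite -(real_normK (num_real x)); have := normr_ge0 x; nra.
move=> /(ler_wpM2r (ltW g0)); nra.
Qed.

(** A polynomial times a Gaussian is bounded: half of the exponent absorbs one
power of [x]. *)
Lemma poly_gs_bounded p a : 0 < a -> exists C, forall x, `|p.[x]| * gs a x <= C.
Proof.
elim/poly_ind: p a => [|p c IH] a a0.
  by exists 0 => x; rewrite horner0 normr0 mul0r.
have a20 : 0 < 2 * a by rewrite mulr_gt0.
have [C1 H1] := IH _ a20; have [C2 H2] := norm_gs_bounded a20.
exists (C1 * C2 + `|c|) => x.
rewrite hornerMXaddC; have g0 := gs_gt0 a x.
apply: (le_trans (ler_wpM2r (ltW g0) (ler_normD _ _))); rewrite mulrDl normrM.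
apply: lerD; last by rewrite ler_piMr// gs_le1.
rewrite gs_half// mulrACA; apply: ler_pM => //; exact: mulr_ge0 (normr_ge0 _) (ltW (gs_gt0 _ _)).
Qed.

Lemma pg_is_derive a p y (x : R) : 0 < a -> is_derive x 1 (pg a p y) (pg a (dpg a p) y x).
Proof.
move=> a0; rewrite /pg /gs.
have dp : is_derive x 1 (fun x => p.[x - y]) (p^`().[x - y]).
  have -> : (fun x => p.[x - y]) = (horner p) \o (fun x => x - y) by [].
  by apply: is_derive_eq; rewrite /GRing.scale /= subr0 mulr1.
have de : is_derive x 1 (fun x => expR (- (x - y) ^+ 2 / (2 * a)))
    (- (x - y) / a * expR (- (x - y) ^+ 2 / (2 * a))).
  have dq : is_derive x 1 (fun x => - (x - y) ^+ 2 / (2 * a)) (- (x - y) / a).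
    apply: is_derive_eq; rewrite /GRing.scale /=.
    by field; rewrite gt_eqF.
  have -> : (fun x => expR (- (x - y) ^+ 2 / (2 * a))) = expR \o (fun x => - (x - y) ^+ 2 / (2 * a)) by [].
  by apply: is_derive_eq; rewrite /GRing.scale /= mulrC.
have hE : (dpg a p).[x - y] = p^`().[x - y] - a^-1 * (x - y) * p.[x - y].
  by rewrite /dpg !hornerE.
apply: is_derive_eq; rewrite hE /GRing.scale /=.
by field; rewrite gt_eqF.
Qed.

Lemma pg_continuous a p y : 0 < a -> continuous (pg a p y).
Proof. by move=> a0; apply: is_derive_continuous => x; exact: pg_is_derive. Qed.

Lemma pg_msbl a p y : 0 < a -> msbl1 R (pg a p y).
Proof. by move=> a0; apply: continuous_measurable_fun; exact: pg_continuous. Qed.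

Lemma pg_intgr a p y : 0 < a -> intgr1 R (pg a p y).
Proof.
move=> a0; have a20 : 0 < 2 * a by rewrite mulr_gt0.
have [C HC] := poly_gs_bounded p a20.
apply: (@intgr_le _ (measurableTypeR R) R lebesgue_measure _ (fun x => C * gs (2 * a) (x - y))).
- exact: pg_msbl.
- move=> x; rewrite /pg gs_half// mulrA normrM normrM !(gtr0_norm (gs_gt0 _ _)).
  by rewrite ler_wpM2r ?HC// ltW// gs_gt0.
- by apply: intgrZ; exact: gs_intgr.
Qed.

Lemma pg_sqr a p y x : 0 < a -> pg a p y x ^+ 2 = pg (a / 2) (p ^+ 2) y x.
Proof.
move=> a0; rewrite /pg exprMn horner_exp; congr (_ * _).
rewrite (gs_half (a := a / 2)) ?divr_gt0//.
by rewrite -expr2; have -> : 2 * (a / 2) = a by field.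
Qed.

Lemma pg_sqint a p y : 0 < a -> sqint1 R (pg a p y).
Proof.
move=> a0; split; first exact: pg_msbl.
rewrite (_ : (fun x => _) = pg (a / 2) (p ^+ 2) y); last by apply/funext => x; rewrite pg_sqr.
by apply: pg_intgr; rewrite divr_gt0.
Qed.

End gauss_line.

(** * Gaussian test functions in space *)

Section tensor_integrals.
Local Open Scope ereal_scope.
Context d1 d2 (T1 : measurableType d1) (T2 : measurableType d2) (R : realType).
Variable m1 : {sigma_finite_measure set T1 -> \bar R}.
Variable m2 : {sigma_finite_measure set T2 -> \bar R}.
Variables (f : T1 -> R) (g : T2 -> R).
Hypotheses (fi : intgr m1 f) (gi : intgr m2 g).

Let h (x : T1 * T2) : R := (f x.1 * g x.2)%R.

Lemma prod_integrable : (m1 \x m2).-integrable setT (EFin \o h).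
Proof.
have mh : msbl h.
  apply: msblM.
  - by apply: (measurableT_comp (intgr_msbl fi)); exact: measurable_fst.
  - by apply: (measurableT_comp (intgr_msbl gi)); exact: measurable_snd.
have gf : \int[m2]_y `|g y|%:E \is a fin_num.
  by apply: integrable_fin_num => //; exact: (intgr_norm gi).
apply/integrable12ltyP; first exact/measurable_EFinP.
rewrite (_ : \int[m1]_x _ = \int[m1]_x (`|f x|%:E * \int[m2]_y `|g y|%:E)); last first.
  apply: eq_integral => x _.
  rewrite -ge0_integralZl_EFin//.
  - by apply: eq_integral => y _; rewrite /h /= normrM.
  - by apply/measurable_EFinP; exact: msbl_norm (intgr_msbl gi).
rewrite -(fineK gf) ge0_integralZr//.
- apply: lte_mul_pinfty.
  + exact: integral_ge0.
  + by apply: integrable_fin_num => //; exact: (intgr_norm fi).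
  + exact: ltry.
- by apply/measurable_EFinP; exact: msbl_norm (intgr_msbl fi).
- by rewrite lee_fin fine_ge0//; apply: integral_ge0.
Qed.

Lemma prod_integral : \int[m1 \x m2]_x (h x)%:E = (\int[m1]_x f x * \int[m2]_y g y)%R%:E.
Proof.
rewrite -(integral12_prod_meas1 prod_integrable) /fubini_F.
rewrite (_ : \int[m1]_x _ = \int[m1]_x ((\int[m2]_y g y)%R%:E * (f x)%:E)).
  by rewrite (integralZl measurableT fi) (Int_EFin fi) -EFinM mulrC.
apply: eq_integral => x _ /=.
rewrite -EFinM mulrC -IntZ// -Int_EFin//; exact: intgrZ.
Qed.

End tensor_integrals.

Section tensors.
Context {R : realType}.
Implicit Types (F : 'I_3 -> R -> R) (x y : space3 R) (i j : 'I_3).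

Definition tens F x : R := F c1 x.1.1 * F c2 x.1.2 * F c3 x.2.

Lemma tens_intgr F : (forall i, intgr1 R (F i)) -> intgr3 R (tens F).
Proof.
move=> Fi.
have h12 := prod_integrable (m1 := @lebesgue_measure R) (m2 := @lebesgue_measure R) (Fi c1) (Fi c2).
exact: (prod_integrable (m1 := @leb2s R) (m2 := @lebesgue_measure R) h12 (Fi c3)).
Qed.

Lemma Int_tens F : (forall i, intgr1 R (F i)) ->
  \int[leb3 R]_x (tens F x) = \int[leb1 R]_z (F c1 z) * \int[leb1 R]_z (F c2 z) * \int[leb1 R]_z (F c3 z).
Proof.
move=> Fi.
have h12 := prod_integrable (m1 := @lebesgue_measure R) (m2 := @lebesgue_measure R) (Fi c1) (Fi c2).
have e := prod_integral (m1 := @leb2s R) (m2 := @lebesgue_measure R) h12 (Fi c3).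
have e2 := prod_integral (m1 := @lebesgue_measure R) (m2 := @lebesgue_measure R) (Fi c1) (Fi c2).
by apply: (etrans (congr1 fine e)) => /=; congr (_ * _); exact: (congr1 fine e2).
Qed.

Lemma tens_msbl F : (forall i, msbl1 R (F i)) -> msbl3 R (tens F).
Proof.
move=> mF; have c i : msbl3 R (fun x => F i (xcoord x i)).
  by apply: (measurableT_comp (mF i)); exact: measurable_xcoord.
by apply: msblM; [apply: msblM; [exact: (c c1)|exact: (c c2)]|exact: (c c3)].
Qed.

Lemma tens_sqint F : (forall i, sqint1 R (F i)) -> sqint3 R (tens F).
Proof.
move=> FL; split; first by apply: tens_msbl => i; have [] := FL i.
have : intgr3 R (tens (fun i z => F i z ^+ 2)) by apply: tens_intgr => i; have [] := FL i.
by congr intgr; apply/funext => x; rewrite /tens !exprMn.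
Qed.

Lemma slice_derivable (f : space3 R -> R) i x (d : R) :
  is_derive (xcoord x i) 1 (fun z => f (upd x i z)) d ->
  derivable f x (ebasis R i) /\ pder i f x = d.
Proof.
move=> [df dfe].
have e : (fun t : R => t^-1 *: (f (upd x i (t *: (1 : R) + xcoord x i)) - f (upd x i (xcoord x i)))) =
   (fun t : R => t^-1 *: (f (t *: ebasis R i + x) - f x)).
  by apply/funext => t; rewrite upd_shift upd_xcoord.
split.
- by move: df; rewrite /derivable /= e.
- by rewrite -dfe /pder /derive /= e.
Qed.

Lemma tens_derivable F (F' : R -> R) i x : (forall z : R, is_derive z 1 (F i) (F' z)) ->
  derivable (tens F) x (ebasis R i) /\
  pder i (tens F) x = tens (fun j => if j == i then F' else F j) x.
Proof.
move=> dF; apply: slice_derivable; case: (ord3P i) dF => -> dF; rewrite /tens /=.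
- have d := dF x.1.1; rewrite /xcoord /=.
  by apply: is_derive_eq; rewrite /GRing.scale /=; ring.
- have d := dF x.1.2; rewrite /xcoord /=.
  by apply: is_derive_eq; rewrite /GRing.scale /=; ring.
- have d := dF x.2; rewrite /xcoord /=.
  by apply: is_derive_eq; rewrite /GRing.scale /=; ring.
Qed.

Lemma tens_continuous F : (forall i, continuous (F i)) -> continuous (tens F).
Proof.
move=> cF x; apply: cvgM; first apply: cvgM.
- apply: (cvg_comp (fun x : space3 R => x.1.1) (F c1)); last exact: cF.
  by apply: (cvg_comp (fun x : space3 R => x.1) fst); exact: cvg_fst.
- apply: (cvg_comp (fun x : space3 R => x.1.2) (F c2)); last exact: cF.
  by apply: (cvg_comp (fun x : space3 R => x.1) snd); [exact: cvg_fst|exact: cvg_snd].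
- by apply: (cvg_comp (fun x : space3 R => x.2) (F c3)); [exact: cvg_snd|exact: cF].
Qed.

(** Products of polynomials and anisotropic Gaussians centred at [y]: a class of
test functions closed under differentiation. *)
Definition gk (a : 'I_3 -> R) (p : 'I_3 -> {poly R}) (y : space3 R) : space3 R -> R :=
  tens (fun i => pg (a i) (p i) (xcoord y i)).

Definition dgk (a : 'I_3 -> R) i (p : 'I_3 -> {poly R}) : 'I_3 -> {poly R} :=
  fun j => if j == i then dpg (a i) (p i) else p j.

Lemma pder_gk (a : 'I_3 -> R) p y i x : (forall i, 0 < a i) ->
  derivable (gk a p y) x (ebasis R i) /\ pder i (gk a p y) x = gk a (dgk a i p) y x.
Proof.
move=> a0.
have [] := @tens_derivable (fun i => pg (a i) (p i) (xcoord y i)) (pg (a i) (dpg (a i) (p i)) (xcoord y i)) i x.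
  by move=> z; exact: pg_is_derive.
move=> d1 d2; split => //; rewrite /gk d2 /tens /dgk.
by case: (ord3P i) => ->.
Qed.

Lemma gk_Hinf (a : 'I_3 -> R) p y : (forall i, 0 < a i) -> Hinf (gk a p y).
Proof.
move=> a0 k; elim: k p => [|k IH] p; split=> //.
- by apply: tens_continuous => i; exact: pg_continuous.
- by apply: tens_sqint => i; exact: pg_sqint.
- by apply: tens_continuous => i; exact: pg_continuous.
- by apply: tens_sqint => i; exact: pg_sqint.
move=> i; split; first by move=> x; have [] := pder_gk p y i x a0.
rewrite (_ : pder i _ = gk a (dgk a i p) y); first exact: IH.
by apply/funext => x; have [] := pder_gk p y i x a0.
Qed.

End tensors.

(** Differentiation under the integral sign, for a derivative dominated near [z]. *)
Lemma is_derive_Int d (T : measurableType d) (R : realType)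
    (mu : {measure set T -> \bar R}) (f f' : R -> T -> R) (G : T -> R) (z : R) :
  (forall x t, is_derive (x : R) 1 (f ^~ t) (f' x t)) -> (forall x, intgr mu (f x)) ->
  intgr mu G -> (forall x t, z - 1 < x < z + 1 -> `|f' x t| <= G t) ->
  is_derive z 1 (fun x => \int[mu]_t (f x t)) (\int[mu]_t (f' z t)).
Proof.
move=> df fi Gi f'G.
have zI : `]z - 1, z + 1[%classic z by rewrite /= in_itv /=; apply/andP; split; lra.
have G0 t : 0 <= G t by apply: (le_trans _ (f'G z t _)) => //; move: zI; rewrite /= in_itv.
have f'E x t : ((f ^~ t)^`() x = f' x t)%classic.
  by rewrite derive1E; exact: (derive_val (is_derive := df x t)).
have bd x t : `]z - 1, z + 1[%classic x -> setT t -> `|partial1of2 f x t| <= G t.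
  by rewrite /= in_itv /= => xI _; rewrite /partial1of2 f'E; exact: f'G.
have fi' x : `]z - 1, z + 1[%classic x -> mu.-integrable setT (EFin \o f x) by move=> _; exact: fi.
have fd x t : `]z - 1, z + 1[%classic x -> setT t -> derivable (f ^~ t) x 1.
  by move=> _ _; have [] := df x t.
apply: DeriveDef.
  exact: (@derivable_under_integral _ _ _ mu f setT measurableT _ (z - 1) (z + 1) zI fi' fd G).
rewrite -derive1E.
rewrite (@differentiation_under_integral _ _ _ mu f setT measurableT _ (z - 1) (z + 1) zI fi' fd G)//.
by apply: eq_Int => t; rewrite /partial1of2 f'E.
Qed.

Section gauss_fourier.
Context {R : realType}.
Implicit Types (x y z a : R).

(** The one-dimensional fundamental theorem on the whole line, read off from the
three-dimensional one by tensoring with Gaussians. *)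
Lemma Int_line0 (h h' : R -> R) : (forall z : R, is_derive z 1 h (h' z)) ->
  continuous h' -> intgr1 R h -> intgr1 R h' -> \int[leb1 R]_z (h' z) = 0.
Proof.
move=> dh ch' hi h'i.
pose g : R -> R := fun z => gs 1 (z - 0).
have gi : intgr1 R g by apply: gs_intgr.
pose F (j : 'I_3) : R -> R := if j == c1 then h else g.
have e : pder c1 (tens F) = tens (fun j => if j == c1 then h' else F j).
  by apply/funext => x; have [] := @tens_derivable _ F h' c1 x dh.
have F'i (j : 'I_3) : intgr1 R (if j == c1 then h' else F j).
  by case: (ord3P j) => -> /=.
have : \int[leb3 R]_x (pder c1 (tens F) x) = 0.
  apply: Int_pder0.
  - by move=> x; have [] := @tens_derivable _ F h' c1 x dh.
  - move=> x; rewrite e; apply: continuous_slice; apply: tens_continuous => j.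
    have cg : continuous g.
      rewrite (_ : g = pg 1 1 0); first exact: pg_continuous.
      by apply/funext => z; rewrite /pg hornerC mul1r.
    by case: (ord3P j) => -> /=.
  - by apply: tens_intgr => j; case: (ord3P j) => -> /=.
  - by rewrite e; exact: tens_intgr.
rewrite e Int_tens//= /F /= Int_gs// => /eqP.
by rewrite !mulf_eq0 !(gt_eqF (gmass_gt0 _))// !orbF => /eqP.
Qed.

Definition Jcos a (m : nat) z : R := \int[leb1 R]_t (cos (z * t) * (t ^+ m * gs a t)).
Definition Jsin a (m : nat) z : R := \int[leb1 R]_t (sin (z * t) * (t ^+ m * gs a t)).

Lemma mono_gsE a m t : t ^+ m * gs a t = pg a 'X^m 0 t.
Proof. by rewrite /pg subr0 hornerXn. Qed.

Lemma mono_gs_intgr a m : 0 < a -> intgr1 R (fun t => t ^+ m * gs a t).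
Proof.
move=> a0; have := pg_intgr 'X^m 0 a0; congr intgr.
by apply/funext => t; rewrite mono_gsE.
Qed.

Lemma abs_cos_le1 x : `|cos x| <= 1.
Proof. by rewrite ler_norml cos_geN1 cos_le1. Qed.
Lemma abs_sin_le1 x : `|sin x| <= 1.
Proof. by rewrite ler_norml sin_geN1 sin_le1. Qed.

Lemma trig_is_derive z (t : R) :
  is_derive t 1 (fun t => cos (z * t)) (- z * sin (z * t)) /\
  is_derive t 1 (fun t => sin (z * t)) (z * cos (z * t)).
Proof.
have dz : is_derive t 1 (fun t => z * t) z.
  by apply: is_derive_eq; rewrite /GRing.scale /=; ring.
split.
- have -> : (fun t => cos (z * t)) = cos \o (fun t => z * t) by [].
  by apply: is_derive_eq; rewrite /GRing.scale /=; ring.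
- have -> : (fun t => sin (z * t)) = sin \o (fun t => z * t) by [].
  by apply: is_derive_eq; rewrite /GRing.scale /=; ring.
Qed.

Lemma mono_gs_is_derive a m (t : R) : 0 < a ->
  is_derive t 1 (fun t => t ^+ m * gs a t)
    ((m%:R * t ^+ m.-1 - a^-1 * t ^+ m.+1) * gs a t).
Proof.
move=> a0; have := pg_is_derive 'X^m 0 t a0.
rewrite (_ : pg a 'X^m 0 = fun t => t ^+ m * gs a t); last first.
  by apply/funext => s; rewrite mono_gsE.
move=> d; apply: is_derive_eq; rewrite /pg /dpg subr0; congr (_ * _).
by rewrite derivXn !hornerE hornerMn hornerXn mulr_natl exprS mulrA.
Qed.

Lemma trig_msbl z : msbl1 R (fun t => cos (z * t)) /\ msbl1 R (fun t => sin (z * t)).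
Proof.
by split; apply: continuous_measurable_fun;
  apply: is_derive_continuous => t; have [] := trig_is_derive z t.
Qed.

Lemma trig_mono_intgr a m z : 0 < a ->
  intgr1 R (fun t => cos (z * t) * (t ^+ m * gs a t)) /\
  intgr1 R (fun t => sin (z * t) * (t ^+ m * gs a t)).
Proof.
move=> a0; have gi := mono_gs_intgr m a0; have [mc ms] := trig_msbl z.
split; apply: (intgr_le _ _ (intgr_norm gi)).
- by apply: msblM => //; exact: intgr_msbl gi.
- by move=> t; rewrite normrM ler_piMl// abs_cos_le1.
- by apply: msblM => //; exact: intgr_msbl gi.
- by move=> t; rewrite normrM ler_piMl// abs_sin_le1.
Qed.

(** Integration by parts turns multiplication by [t] on the frequency side into
lower order moments; for [m = 0] the term with [m.-1] has coefficient zero. *)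
Lemma Jcos_rec a m z : 0 < a ->
  Jcos a m.+1 z = a * (m%:R * Jcos a m.-1 z - z * Jsin a m z).
Proof.
move=> a0.
have ci k := (trig_mono_intgr k z a0).1; have si k := (trig_mono_intgr k z a0).2.
pose h t := cos (z * t) * (t ^+ m * gs a t).
pose h' t := m%:R * (cos (z * t) * (t ^+ m.-1 * gs a t)) -
  z * (sin (z * t) * (t ^+ m * gs a t)) - a^-1 * (cos (z * t) * (t ^+ m.+1 * gs a t)).
have dh (t : R) : is_derive t 1 h (h' t).
  have [dc _] := trig_is_derive z t; have dg := mono_gs_is_derive m t a0.
  by apply: is_derive_eq; rewrite /GRing.scale /= /h'; ring.
have c_cos : continuous (fun t : R => cos (z * t)).
  by apply: is_derive_continuous => t; have [d _] := trig_is_derive z t; exact: d.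
have c_sin : continuous (fun t : R => sin (z * t)).
  by apply: is_derive_continuous => t; have [_ d] := trig_is_derive z t; exact: d.
have c_g k : continuous (fun t : R => t ^+ k * gs a t).
  by apply: is_derive_continuous => t; exact: mono_gs_is_derive.
have i1 := intgrZ m%:R (ci m.-1); have i2 := intgrZ z (si m); have i3 := intgrZ a^-1 (ci m.+1).
have := Int_line0 dh _ (ci m) (intgrB (intgrB i1 i2) i3).
rewrite (IntB (intgrB i1 i2) i3) (IntB i1 i2) !IntZ// => H.
have {}H : m%:R * Jcos a m.-1 z - z * Jsin a m z - a^-1 * Jcos a m.+1 z = 0.
  apply: H => t; apply: cvgB; first apply: cvgB.
  - by apply: cvgM; [exact: cvg_cst|apply: cvgM; [exact: c_cos|exact: c_g]].
  - by apply: cvgM; [exact: cvg_cst|apply: cvgM; [exact: c_sin|exact: c_g]].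
  - by apply: cvgM; [exact: cvg_cst|apply: cvgM; [exact: c_cos|exact: c_g]].
move/eqP: H; rewrite subr_eq0 => /eqP ->.
by rewrite mulrA mulfV ?gt_eqF// mul1r.
Qed.

Lemma Jsin_rec a m z : 0 < a ->
  Jsin a m.+1 z = a * (m%:R * Jsin a m.-1 z + z * Jcos a m z).
Proof.
move=> a0.
have ci k := (trig_mono_intgr k z a0).1; have si k := (trig_mono_intgr k z a0).2.
pose h t := sin (z * t) * (t ^+ m * gs a t).
pose h' t := m%:R * (sin (z * t) * (t ^+ m.-1 * gs a t)) +
  z * (cos (z * t) * (t ^+ m * gs a t)) - a^-1 * (sin (z * t) * (t ^+ m.+1 * gs a t)).
have dh (t : R) : is_derive t 1 h (h' t).
  have [_ dc] := trig_is_derive z t; have dg := mono_gs_is_derive m t a0.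
  by apply: is_derive_eq; rewrite /GRing.scale /= /h'; ring.
have c_cos : continuous (fun t : R => cos (z * t)).
  by apply: is_derive_continuous => t; have [d _] := trig_is_derive z t; exact: d.
have c_sin : continuous (fun t : R => sin (z * t)).
  by apply: is_derive_continuous => t; have [_ d] := trig_is_derive z t; exact: d.
have c_g k : continuous (fun t : R => t ^+ k * gs a t).
  by apply: is_derive_continuous => t; exact: mono_gs_is_derive.
have i1 := intgrZ m%:R (si m.-1); have i2 := intgrZ z (ci m); have i3 := intgrZ a^-1 (si m.+1).
have := Int_line0 dh _ (si m) (intgrB (intgrD i1 i2) i3).
rewrite (IntB (intgrD i1 i2) i3) (IntD i1 i2) !IntZ// => H.
have {}H : m%:R * Jsin a m.-1 z + z * Jcos a m z - a^-1 * Jsin a m.+1 z = 0.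
  apply: H => t; apply: cvgB; first apply: cvgD.
  - by apply: cvgM; [exact: cvg_cst|apply: cvgM; [exact: c_sin|exact: c_g]].
  - by apply: cvgM; [exact: cvg_cst|apply: cvgM; [exact: c_cos|exact: c_g]].
  - by apply: cvgM; [exact: cvg_cst|apply: cvgM; [exact: c_sin|exact: c_g]].
move/eqP: H; rewrite subr_eq0 => /eqP ->.
by rewrite mulrA mulfV ?gt_eqF// mul1r.
Qed.

(** Differentiating the cosine and sine transforms brings down one power of [t]. *)
Lemma J0_is_derive a (z : R) : 0 < a ->
  is_derive z 1 (Jcos a 0) (- Jsin a 1 z) /\ is_derive z 1 (Jsin a 0) (Jcos a 1 z).
Proof.
move=> a0; pose G t : R := `|t ^+ 1 * gs a t|.
have Gi : intgr1 R G by apply: intgr_norm; exact: mono_gs_intgr.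
have dc (x t : R) : is_derive x 1 (fun x => cos (x * t) * (t ^+ 0 * gs a t)) (- (sin (x * t) * (t ^+ 1 * gs a t))).
  have d : is_derive x 1 (fun x => cos (x * t)) (- t * sin (x * t)).
    have := (trig_is_derive t x).1; under eq_fun do rewrite mulrC.
    by rewrite [t * x]mulrC.
  by apply: is_derive_eq; rewrite /GRing.scale /=; ring.
have ds (x t : R) : is_derive x 1 (fun x => sin (x * t) * (t ^+ 0 * gs a t)) (cos (x * t) * (t ^+ 1 * gs a t)).
  have d : is_derive x 1 (fun x => sin (x * t)) (t * cos (x * t)).
    have := (trig_is_derive t x).2; under eq_fun do rewrite mulrC.
    by rewrite [t * x]mulrC.
  by apply: is_derive_eq; rewrite /GRing.scale /=; ring.
have i0 x := trig_mono_intgr 0 x a0.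
split.
- rewrite /Jsin -IntN; last by have [] := trig_mono_intgr 1 z a0.
  have d := @is_derive_Int _ _ _ (@lebesgue_measure R) (fun x t => cos (x * t) * (t ^+ 0 * gs a t))
    (fun x t => - (sin (x * t) * (t ^+ 1 * gs a t))) G z dc (fun x => (i0 x).1) Gi.
  apply: d.
  by move=> x t _; rewrite normrN normrM ler_piMl// abs_sin_le1.
- have d := @is_derive_Int _ _ _ (@lebesgue_measure R) (fun x t => sin (x * t) * (t ^+ 0 * gs a t))
    (fun x t => cos (x * t) * (t ^+ 1 * gs a t)) G z ds (fun x => (i0 x).2) Gi.
  apply: d.
  by move=> x t _; rewrite normrM ler_piMl// abs_cos_le1.
Qed.

(** The Gaussian is the only solution of its first order equation. *)
Lemma gauss_ode a (f : R -> R) : 0 < a ->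
  (forall z : R, is_derive z 1 f (- (a * z * f z))) -> forall z, f z = f 0 * gs a^-1 z.
Proof.
move=> a0 df z.
pose e (z : R) := expR (a / 2 * z ^+ 2).
have de (x : R) : is_derive x 1 e (a * x * e x).
  have dq : is_derive x 1 (fun z : R => a / 2 * z ^+ 2) (a * x).
    by apply: is_derive_eq; rewrite /GRing.scale /=; field.
  have -> : e = expR \o (fun z : R => a / 2 * z ^+ 2) by [].
  by apply: is_derive_eq; rewrite /GRing.scale /= mulrC.
have dfe (x : R) : is_derive x 1 (fun z => f z * e z) 0.
  have d1 := df x; have d2 := de x.
  by apply: is_derive_eq; rewrite /GRing.scale /=; ring.
have c : f z * e z = f 0 * e 0.
  by apply: (is_derive_0_is_cst (f := fun z => f z * e z)).
have ge : gs a^-1 z * e z = 1.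
  rewrite /gs /e -expRD [X in expR X](_ : _ = 0) ?expR0//; field.
  by rewrite gt_eqF.
have e0 : e 0 = 1 by rewrite /e expr0n mulr0 expR0.
have enz : e z != 0 by rewrite gt_eqF// expR_gt0.
by apply: (mulIf enz); rewrite c e0 mulr1 -mulrA ge mulr1.
Qed.

Lemma Jcos0 a z : 0 < a -> Jcos a 0 z = gmass a * gs a^-1 z.
Proof.
move=> a0.
have df (x : R) : is_derive x 1 (Jcos a 0) (- (a * x * Jcos a 0 x)).
  have [d _] := J0_is_derive x a0.
  by rewrite (Jsin_rec 0 x a0) mul0r add0r mulrA in d.
rewrite (gauss_ode a0 df z); congr (_ * _); rewrite /Jcos -(Int_gs 0 a0).
by apply: eq_Int => t; rewrite mul0r cos0 !mul1r subr0.
Qed.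

Lemma Jsin0 a z : 0 < a -> Jsin a 0 z = 0.
Proof.
move=> a0.
have df (x : R) : is_derive x 1 (Jsin a 0) (- (a * x * Jsin a 0 x)).
  have [_ d] := J0_is_derive x a0.
  by rewrite (Jcos_rec 0 x a0) mul0r sub0r mulrN mulrA in d.
rewrite (gauss_ode a0 df z) [X in X * _](_ : _ = 0) ?mul0r//.
rewrite /Jsin; under eq_Rintegral do rewrite mul0r sin0 mul0r.
by rewrite /Rintegral integral0.
Qed.

Lemma Jcos1 a z : 0 < a -> Jcos a 1 z = 0.
Proof. by move=> a0; rewrite Jcos_rec// Jsin0// mulr0 mul0r subr0 mulr0. Qed.
Lemma Jsin1 a z : 0 < a -> Jsin a 1 z = gmass a * (a * z * gs a^-1 z).
Proof. by move=> a0; rewrite Jsin_rec// Jcos0// mul0r add0r; ring. Qed.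
Lemma Jcos2 a z : 0 < a -> Jcos a 2 z = gmass a * ((a - a ^+ 2 * z ^+ 2) * gs a^-1 z).
Proof. by move=> a0; rewrite Jcos_rec// Jsin1// Jcos0//; ring. Qed.
Lemma Jsin2 a z : 0 < a -> Jsin a 2 z = 0.
Proof. by move=> a0; rewrite Jsin_rec// Jcos1// Jsin0// !mulr0 addr0 mulr0. Qed.

End gauss_fourier.

(** * Fourier integrals of Gaussians in space *)

Section fourier_tensor.
Context {R : realType}.
Implicit Types (x y z xi : space3 R) (a : 'I_3 -> R).

Lemma L2_sqint (f : space3 R -> R) : L2 f -> sqint3 R f.
Proof.
move=> Lf; split; last exact: (Lfun2_integrable_sqr Lf).
by move: Lf; rewrite /L2 inE => /andP[/set_mem].
Qed.

Lemma phaseE x xi : phase x xi = x.1.1 * xi.1.1 + x.1.2 * xi.1.2 + x.2 * xi.2.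
Proof. by rewrite /phase sum3E. Qed.

Lemma Int_trig_tens (g : 'I_3 -> R -> R) z : (forall j, intgr1 R (g j)) ->
  let C j := \int[leb1 R]_t (cos (xcoord z j * t) * g j t) in
  let S j := \int[leb1 R]_t (sin (xcoord z j * t) * g j t) in
  \int[leb3 R]_xi (cos (phase z xi) * tens g xi) =
    C c1 * C c2 * C c3 - S c1 * S c2 * C c3 - S c1 * C c2 * S c3 - C c1 * S c2 * S c3 /\
  \int[leb3 R]_xi (sin (phase z xi) * tens g xi) =
    S c1 * C c2 * C c3 + C c1 * S c2 * C c3 + C c1 * C c2 * S c3 - S c1 * S c2 * S c3.
Proof.
move=> gi C S.
pose gc j t := cos (xcoord z j * t) * g j t.
pose gs j t := sin (xcoord z j * t) * g j t.
have gci j : intgr1 R (gc j).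
  apply: (intgr_le _ _ (intgr_norm (gi j))).
  - by apply: msblM; [have [] := trig_msbl (xcoord z j)|exact: intgr_msbl (gi j)].
  - by move=> t; rewrite normrM ler_piMl// abs_cos_le1.
have gsi j : intgr1 R (gs j).
  apply: (intgr_le _ _ (intgr_norm (gi j))).
  - by apply: msblM; [have [] := trig_msbl (xcoord z j)|exact: intgr_msbl (gi j)].
  - by move=> t; rewrite normrM ler_piMl// abs_sin_le1.
pose F (b1 b2 b3 : bool) j : R -> R :=
  if (if j == c1 then b1 else if j == c2 then b2 else b3) then gs j else gc j.
have Fi b1 b2 b3 j : intgr1 R (F b1 b2 b3 j) by rewrite /F; case: ifP.
have Ti b1 b2 b3 := tens_intgr (Fi b1 b2 b3).
have IT b1 b2 b3 := Int_tens (Fi b1 b2 b3).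
split.
- transitivity (\int[leb3 R]_xi (tens (F false false false) xi - tens (F true true false) xi
     - tens (F true false true) xi - tens (F false true true) xi)).
    apply: eq_Int => xi; rewrite phaseE /tens /F /= /gc /gs /xcoord /tnth /= !(sinD, cosD); ring.
  have i1 := intgrB (Ti false false false) (Ti true true false).
  have i2 := intgrB i1 (Ti true false true).
  by rewrite (IntB i2 (Ti _ _ _)) (IntB i1 (Ti _ _ _)) (IntB (Ti _ _ _) (Ti _ _ _)) !IT.
- transitivity (\int[leb3 R]_xi (tens (F true false false) xi + tens (F false true false) xi
     + tens (F false false true) xi - tens (F true true true) xi)).
    apply: eq_Int => xi; rewrite phaseE /tens /F /= /gc /gs /xcoord /tnth /= !(sinD, cosD); ring.
  have i1 := intgrD (Ti true false false) (Ti false true false).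
  have i2 := intgrD i1 (Ti false false true).
  by rewrite (IntB i2 (Ti _ _ _)) (IntD i1 (Ti _ _ _)) (IntD (Ti _ _ _) (Ti _ _ _)) !IT.
Qed.

(** The frequency-side counterpart of the spatial test functions [gk]. *)
Definition freq a (m : 'I_3 -> nat) : space3 R -> R :=
  tens (fun j t => t ^+ m j * gs (a j) t).

(** The exponents of the monomial [xi_i * xi_j * xi_3 ^+ e]. *)
Definition expo2 (i j : 'I_3) (e : nat) (k : 'I_3) : nat :=
  (k == i) + (k == j) + (if k == c3 then e else 0).

Lemma freqE a i j e xi : freq a (expo2 i j e) xi =
  xcoord xi i * xcoord xi j * xi.2 ^+ e * freq a (fun=> 0%N) xi.
Proof.
rewrite /freq /tens /expo2.
by case: (ord3P i) => ->; case: (ord3P j) => -> /=; rewrite /xcoord /tnth /= ?exprD; ring.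
Qed.

Lemma dpg_horner (A z : R) p : (dpg A p).[z] = p^`().[z] - A^-1 * z * p.[z].
Proof. by rewrite /dpg !hornerE. Qed.

Lemma dpg1E (A z : R) : (dpg A 1).[z] = - (A^-1 * z).
Proof. by rewrite dpg_horner derivC !hornerE. Qed.

Lemma dpg2E (A z : R) : (dpg A (dpg A 1)).[z] = A^-1 ^+ 2 * z ^+ 2 - A^-1.
Proof.
rewrite dpg_horner dpg1E.
have -> : (dpg A 1)^`() = - (A^-1)%:P.
  by rewrite /dpg derivC sub0r mulr1 derivN derivM derivC mul0r add0r derivX mulr1.
by rewrite hornerN hornerC; ring.
Qed.

Definition ainv a : 'I_3 -> R := fun j => (a j)^-1.
Definition mass3 a : R := gmass (a c1) * gmass (a c2) * gmass (a c3).

Lemma freq_sqint a m : (forall j, 0 < a j) -> sqint3 R (freq a m) /\ intgr3 R (freq a m).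
Proof.
move=> a0; have e j : (fun t => t ^+ m j * gs (a j) t) = pg (a j) ('X^(m j)) 0.
  by apply/funext => t; rewrite mono_gsE.
split; [apply: tens_sqint|apply: tens_intgr] => j.
- by rewrite e; exact: pg_sqint.
- by rewrite e; exact: pg_intgr.
Qed.

(** The Fourier transform of a monomial times a Gaussian is a derivative of a
Gaussian; here for two horizontal factors and possibly one vertical one. *)
Lemma Int_freq_even a (i j : 'I_3) x y : (forall k, 0 < a k) -> (i < 2)%N -> (j < 2)%N ->
  \int[leb3 R]_xi (cos (phase (x - y) xi) * freq a (expo2 i j 0) xi) =
  - (mass3 a * gk (ainv a) (dgk (ainv a) i (dgk (ainv a) j (fun=> 1))) y x).
Proof.
move=> a0 i2 j2.
have gi k : intgr1 R (fun t => t ^+ expo2 i j 0 k * gs (a k) t) by exact: mono_gs_intgr.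
rewrite (Int_trig_tens (x - y) gi).1 -!/(Jcos _ _ _) -!/(Jsin _ _ _).
rewrite /gk /tens /pg /dgk /ainv /mass3.
move: gi i2 j2; case: (ord3P i) => -> //; case: (ord3P j) => -> //= _ _ _;
rewrite /expo2 /= ?addn0 ?add0n ?addn1 /= !(Jcos0, Jsin0, Jcos1, Jsin1, Jcos2, Jsin2)//
  ?dpg2E ?dpg1E ?hornerC ?invrK /xcoord /tnth /=; ring.
Qed.

Lemma Int_freq_odd a (i j : 'I_3) x y : (forall k, 0 < a k) -> (i < 2)%N -> (j < 2)%N ->
  \int[leb3 R]_xi (sin (phase (x - y) xi) * freq a (expo2 i j 1) xi) =
  mass3 a * gk (ainv a) (dgk (ainv a) c3 (dgk (ainv a) i (dgk (ainv a) j (fun=> 1)))) y x.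
Proof.
move=> a0 i2 j2.
have gi k : intgr1 R (fun t => t ^+ expo2 i j 1 k * gs (a k) t) by exact: mono_gs_intgr.
rewrite (Int_trig_tens (x - y) gi).2 -!/(Jcos _ _ _) -!/(Jsin _ _ _).
rewrite /gk /tens /pg /dgk /ainv /mass3.
move: gi i2 j2; case: (ord3P i) => -> //; case: (ord3P j) => -> //= _ _ _;
rewrite /expo2 /= ?addn0 ?add0n ?addn1 /= !(Jcos0, Jsin0, Jcos1, Jsin1, Jcos2, Jsin2)//
  ?dpg2E ?dpg1E ?hornerC ?invrK /xcoord /tnth /=; ring.
Qed.

End fourier_tensor.

(** * The multiplication formula for the Fourier transform *)

Section multiplication_formula.
Context {R : realType}.
Implicit Types (x y xi : space3 R) (f g : space3 R -> R).

Lemma phase_msbl : measurable_fun [set: (mspace3 R * mspace3 R)%type]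
  (fun p => phase p.1 p.2 : R).
Proof.
apply: (measurable_funS (E := setT)) => //; rewrite /phase; under eq_fun do rewrite sum3E.
have c (i : 'I_3) : measurable_fun [set: (mspace3 R * mspace3 R)%type] (fun p => xcoord p.1 i * xcoord p.2 i : R).
  apply: measurable_funM.
  - exact: (measurableT_comp (@measurable_xcoord R i) measurable_fst).
  - exact: (measurableT_comp (@measurable_xcoord R i) measurable_snd).
by apply: measurable_funD; [apply: measurable_funD|]; exact: c.
Qed.

Lemma phaseC x xi : phase x xi = phase xi x.
Proof. by rewrite /phase; apply: eq_bigr => i _; rewrite mulrC. Qed.

Lemma trig_phase_msbl : measurable_fun [set: (mspace3 R * mspace3 R)%type] (fun p => cos (phase p.1 p.2) : R) /\
  measurable_fun [set: (mspace3 R * mspace3 R)%type] (fun p => sin (phase p.1 p.2) : R).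
Proof.
split.
- apply: (measurableT_comp _ phase_msbl); apply: continuous_measurable_fun; exact: continuous_cos.
- apply: (measurableT_comp _ phase_msbl); apply: continuous_measurable_fun; exact: continuous_sin.
Qed.

Lemma trig_phase_msbl1 x : msbl3 R (fun xi => cos (phase x xi)) /\ msbl3 R (fun xi => sin (phase x xi)).
Proof.
have [mc ms] := trig_phase_msbl; split.
- exact: (measurableT_comp mc (pair1_measurable x)).
- exact: (measurableT_comp ms (pair1_measurable x)).
Qed.

Lemma trig_intgr g x : intgr3 R g -> intgr3 R (fun xi => cos (phase x xi) * g xi) /\
  intgr3 R (fun xi => sin (phase x xi) * g xi).
Proof.
move=> gi; have [mc ms] := trig_phase_msbl1 x; split; apply: (intgr_le _ _ (intgr_norm gi)).
- by apply: msblM => //; exact: intgr_msbl gi.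
- by move=> t; rewrite normrM ler_piMl// abs_cos_le1.
- by apply: msblM => //; exact: intgr_msbl gi.
- by move=> t; rewrite normrM ler_piMl// abs_sin_le1.
Qed.

Lemma trig_sqint g x : sqint3 R g -> sqint3 R (fun xi => cos (phase x xi) * g xi) /\
  sqint3 R (fun xi => sin (phase x xi) * g xi).
Proof.
move=> gi; have [mc ms] := trig_phase_msbl1 x; split.
- by apply: (sqintM_bounded (C := 1)) => // t; exact: abs_cos_le1.
- by apply: (sqintM_bounded (C := 1)) => // t; exact: abs_sin_le1.
Qed.

Lemma Fubini3 (H : (mspace3 R * mspace3 R)%type -> R) :
  (@leb3s R \x @leb3s R)%E.-integrable setT (EFin \o H) ->
  (forall x, intgr3 R (fun y => H (x, y))) -> (forall y, intgr3 R (fun x => H (x, y))) ->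
  \int[leb3 R]_x (\int[leb3 R]_y H (x, y)) = \int[leb3 R]_y (\int[leb3 R]_x H (x, y)).
Proof.
move=> Hi H1 H2.
have := Fubini (m1 := @leb3s R) (m2 := @leb3s R) Hi => e.
rewrite {1}/Rintegral [RHS]/Rintegral; congr fine.
transitivity (\int[@leb3s R]_x \int[@leb3s R]_y (EFin \o H) (x, y))%E.
  by apply: eq_integral => x _; rewrite -(Int_EFin (H1 x)).
by rewrite e; apply: eq_integral => y _; rewrite -(Int_EFin (H2 y)).
Qed.

Lemma cubeE (n : nat) x : \1_(cube n) x = tens (fun=> cutoff n%:R) x :> R.
Proof.
rewrite /tens !cutoffE indicE -!natrM !mulnb; congr (nat_of_bool _)%:R.
apply/idP/idP; rewrite inE /cube /=.
- by move=> H; have := H c1; have := H c2; have := H c3; rewrite /xcoord /tnth /= => -> -> ->.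
- by move=> /andP[/andP[h1 h2] h3] i; case: (ord3P i) => ->.
Qed.

Lemma cutoff_intgr (N : R) : intgr1 R (cutoff N).
Proof.
exact: integrable_indic_itv.
Qed.

Lemma cube_sqint n : sqint3 R (\1_(cube n)).
Proof.
rewrite (_ : \1_(cube n) = tens (fun=> cutoff n%:R)); last by apply/funext => x; exact: cubeE.
apply: tens_sqint => _; split; first exact: measurable_cutoff.
have := cutoff_intgr n%:R; congr intgr; apply/funext => x.
by rewrite /cutoff indicE; case: (_ \in _); rewrite ?expr1n ?expr0n.
Qed.

Definition trunc f (n : nat) x : R := \1_(cube n) x * f x.

Lemma trunc_intgr f n : sqint3 R f -> intgr3 R (trunc f n).
Proof. by move=> fL; apply: sqint_mul => //; exact: cube_sqint. Qed.

Lemma trunc_le f n x : `|trunc f n x| <= `|f x|.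
Proof. by rewrite /trunc indicE; case: (_ \in _); rewrite ?mul1r// mul0r normr0. Qed.

Lemma trunc_cvg f x : trunc f n x @[n --> \oo] --> f x.
Proof.
apply: cvg_near_cst; near=> n.
suff xn : x \in cube n by rewrite /trunc indicE xn mul1r.
rewrite inE /cube /= => i.
rewrite (@le_trans _ _ (`|xcoord x c1| + `|xcoord x c2| + `|xcoord x c3|))//.
  have := normr_ge0 (xcoord x c1); have := normr_ge0 (xcoord x c2); have := normr_ge0 (xcoord x c3).
  by case: (ord3P i) => -> *; lra.
near: n; exact: nbhs_infty_ger.
Unshelve. all: by end_near.
Qed.

Lemma tfourierE f n xi :
  tfourier_re f n xi = \int[leb3 R]_x (trunc f n x * cos (phase x xi)) /\
  tfourier_im f n xi = - \int[leb3 R]_x (trunc f n x * sin (phase x xi)).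
Proof.
rewrite /tfourier_re /tfourier_im; split; [|congr (- _)]; rewrite [LHS]Rintegral_mkcond; apply: eq_Int => x;
by rewrite patchE /trunc indicE; case: (_ \in _); rewrite ?mul1r ?mul0r.
Qed.

(** Fubini's theorem applies to the trigonometric kernels because they are bounded
and a square-integrable function truncated to a cube is integrable. *)
Lemma kernel_integrable (c : (mspace3 R * mspace3 R)%type -> R) f1 g :
  measurable_fun setT c -> (forall p, `|c p| <= 1) -> intgr3 R f1 -> intgr3 R g ->
  (@leb3s R \x @leb3s R)%E.-integrable setT (EFin \o (fun p => c p * (f1 p.1 * g p.2))).
Proof.
move=> mc c1 f1i gi.
have h := prod_integrable (m1 := @leb3s R) (m2 := @leb3s R) f1i gi.
apply: (intgr_le _ _ (intgr_norm h)).
- by apply: msblM => //; exact: intgr_msbl h.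
- by move=> p; rewrite normrM ler_piMl.
Qed.

(** A trigonometric kernel is not integrable over all frequencies, so Fubini's theorem
gives the measurability of the transform times an integrable weight [w]; the
weight is then divided out. *)
Lemma tfourier_msbl f n : sqint3 R f -> msbl3 R (tfourier_re f n) /\ msbl3 R (tfourier_im f n).
Proof.
move=> fL; have ti := trunc_intgr n fL.
pose w : space3 R -> R := freq (fun=> 1) (fun=> 0%N).
have wi : intgr3 R w by have [] := @freq_sqint R (fun=> 1) (fun=> 0%N) (fun=> ltr01).
have w0 x : w x != 0.
  by rewrite /w /freq /tens !expr0 !mul1r !mulf_neq0// gt_eqF// gs_gt0.
have key (c : R -> R) : (forall r, `|c r| <= 1) ->
    measurable_fun [set: (mspace3 R * mspace3 R)%type] (fun p => c (phase p.1 p.2)) ->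
    msbl3 R (fun xi => \int[leb3 R]_x (trunc f n x * c (phase x xi))).
  move=> c1 mc; have ki := kernel_integrable mc (fun p => c1 (phase p.1 p.2)) wi ti.
  have := measurable_fubini_F ki; rewrite /fubini_F => mF.
  pose H (p : mspace3 R * mspace3 R) : R := c (phase p.1 p.2) * (w p.1 * trunc f n p.2).
  have -> : (fun xi => \int[leb3 R]_x (trunc f n x * c (phase x xi))) =
     (fun xi => (w xi)^-1 * fine (\int[@leb3s R]_y (EFin \o H) (xi, y))%E).
    apply/funext => xi.
    have h : intgr3 R (fun x => trunc f n x * c (phase x xi)).
      apply: (intgr_le _ _ (intgr_norm ti)).
      - apply: msblM; first exact: intgr_msbl ti.
        by have := measurableT_comp mc (pair1_measurable xi); under eq_fun do rewrite phaseC.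
      - by move=> x; rewrite normrM ler_piMr.
    apply: (mulfI (w0 xi)); rewrite mulVKf// -IntZ//.
    by apply: eq_Int => x /=; rewrite /H /= (phaseC x xi); ring.
  apply: msblM.
  - have mw : msbl3 R w by exact: intgr_msbl wi.
    have e : w = fun xi => expR (ln (w xi)).
      apply/funext => xi; rewrite lnK// posrE.
      by rewrite /w /freq /tens !expr0 !mul1r !mulr_gt0// gs_gt0.
    rewrite e; under eq_fun do rewrite -expRN.
    apply: measurableT_comp; first exact: measurable_expR.
    by apply: msblN; apply: (measurableT_comp _ mw); exact: measurable_ln.
  - by apply: (measurableT_comp _ mF); exact: fine_measurable.
have [mc ms] := trig_phase_msbl.
split.
- by have := key cos abs_cos_le1 mc; congr msbl; apply/funext => xi; rewrite (tfourierE f n xi).1.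
- have := msblN (key sin abs_sin_le1 ms); congr msbl; apply/funext => xi.
  by rewrite (tfourierE f n xi).2.
Qed.

Lemma trunc_exchange (c : R -> R) f g n : (forall r, `|c r| <= 1) ->
  measurable_fun [set: (mspace3 R * mspace3 R)%type] (fun p => c (phase p.1 p.2)) ->
  sqint3 R f -> intgr3 R g ->
  \int[leb3 R]_xi ((\int[leb3 R]_x (trunc f n x * c (phase x xi))) * g xi) =
  \int[leb3 R]_x (trunc f n x * \int[leb3 R]_xi (c (phase x xi) * g xi)) /\
  intgr3 R (fun x => trunc f n x * \int[leb3 R]_xi (c (phase x xi) * g xi)).
Proof.
move=> c1 mc fL gi; have ti := trunc_intgr n fL.
have ki := kernel_integrable mc (fun p => c1 (phase p.1 p.2)) ti gi.
have m1 x : msbl3 R (fun y => c (phase x y)) := measurableT_comp mc (pair1_measurable x).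
have m2 y : msbl3 R (fun x => c (phase x y)) := measurableT_comp mc (pair2_measurable y).
have i1 x : intgr3 R (fun y => c (phase x y) * g y).
  apply: (intgr_le _ _ (intgr_norm gi)); first by apply: msblM => //; exact: intgr_msbl gi.
  by move=> y; rewrite normrM ler_piMl.
have i2 y : intgr3 R (fun x => trunc f n x * c (phase x y)).
  apply: (intgr_le _ _ (intgr_norm ti)); first by apply: msblM => //; exact: intgr_msbl ti.
  by move=> x; rewrite normrM ler_piMr.
have i12 x : intgr3 R (fun y => c (phase x y) * (trunc f n x * g y)).
  have := intgrZ (trunc f n x) (i1 x); congr intgr.
  by apply/funext => y; ring.
have i21 y : intgr3 R (fun x => c (phase x y) * (trunc f n x * g y)).
  have := intgrZ (g y) (i2 y); congr intgr.
  by apply/funext => x; ring.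
have F := Fubini3 ki i12 i21; split; last first.
  have := integrable_fubini_F ki; rewrite /fubini_F /intgr.
  congr integrable; apply/funext => x /=; rewrite -IntZ// -Int_EFin ?i12//.
  - by apply: eq_integral => y _; congr EFin; ring.
  - exact: intgrZ.
transitivity (\int[leb3 R]_y \int[leb3 R]_x (c (phase x y) * (trunc f n x * g y))).
  apply: eq_Int => y; rewrite mulrC -IntZ//.
  by apply: eq_Int => x; ring.
rewrite -F; apply: eq_Int => x; rewrite -IntZ//.
by apply: eq_Int => y; ring.
Qed.

Lemma L2_cvg_Int (h : nat -> space3 R -> R) (g psi : space3 R -> R) :
  L2_cvg h g -> (forall n, msbl3 R (h n)) -> sqint3 R g -> sqint3 R psi ->
  \int[leb3 R]_x (h n x * psi x) @[n --> \oo] --> \int[leb3 R]_x (g x * psi x).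
Proof.
move=> hg mh gL psiL; pose M := \int[leb3 R]_x (psi x ^+ 2).
have M0 : 0 <= M by apply: Rintegral_ge0 => x _; exact: sqr_ge0.
apply/cvgrPdist_le => e e0.
(* The weight that makes both terms of [Int_mul_le] at most [e / 2]. *)
pose l := e / (2 * (1 + M)); have l0 : 0 < l by rewrite divr_gt0// mulr_gt0// ltr_pwDl.
have el : 0 < e * l / 2 by rewrite divr_gt0// mulr_gt0.
move: hg; rewrite /L2_cvg => /fine_cvgP[hfin /cvgrPdist_le /(_ _ el) hsmall].
near=> n.
have nfin : (\int[leb3 R]_x ((h n x - g x) ^+ 2)%:E)%E \is a fin_num by near: n.
have nsmall : `|0 - fine (\int[leb3 R]_x ((h n x - g x) ^+ 2)%:E)%E| <= e * l / 2.
  by near: n.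
have dL : sqint3 R (fun x => h n x - g x).
  have md : msbl3 R (fun x => h n x - g x) by apply: msblB => //; exact: gL.1.
  split => //; apply/integrableP; split.
    by apply/measurable_EFinP; apply: measurable_funX.
  under eq_integral do rewrite /= ger0_norm ?sqr_ge0//.
  by move: nfin; rewrite fin_numE => /andP[_]; rewrite ltey.
have hL : sqint3 R (h n).
  by have := sqintD dL gL; congr sqint; apply/funext => x; rewrite subrK.
rewrite distrC -IntB; [|exact: sqint_mul..].
rewrite (_ : Rintegral _ _ _ = \int[leb3 R]_x (psi x * (h n x - g x))); last first.
  by apply: eq_Int => x; ring.
apply: (le_trans (Int_mul_le l0 psiL dL)).
rewrite -/M; move: nsmall; rewrite sub0r normrN ger0_norm; last first.
  by apply: fine_ge0; apply: integral_ge0 => x _; rewrite lee_fin sqr_ge0.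
rewrite -/(Rintegral _ _ _) => nsmall.
have : l^-1 * \int[leb3 R]_x ((h n x - g x) ^+ 2) <= e / 2.
  by rewrite ler_pdivrMl// (_ : l * (e / 2) = e * l / 2)//; field.
have : l * M <= e / 2.
  rewrite /l mulrAC ler_pdivrMr ?mulr_gt0 ?ltr_pwDl//.
  by rewrite [leRHS](_ : _ = e * (1 + M)); [rewrite ler_pM2l// lerDr|field].
lra.
Unshelve. all: by end_near.
Qed.

(** The multiplication formula: the transform, defined as an [L2] limit over cubes,
is moved onto an integrable test function. Through it every property of a
Fourier multiplier becomes an identity between pairings with Gaussians. *)
Lemma fourier_pairing f fre fim g1 g2 : is_fourier f fre fim ->
  sqint3 R g1 -> intgr3 R g1 -> sqint3 R g2 -> intgr3 R g2 ->
  let k x := \int[leb3 R]_xi (cos (phase x xi) * g1 xi + sin (phase x xi) * g2 xi) in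
  sqint3 R k ->
  \int[leb3 R]_xi (fre xi * g1 xi) - \int[leb3 R]_xi (fim xi * g2 xi) =
  \int[leb3 R]_x (f x * k x).
Proof.
move=> [/L2_sqint fL /L2_sqint reL /L2_sqint imL recv imcv] g1L g1i g2L g2i k kL.
have [mc ms] := trig_phase_msbl.
have l1 := L2_cvg_Int recv (fun n => (tfourier_msbl n fL).1) reL g1L.
have l2 := L2_cvg_Int imcv (fun n => (tfourier_msbl n fL).2) imL g2L.
have l3 : \int[leb3 R]_x (trunc f n x * k x) @[n --> \oo] --> \int[leb3 R]_x (f x * k x).
  apply: (@Int_cvg _ (mspace3 R) R (leb3 R) (fun n x => trunc f n x * k x)
    (fun x => f x * k x) (fun x => `|f x * k x|)).
  - by move=> n; apply: msblM; [exact: intgr_msbl (trunc_intgr n fL)|exact: kL.1].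
  - by move=> x; apply: cvgM; [exact: trunc_cvg|exact: cvg_cst].
  - by apply: intgr_norm; exact: sqint_mul.
  - by move=> n x; rewrite normrM [leRHS]normrM; apply: ler_wpM2r => //; exact: trunc_le.
have e n : \int[leb3 R]_xi (tfourier_re f n xi * g1 xi) - \int[leb3 R]_xi (tfourier_im f n xi * g2 xi)
   = \int[leb3 R]_x (trunc f n x * k x).
  have [E1 i1] := trunc_exchange n abs_cos_le1 mc fL g1i.
  have [_ i2] := trunc_exchange n abs_sin_le1 ms fL g2i.
  have [E2 _] := trunc_exchange n abs_sin_le1 ms fL (intgrN g2i).
  have -> : \int[leb3 R]_xi (tfourier_re f n xi * g1 xi) =
      \int[leb3 R]_x (trunc f n x * \int[leb3 R]_xi (cos (phase x xi) * g1 xi)).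
    by rewrite -E1; apply: eq_Int => xi; rewrite (tfourierE f n xi).1.
  have -> : \int[leb3 R]_xi (tfourier_im f n xi * g2 xi) =
      - \int[leb3 R]_x (trunc f n x * \int[leb3 R]_xi (sin (phase x xi) * g2 xi)).
    rewrite -(IntN i2); transitivity (\int[leb3 R]_xi ((\int[leb3 R]_x (trunc f n x * sin (phase x xi))) * - g2 xi)).
      by apply: eq_Int => xi; rewrite (tfourierE f n xi).2 mulNr mulrN.
    rewrite E2; apply: eq_Int => x; rewrite -mulrN -IntN; last by have [] := trig_intgr x g2i.
    by congr (_ * _); apply: eq_Int => xi; rewrite mulrN.
  rewrite opprK.
  rewrite -(IntD i1 i2); apply: eq_Int => x; rewrite -mulrDr; congr (_ * _).
  by rewrite /k IntD//; [have [] := trig_intgr x g1i|have [] := trig_intgr x g2i].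
have l4 : \int[leb3 R]_x (trunc f n x * k x) @[n --> \oo] -->
    \int[leb3 R]_xi (fre xi * g1 xi) - \int[leb3 R]_xi (fim xi * g2 xi).
  by under eq_fun do rewrite -e; exact: cvgB l1 l2.
exact: (cvg_unique (@Rhausdorff R) l4 l3).
Qed.

End multiplication_formula.

(** * Riesz transforms tested against Gaussians *)

Section riesz.
Context {R : realType}.
Implicit Types (x y xi : space3 R) (f g G : space3 R -> R) (a b : 'I_3 -> R).

Lemma phaseB x y xi : phase (x - y) xi = phase x xi - phase y xi.
Proof. by rewrite !phaseE /=; ring. Qed.

Lemma pder_gk_fun b p y i : (forall k, 0 < b k) ->
  pder i (gk b p y) = gk b (dgk b i p) y.
Proof. by move=> b0; apply/funext => x; have [] := pder_gk p y i x b0. Qed.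

Lemma gk_sqint b p y : (forall k, 0 < b k) -> sqint3 R (gk b p y).
Proof. by move=> b0; apply: Hinf_sqint; exact: gk_Hinf. Qed.

(** The test functions on the frequency side carry the phase of the point [y], so
that their transforms are derivatives of Gaussians centred at [y]. *)
Lemma gauss_pairing_even f fre fim a (i j : 'I_3) y : is_fourier f fre fim ->
  (forall k, 0 < a k) -> (i < 2)%N -> (j < 2)%N ->
  \int[leb3 R]_xi (fre xi * (cos (phase y xi) * freq a (expo2 i j 0) xi)) -
  \int[leb3 R]_xi (fim xi * (sin (phase y xi) * freq a (expo2 i j 0) xi)) =
  - mass3 a * \int[leb3 R]_x (f x * pder i (pder j (gk (ainv a) (fun=> 1) y)) x).
Proof.
move=> ft a0 i2 j2; have [gL gi] := freq_sqint (expo2 i j 0) a0.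
have [cL sL] := trig_sqint y gL; have [ci si] := trig_intgr y gi.
have ia0 k : 0 < ainv a k by rewrite invr_gt0.
have fL : sqint3 R f by have [/L2_sqint] := ft.
rewrite !pder_gk_fun//; set K := gk _ _ _.
have KL : sqint3 R K by exact: gk_sqint.
have e x : \int[leb3 R]_xi (cos (phase x xi) * (cos (phase y xi) * freq a (expo2 i j 0) xi) +
    sin (phase x xi) * (sin (phase y xi) * freq a (expo2 i j 0) xi)) = - mass3 a * K x.
  rewrite mulNr -Int_freq_even//; apply: eq_Int => xi.
  by rewrite phaseB cosB; ring.
rewrite (fourier_pairing ft cL ci sL si); last first.
  by rewrite (_ : (fun x => _) = fun x => - mass3 a * K x); [exact: sqintZ|exact/funext].
rewrite -IntZ; last exact: sqint_mul.
by apply: eq_Int => x; rewrite e mulrCA.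
Qed.

Lemma gauss_pairing_odd f fre fim a (i j : 'I_3) y : is_fourier f fre fim ->
  (forall k, 0 < a k) -> (i < 2)%N -> (j < 2)%N ->
  \int[leb3 R]_xi (fre xi * (- sin (phase y xi) * freq a (expo2 i j 1) xi)) -
  \int[leb3 R]_xi (fim xi * (cos (phase y xi) * freq a (expo2 i j 1) xi)) =
  mass3 a * \int[leb3 R]_x (f x * pder c3 (pder i (pder j (gk (ainv a) (fun=> 1) y))) x).
Proof.
move=> ft a0 i2 j2; have [gL gi] := freq_sqint (expo2 i j 1) a0.
have [cL sL] := trig_sqint y gL; have [ci si] := trig_intgr y gi.
have ia0 k : 0 < ainv a k by rewrite invr_gt0.
have fL : sqint3 R f by have [/L2_sqint] := ft.
rewrite !pder_gk_fun//; set K := gk _ _ _.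
have KL : sqint3 R K by exact: gk_sqint.
have sL' : sqint3 R (fun xi => - sin (phase y xi) * freq a (expo2 i j 1) xi).
  by under eq_fun do rewrite mulNr; exact: sqintN.
have si' : intgr3 R (fun xi => - sin (phase y xi) * freq a (expo2 i j 1) xi).
  by under eq_fun do rewrite mulNr; exact: intgrN.
have e x : \int[leb3 R]_xi (cos (phase x xi) * (- sin (phase y xi) * freq a (expo2 i j 1) xi) +
    sin (phase x xi) * (cos (phase y xi) * freq a (expo2 i j 1) xi)) = mass3 a * K x.
  rewrite -Int_freq_odd//; apply: eq_Int => xi.
  by rewrite phaseB sinB; ring.
rewrite (fourier_pairing ft sL' si' cL ci); last first.
  by rewrite (_ : (fun x => _) = fun x => mass3 a * K x); [exact: sqintZ|exact/funext].
rewrite -IntZ; last exact: sqint_mul.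
by apply: eq_Int => x; rewrite e mulrCA.
Qed.

(** The horizontal Laplacian of a Gaussian centred at [y]; in [lapl_hK3] it carries
an additional vertical derivative. *)
Definition lapl_hK b y : space3 R -> R := fun x =>
  pder c1 (pder c1 (gk b (fun=> 1) y)) x + pder c2 (pder c2 (gk b (fun=> 1) y)) x.
Definition lapl_hK3 b y : space3 R -> R := fun x =>
  pder c3 (pder c1 (pder c1 (gk b (fun=> 1) y))) x + pder c3 (pder c2 (pder c2 (gk b (fun=> 1) y))) x.

Lemma symb_freq a (i j : 'I_3) e xi : (i < 2)%N -> (j < 2)%N ->
  symb_h i j xi * (freq a (expo2 c1 c1 e) xi + freq a (expo2 c2 c2 e) xi) =
  freq a (expo2 i j e) xi.
Proof.
move=> i2 j2; rewrite !freqE /symb_h.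
set E := freq _ _ _; set v := xi.2 ^+ e; set p := xcoord xi c1; set q := xcoord xi c2.
have [z0|nz] := eqVneq (p ^+ 2 + q ^+ 2) 0; last by field.
have /andP[/eqP p0 /eqP q0] : (p == 0) && (q == 0).
  by move/eqP: z0; rewrite paddr_eq0 ?sqr_ge0// !sqrf_eq0.
have z (k : 'I_3) : (k < 2)%N -> xcoord xi k = 0.
  by case: (ord3P k) => -> // _; rewrite -?/p -?/q ?p0 ?q0.
by rewrite !z// !mul0r.
Qed.

Lemma pairing_combine (m L1 M1 I1 L2 M2 I2 L M I : R) : m != 0 ->
  L1 - M1 = m * I1 -> L2 - M2 = m * I2 -> L - M = m * I ->
  L1 + L2 = L -> M1 + M2 = M -> I1 + I2 = I.
Proof.
move=> m0 e1 e2 e eL eM; apply: (mulfI m0); rewrite -eL -eM in e.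
by rewrite mulrDr -e1 -e2 -e; ring.
Qed.

(** The weak form of [Delta_h (R_ij f) = d_i d_j f], tested against Gaussians.
The symbol times [xi_1 ^+ 2 + xi_2 ^+ 2] is a monomial, also where the symbol is
a division by zero. *)
Lemma riesz_even f G b (i j : 'I_3) y : is_multiplier (symb_h i j) f G ->
  (forall k, 0 < b k) -> (i < 2)%N -> (j < 2)%N ->
  \int[leb3 R]_x (G x * lapl_hK b y x) =
  \int[leb3 R]_x (f x * pder i (pder j (gk b (fun=> 1) y)) x).
Proof.
move=> [fre [fim [ft Gt]]] b0 i2 j2.
pose a := ainv b; have a0 k : 0 < a k by rewrite invr_gt0.
have bE : b = ainv a by apply/funext => k; rewrite /a /ainv invrK.
have GL : sqint3 R G by have [/L2_sqint] := Gt.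
have [_ reL imL _ _] := ft; have {}reL := L2_sqint reL; have {}imL := L2_sqint imL.
have [_ GreL GimL _ _] := Gt; have {}GreL := L2_sqint GreL; have {}GimL := L2_sqint GimL.
have m0 : mass3 a != 0 by rewrite !mulf_neq0// gt_eqF// gmass_gt0.
have E11 := gauss_pairing_even y Gt a0 (isT : (c1 < 2)%N) (isT : (c1 < 2)%N).
have E22 := gauss_pairing_even y Gt a0 (isT : (c2 < 2)%N) (isT : (c2 < 2)%N).
have Eij := gauss_pairing_even y ft a0 i2 j2.
have KL k : sqint3 R (pder k (pder k (gk b (fun=> 1) y))).
  by rewrite !pder_gk_fun//; exact: gk_sqint.
have [c1L s1L] := trig_sqint y (freq_sqint (expo2 c1 c1 0) a0).1.
have [c2L s2L] := trig_sqint y (freq_sqint (expo2 c2 c2 0) a0).1.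
have nm0 : - mass3 a != 0 by rewrite oppr_eq0.
rewrite -bE in E11 E22 Eij.
transitivity (\int[leb3 R]_x (G x * pder c1 (pder c1 (gk b (fun=> 1) y)) x) +
  \int[leb3 R]_x (G x * pder c2 (pder c2 (gk b (fun=> 1) y)) x)).
  rewrite -(IntD (sqint_mul GL (KL c1)) (sqint_mul GL (KL c2))).
  by apply: eq_Int => x; rewrite mulrDr.
apply: (pairing_combine nm0 E11 E22 Eij).
- rewrite -(IntD (sqint_mul GreL c1L) (sqint_mul GreL c2L)).
  by apply: eq_Int => xi; rewrite -(symb_freq a 0 xi i2 j2); ring.
- rewrite -(IntD (sqint_mul GimL s1L) (sqint_mul GimL s2L)).
  by apply: eq_Int => xi; rewrite -(symb_freq a 0 xi i2 j2); ring.
Qed.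

Lemma riesz_odd f G b (i j : 'I_3) y : is_multiplier (symb_h i j) f G ->
  (forall k, 0 < b k) -> (i < 2)%N -> (j < 2)%N ->
  \int[leb3 R]_x (G x * lapl_hK3 b y x) =
  \int[leb3 R]_x (f x * pder c3 (pder i (pder j (gk b (fun=> 1) y))) x).
Proof.
move=> [fre [fim [ft Gt]]] b0 i2 j2.
pose a := ainv b; have a0 k : 0 < a k by rewrite invr_gt0.
have bE : b = ainv a by apply/funext => k; rewrite /a /ainv invrK.
have GL : sqint3 R G by have [/L2_sqint] := Gt.
have [_ reL imL _ _] := ft; have {}reL := L2_sqint reL; have {}imL := L2_sqint imL.
have [_ GreL GimL _ _] := Gt; have {}GreL := L2_sqint GreL; have {}GimL := L2_sqint GimL.
have m0 : mass3 a != 0 by rewrite !mulf_neq0// gt_eqF// gmass_gt0.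
have E11 := gauss_pairing_odd y Gt a0 (isT : (c1 < 2)%N) (isT : (c1 < 2)%N).
have E22 := gauss_pairing_odd y Gt a0 (isT : (c2 < 2)%N) (isT : (c2 < 2)%N).
have Eij := gauss_pairing_odd y ft a0 i2 j2.
have KL k : sqint3 R (pder c3 (pder k (pder k (gk b (fun=> 1) y)))).
  by rewrite !pder_gk_fun//; exact: gk_sqint.
have [c1L s1L] := trig_sqint y (freq_sqint (expo2 c1 c1 1) a0).1.
have [c2L s2L] := trig_sqint y (freq_sqint (expo2 c2 c2 1) a0).1.
have N g : sqint3 R (fun xi => sin (phase y xi) * g xi) -> sqint3 R (fun xi => - sin (phase y xi) * g xi).
  by move=> /sqintN; under eq_fun do rewrite -mulNr.
have n1L := N _ s1L; have n2L := N _ s2L.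
rewrite -bE in E11 E22 Eij.
transitivity (\int[leb3 R]_x (G x * pder c3 (pder c1 (pder c1 (gk b (fun=> 1) y))) x) +
  \int[leb3 R]_x (G x * pder c3 (pder c2 (pder c2 (gk b (fun=> 1) y))) x)).
  rewrite -(IntD (sqint_mul GL (KL c1)) (sqint_mul GL (KL c2))).
  by apply: eq_Int => x; rewrite mulrDr.
apply: (pairing_combine m0 E11 E22 Eij).
- rewrite -(IntD (sqint_mul GreL n1L) (sqint_mul GreL n2L)).
  by apply: eq_Int => xi; rewrite -(symb_freq a 1 xi i2 j2); ring.
- rewrite -(IntD (sqint_mul GimL c1L) (sqint_mul GimL c2L)).
  by apply: eq_Int => xi; rewrite -(symb_freq a 1 xi i2 j2); ring.
Qed.

End riesz.

(** * A Liouville theorem in the horizontal variables *)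

Section liouville.
Context {R : realType}.
Implicit Types (x y : space3 R) (tau s : R).

(** Only the horizontal width [s] moves with the heat flow; the vertical one stays
fixed. *)
Definition width (s delta : R) : 'I_3 -> R := fun j => if j == c3 then delta else s.

Lemma width_gt0 s delta : 0 < s -> 0 < delta -> forall k, 0 < width s delta k.
Proof. by move=> s0 d0 k; rewrite /width; case: ifP. Qed.

Let r2 y x : R := (x.1.1 - y.1.1) ^+ 2 + (x.1.2 - y.1.2) ^+ 2.

(** The two-dimensional heat kernel at time [expR tau]: in this time variable all
the formulas are exponentials, with no singularity. *)
Let heat y tau x : R := expR (- tau - r2 y x * expR (- tau) / 2).

Let hker delta y x : R := gs delta (x.2 - y.2).
Let hker3 delta y x : R := - (delta^-1 * (x.2 - y.2)) * gs delta (x.2 - y.2).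

Lemma heatE y tau x :
  heat y tau x = expR (- tau) * (gs (expR tau) (x.1.1 - y.1.1) * gs (expR tau) (x.1.2 - y.1.2)).
Proof.
rewrite /heat /gs -!expRD; congr expR; rewrite /r2 expRN; field.
by rewrite gt_eqF// expR_gt0.
Qed.

Lemma gk_widthE delta tau y x : 0 < delta ->
  gk (width (expR tau) delta) (fun=> 1) y x = expR tau * (heat y tau x * hker delta y x).
Proof.
move=> d0; rewrite heatE /gk /tens /pg /width /= !hornerC !mul1r /hker !mulrA.
by rewrite -expRD addrN expR0 mul1r.
Qed.

Lemma pder3_gk_widthE delta tau y x : 0 < delta ->
  pder c3 (gk (width (expR tau) delta) (fun=> 1) y) x = expR tau * (heat y tau x * hker3 delta y x).
Proof.
move=> d0; rewrite pder_gk_fun; last exact: width_gt0 (expR_gt0 _) d0.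
rewrite heatE /gk /tens /pg /width /dgk /= !hornerC dpg1E !mul1r /hker3 !mulrA.
by rewrite -expRD addrN expR0 mul1r.
Qed.

Let dheat y tau x : R := (r2 y x * expR (- tau) / 2 - 1) * heat y tau x.

Lemma heat_is_derive y x tau : is_derive tau 1 (heat y ^~ x) (dheat y tau x).
Proof.
have de : is_derive tau 1 (fun tau => expR (- tau)) (- expR (- tau)).
  have -> : (fun tau : R => expR (- tau)) = expR \o -%R by [].
  by apply: is_derive_eq; rewrite /GRing.scale /= mulrN mulr1.
have -> : heat y ^~ x = expR \o (fun tau => - tau - r2 y x * expR (- tau) / 2) by [].
have dq : is_derive tau 1 (fun tau => - tau - r2 y x * expR (- tau) / 2)
    (r2 y x * expR (- tau) / 2 - 1).
  by apply: is_derive_eq; rewrite /GRing.scale /=; ring.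
by apply: is_derive_eq; rewrite /GRing.scale /= mulrC.
Qed.

(** Up to normalization the Gaussian of horizontal width [expR tau] solves the heat
equation, so its horizontal Laplacian is a derivative in [tau]. *)
Lemma lapl_hK_heat delta tau y x : 0 < delta ->
  lapl_hK (width (expR tau) delta) y x = 2 * (dheat y tau x * hker delta y x).
Proof.
move=> d0; have w0 := width_gt0 (expR_gt0 tau) d0.
rewrite /lapl_hK !(pder_gk_fun _ _ _ w0) /gk /tens /pg /dgk /width /= !hornerC !dpg2E !mul1r.
rewrite /dheat heatE /hker /r2 -expRN.
by field.
Qed.

Lemma lapl_hK3_heat delta tau y x : 0 < delta ->
  lapl_hK3 (width (expR tau) delta) y x = 2 * (dheat y tau x * hker3 delta y x).
Proof.
move=> d0; have w0 := width_gt0 (expR_gt0 tau) d0.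
rewrite /lapl_hK3 !(pder_gk_fun _ _ _ w0) /gk /tens /pg /dgk /width /= !hornerC !dpg2E dpg1E !mul1r.
by rewrite /dheat heatE /hker3 /r2 -expRN; field; rewrite gt_eqF.
Qed.

Let majorant delta y t (p : {poly R}) x : R :=
  let k p1 p2 := gk (width (expR (t + 1)) delta)
     (fun j => if j == c3 then p else if j == c1 then p1 else p2) y x in
  let M := expR (1 - t) in
  M * (M / 2 * (k 'X^2 1 + k 1 'X^2) + k 1 1).

Lemma majorant_sqint delta y t p : 0 < delta -> sqint3 R (majorant delta y t p).
Proof.
move=> d0; rewrite /majorant; apply: sqintZ; apply: sqintD; last first.
  by apply: gk_sqint; exact: width_gt0 (expR_gt0 _) d0.
by apply: sqintZ; apply: sqintD; apply: gk_sqint; exact: width_gt0 (expR_gt0 _) d0.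
Qed.

(** For [tau] within distance [1] of [t] the kernel is at most the one of width
[expR (t + 1)], and the coefficients [expR (- tau)] are at most [expR (1 - t)]. *)
Lemma majorant_ge delta y t p tau x : 0 < delta -> t - 1 < tau < t + 1 ->
  `|dheat y tau x * (p.[x.2 - y.2] * gs delta (x.2 - y.2))| <= `|majorant delta y t p x|.
Proof.
move=> d0 /andP[t1 t2].
have -> : majorant delta y t p x = expR (1 - t) * (expR (1 - t) / 2 * r2 y x + 1) *
    (gs (expR (t + 1)) (x.1.1 - y.1.1) * gs (expR (t + 1)) (x.1.2 - y.1.2)) *
    (p.[x.2 - y.2] * gs delta (x.2 - y.2)).
  by rewrite /majorant /gk /tens /pg /width /= !hornerC !hornerXn /r2; ring.
rewrite normrM [leRHS]normrM; apply: ler_wpM2r => //.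
have r0 : 0 <= r2 y x by rewrite addr_ge0// sqr_ge0.
rewrite /dheat normrM [leRHS]ger0_norm; last first.
  by rewrite !mulr_ge0 ?addr_ge0 ?mulr_ge0 ?expR_ge0//; exact: ltW (gs_gt0 _ _).
have h1 : expR (- tau) <= expR (1 - t) by rewrite ler_expR; lra.
have e0 : 0 <= expR (- tau) by exact: expR_ge0.
have c1 : `|r2 y x * expR (- tau) / 2 - 1| <= expR (1 - t) / 2 * r2 y x + 1.
  by rewrite ler_norml; apply/andP; split; nra.
have c2 : `|heat y tau x| <= expR (1 - t) *
    (gs (expR (t + 1)) (x.1.1 - y.1.1) * gs (expR (t + 1)) (x.1.2 - y.1.2)).
  rewrite ger0_norm ?expR_ge0// heatE.
  apply: ler_pM => //; first by rewrite mulr_ge0// ltW// gs_gt0.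
  have g z : gs (expR tau) z <= gs (expR (t + 1)) z.
    rewrite /gs ler_expR !mulNr lerN2 ler_wpM2l ?sqr_ge0//.
    rewrite lef_pV2 ?posrE ?mulr_gt0 ?expR_gt0// ler_pM2l// ler_expR; lra.
  by apply: ler_pM => //; exact: ltW (gs_gt0 _ _).
apply: (le_trans (ler_pM _ _ c1 c2)) => //.
by rewrite le_eqVlt; apply/orP; left; apply/eqP; ring.
Qed.

Lemma gmass_sqr (a : R) : 0 < a -> gmass a ^+ 2 = 2 * pi * a.
Proof.
move=> a0; rewrite /gmass /normal_peak invrK sqr_sqrtr; last first.
  by rewrite mulrn_wge0// mulr_ge0 ?sqr_ge0 ?pi_ge0.
by rewrite sqr_sqrtr ?ltW// -mulr_natl; ring.
Qed.

(** The squared [L2] norm is inversely proportional to the horizontal width. *)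
Lemma heat_Int_sqr delta y tau p : 0 < delta ->
  \int[leb3 R]_x ((heat y tau x * (p.[x.2 - y.2] * gs delta (x.2 - y.2))) ^+ 2) =
  expR (- tau) * (pi * \int[leb1 R]_z (pg delta p y.2 z ^+ 2)).
Proof.
move=> d0; have s0 := expR_gt0 tau; set s := expR tau in s0 *.
pose F (j : 'I_3) (z : R) : R := pg (if j == c3 then delta else s)
  (if j == c3 then p else 1) (xcoord y j) z ^+ 2.
have w0 (j : 'I_3) : 0 < (if j == c3 then delta else s) by case: ifP.
have Fi j : intgr1 R (F j) by have [] := pg_sqint (if j == c3 then p else 1) (xcoord y j) (w0 j).
transitivity (\int[leb3 R]_x (expR (- tau) ^+ 2 * tens F x)).
  by apply: eq_Int => x; rewrite heatE /tens /F /pg /= !hornerC -/s /xcoord /tnth /=; ring.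
rewrite (IntZ _ (tens_intgr Fi)) (Int_tens Fi).
have h (z : R) : \int[leb1 R]_t (pg s 1 z t ^+ 2) = gmass (s / 2).
  rewrite -(Int_gs z); last by rewrite divr_gt0.
  by apply: eq_Int => t; rewrite pg_sqr// expr1n /pg hornerC mul1r.
rewrite /F /= !h -expr2 gmass_sqr ?divr_gt0// [xcoord y c3](_ : _ = y.2)//.
set e := expR (- tau); set J := Rintegral _ _ _.
have es : e * s = 1 by rewrite /e /s -expRD addNr expR0.
by transitivity (e * s * (e * (pi * J))); [field|rewrite es mul1r].
Qed.

(** Smoothing by the heat flow does not change the pairing, while the kernel tends
to zero in [L2]; so the pairing is zero. The vertical derivative stays on the
kernel, since [A - d_3 B], which is harmonic in the horizontal variables, need
not be a function. *)
Lemma heat_liouville A B delta y : sqint3 R A -> sqint3 R B -> 0 < delta ->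
  (forall s, 0 < s -> \int[leb3 R]_x (A x * lapl_hK (width s delta) y x) +
     \int[leb3 R]_x (B x * lapl_hK3 (width s delta) y x) = 0) ->
  forall s, 0 < s -> \int[leb3 R]_x (A x * gk (width s delta) (fun=> 1) y x) +
     \int[leb3 R]_x (B x * pder c3 (gk (width s delta) (fun=> 1) y) x) = 0.
Proof.
move=> AL BL d0 H.
pose p3 : {poly R} := dpg delta 1.
have k1E x : hker delta y x = (1 : {poly R}).[x.2 - y.2] * gs delta (x.2 - y.2).
  by rewrite hornerC mul1r.
have k3E x : hker3 delta y x = p3.[x.2 - y.2] * gs delta (x.2 - y.2).
  by rewrite /p3 dpg1E.
pose f tau x := heat y tau x * (A x * hker delta y x + B x * hker3 delta y x).
pose f' tau x := dheat y tau x * (A x * hker delta y x + B x * hker3 delta y x).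
have w0 tau := width_gt0 (expR_gt0 tau) d0.
have gL tau : sqint3 R (gk (width (expR tau) delta) (fun=> 1) y) by exact: gk_sqint.
have g3L tau : sqint3 R (pder c3 (gk (width (expR tau) delta) (fun=> 1) y)).
  by rewrite pder_gk_fun//; exact: gk_sqint.
have lL tau : sqint3 R (lapl_hK (width (expR tau) delta) y).
  by rewrite /lapl_hK !(pder_gk_fun _ _ _ (w0 tau)); apply: sqintD; exact: gk_sqint.
have l3L tau : sqint3 R (lapl_hK3 (width (expR tau) delta) y).
  by rewrite /lapl_hK3 !(pder_gk_fun _ _ _ (w0 tau)); apply: sqintD; exact: gk_sqint.
have ee tau : expR (- tau) * expR tau = 1 by rewrite -expRD addNr expR0.
have fE tau x : f tau x = expR (- tau) * (A x * gk (width (expR tau) delta) (fun=> 1) y x +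
    B x * pder c3 (gk (width (expR tau) delta) (fun=> 1) y) x).
  rewrite gk_widthE// pder3_gk_widthE// /f.
  transitivity (expR (- tau) * expR tau * (heat y tau x * (A x * hker delta y x + B x * hker3 delta y x))).
    by rewrite ee mul1r.
  by ring.
have f'E tau x : f' tau x = 2^-1 * (A x * lapl_hK (width (expR tau) delta) y x +
    B x * lapl_hK3 (width (expR tau) delta) y x).
  by rewrite lapl_hK_heat// lapl_hK3_heat// /f'; field.
pose E tau := \int[leb3 R]_x (f tau x).
have ag tau := sqint_mul AL (gL tau); have bg tau := sqint_mul BL (g3L tau).
have EE tau : E tau = expR (- tau) * (\int[leb3 R]_x (A x * gk (width (expR tau) delta) (fun=> 1) y x) +
     \int[leb3 R]_x (B x * pder c3 (gk (width (expR tau) delta) (fun=> 1) y) x)).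
  rewrite -(IntD (ag tau) (bg tau)) -IntZ; last exact: intgrD (ag tau) (bg tau).
  by apply: eq_Int => x; exact: fE.
have fi tau : intgr3 R (f tau).
  have := intgrZ (expR (- tau)) (intgrD (ag tau) (bg tau)).
  by congr intgr; apply/funext => x; rewrite fE.
(* By hypothesis the pairing does not change along the heat flow. *)
have dE (tau : R) : is_derive tau 1 E 0.
  have al := sqint_mul AL (lL tau); have bl := sqint_mul BL (l3L tau).
  have -> : 0 = \int[leb3 R]_x (f' tau x).
    transitivity (\int[leb3 R]_x (2^-1 * (A x * lapl_hK (width (expR tau) delta) y x +
        B x * lapl_hK3 (width (expR tau) delta) y x))); last by apply: eq_Int => x; rewrite f'E.
    by rewrite (IntZ _ (intgrD al bl)) (IntD al bl) H ?expR_gt0// mulr0.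
  pose G x := `|A x * majorant delta y tau 1 x| + `|B x * majorant delta y tau p3 x|.
  have Gi : intgr3 R G.
    by apply: intgrD; apply: intgr_norm; apply: sqint_mul => //; exact: majorant_sqint.
  have df (t : R) x : is_derive t 1 (f ^~ x) (f' t x).
    have dh := heat_is_derive y x t.
    by rewrite /f /f'; apply: is_derive_eq; rewrite /GRing.scale /=; ring.
  have d := @is_derive_Int _ _ _ (leb3 R) f f' G tau df fi Gi.
  apply: d => t x tI; rewrite /f' mulrDr (le_trans (ler_normD _ _))//.
  apply: lerD; rewrite mulrCA normrM [leRHS]normrM ler_wpM2l//.
  - by rewrite k1E; exact: majorant_ge.
  - by rewrite k3E; exact: majorant_ge.
have cE tau tau' : E tau = E tau' by apply: (is_derive_0_is_cst (f := E)) => t; exact: dE.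
pose a2 := \int[leb3 R]_x (A x ^+ 2); pose b2 := \int[leb3 R]_x (B x ^+ 2).
have a20 : 0 <= a2 by apply: Rintegral_ge0 => x _; exact: sqr_ge0.
have b20 : 0 <= b2 by apply: Rintegral_ge0 => x _; exact: sqr_ge0.
pose D p := pi * \int[leb1 R]_z (pg delta p y.2 z ^+ 2).
have D0 p : 0 <= D p.
  by rewrite mulr_ge0 ?pi_ge0//; apply: Rintegral_ge0 => x _; exact: sqr_ge0.
(* It also tends to zero: [l] is chosen first, small, and then [tau] large. *)
have small (l tau : R) : 0 < l -> `|E tau| <= l * (a2 + b2) + l^-1 * (expR (- tau) * (D 1 + D p3)).
  move=> l0.
  have hL p : sqint3 R (fun x => heat y tau x * (p.[x.2 - y.2] * gs delta (x.2 - y.2))).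
    have k := sqintZ (expR (- tau)) (gk_sqint (fun j => if j == c3 then p else 1) y (w0 tau)).
    move: k; congr sqint; apply/funext => x.
    by rewrite heatE /gk /tens /pg /width /= !hornerC; ring.
  have i1 := sqint_mul AL (hL 1); have i2 := sqint_mul BL (hL p3).
  have -> : E tau = \int[leb3 R]_x (A x * (heat y tau x * ((1 : {poly R}).[x.2 - y.2] * gs delta (x.2 - y.2)))) +
    \int[leb3 R]_x (B x * (heat y tau x * (p3.[x.2 - y.2] * gs delta (x.2 - y.2)))).
    by rewrite -(IntD i1 i2); apply: eq_Int => x; rewrite /f k1E k3E; ring.
  apply: (le_trans (ler_normD _ _)).
  apply: (le_trans (lerD (Int_mul_le l0 AL (hL 1)) (Int_mul_le l0 BL (hL p3)))).
  rewrite !(heat_Int_sqr _ _ _ d0) -/(D 1) -/(D p3) -/a2 -/b2.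
  by rewrite le_eqVlt; apply/orP; left; apply/eqP; ring.
have E0 tau : E tau = 0.
  apply/eqP; rewrite -normr_le0; apply/ler_addgt0Pr => e e0; rewrite add0r.
  pose l := e / (2 * (1 + a2 + b2)).
  have l0 : 0 < l by rewrite divr_gt0// mulr_gt0//; lra.
  pose m := l * e / (2 * (1 + D 1 + D p3)).
  have Dp : 0 < 1 + D 1 + D p3 by rewrite -addrA ltr_pwDl// addr_ge0.
  have m0 : 0 < m by apply: divr_gt0; apply: mulr_gt0.
  (* At time [- ln m] the kernel has squared norm proportional to [m]. *)
  rewrite (cE tau (- ln m)); apply: (le_trans (small l _ l0)).
  rewrite opprK lnK ?posrE//.
  have h1 : l * (a2 + b2) <= e / 2.
    rewrite /l mulrAC ler_pdivrMr ?mulr_gt0//; last by lra.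
    rewrite [leRHS](_ : _ = e * (1 + a2 + b2)); last by field.
    by rewrite ler_pM2l//; lra.
  have h2 : l^-1 * (m * (D 1 + D p3)) <= e / 2.
    rewrite ler_pdivrMl// /m mulrAC ler_pdivrMr ?mulr_gt0//.
    rewrite [leRHS](_ : _ = l * e * (1 + D 1 + D p3)); last by field.
    apply: ler_wpM2l; first by rewrite ltW// mulr_gt0.
    by rewrite -[X in _ <= X]addrA lerDr.
  by lra.
move=> s s0; have := EE (ln s); rewrite E0 lnK ?posrE// => /esym/eqP.
by rewrite mulf_eq0 gt_eqF ?expR_gt0//= => /eqP.
Qed.

End liouville.

(** * Gaussian mollification *)

Section mollification.
Context {R : realType}.
Implicit Types (x y : space3 R) (a : R) (f g psi : space3 R -> R).

(** The unnormalized isotropic Gaussian kernel; its mass is [gmass a ^+ 3]. *)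
Definition kiso a y x : R := gk (fun=> a) (fun=> 1) y x.

Lemma kisoE a y x :
  kiso a y x = gs a (x.1.1 - y.1.1) * gs a (x.1.2 - y.1.2) * gs a (x.2 - y.2).
Proof. by rewrite /kiso /gk /tens /pg !hornerC !mul1r. Qed.

Lemma kisoC a x y : kiso a y x = kiso a x y.
Proof. by rewrite !kisoE -(gsN _ (x.1.1 - _)) -(gsN _ (x.1.2 - _)) -(gsN _ (x.2 - _)) !opprB. Qed.

Lemma kiso_gt0 a y x : 0 < kiso a y x.
Proof. by rewrite kisoE !mulr_gt0// gs_gt0. Qed.

Lemma kiso_sqint a y : 0 < a -> sqint3 R (kiso a y).
Proof. by move=> a0; exact: gk_sqint. Qed.

Lemma gk_intgr (b : 'I_3 -> R) p y : (forall k, 0 < b k) -> intgr3 R (gk b p y).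
Proof. by move=> b0; apply: tens_intgr => i; exact: pg_intgr. Qed.

Lemma kiso_intgr a y : 0 < a -> intgr3 R (kiso a y).
Proof. by move=> a0; exact: gk_intgr. Qed.

Lemma Int_pg1 a (z : R) : 0 < a -> \int[leb1 R]_t (pg a 1 z t) = gmass a.
Proof.
by move=> a0; rewrite -(Int_gs z a0); apply: eq_Int => t; rewrite /pg hornerC mul1r.
Qed.

Lemma Int_pgX2 a (z : R) : 0 < a -> \int[leb1 R]_t (pg a 'X^2 z t) = a * gmass a.
Proof.
move=> a0.
have := Int_line0 (fun t => pg_is_derive 'X z t a0) (pg_continuous (p := _) (y := z) a0)
  (pg_intgr 'X z a0) (pg_intgr _ z a0).
have e t : pg a (dpg a 'X) z t = pg a 1 z t - a^-1 * pg a 'X^2 z t.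
  by rewrite /pg dpg_horner derivX !hornerC hornerX hornerXn; ring.
under eq_Rintegral do rewrite e.
rewrite (IntB (pg_intgr 1 z a0) (intgrZ a^-1 (pg_intgr 'X^2 z a0))) (IntZ _ (pg_intgr 'X^2 z a0)) Int_pg1//.
by move/eqP; rewrite subr_eq0 => /eqP ->; rewrite mulVKf// gt_eqF.
Qed.

Lemma Int_kiso a y : 0 < a -> \int[leb3 R]_x kiso a y x = gmass a ^+ 3.
Proof.
move=> a0; rewrite /kiso /gk Int_tens; last by move=> i; exact: pg_intgr.
by rewrite !Int_pg1//; ring.
Qed.

Lemma Int_kiso_moment a y : 0 < a ->
  \int[leb3 R]_x (kiso a y x *
    ((x.1.1 - y.1.1) ^+ 2 + (x.1.2 - y.1.2) ^+ 2 + (x.2 - y.2) ^+ 2)) = 3 * a * gmass a ^+ 3 /\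
  intgr3 R (fun x => kiso a y x *
    ((x.1.1 - y.1.1) ^+ 2 + (x.1.2 - y.1.2) ^+ 2 + (x.2 - y.2) ^+ 2)).
Proof.
move=> a0.
pose k (i : 'I_3) := gk (fun=> a) (fun j => if j == i then 'X^2 else 1) y.
have ki i : intgr3 R (k i) by exact: gk_intgr.
have e x : kiso a y x * ((x.1.1 - y.1.1) ^+ 2 + (x.1.2 - y.1.2) ^+ 2 + (x.2 - y.2) ^+ 2) =
   k c1 x + k c2 x + k c3 x.
  by rewrite kisoE /k /gk /tens /pg /= !hornerC !hornerXn; ring.
have Ik i : \int[leb3 R]_x k i x = a * gmass a ^+ 3.
  rewrite /k /gk Int_tens; last by move=> j; exact: pg_intgr.
  by case: (ord3P i) => -> /=; rewrite !Int_pg1// Int_pgX2//; ring.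
split.
- transitivity (\int[leb3 R]_x (k c1 x + k c2 x + k c3 x)); first by apply: eq_Int.
  rewrite (IntD (intgrD (ki c1) (ki c2)) (ki c3)) (IntD (ki c1) (ki c2)) !Ik; ring.
- have := intgrD (intgrD (ki c1) (ki c2)) (ki c3); congr intgr.
  by apply/funext => x; rewrite e.
Qed.

Local Notation pr := (@leb3s R \x @leb3s R)%E.
Local Notation msbl6 := (@msbl _ (mspace3 R * mspace3 R)%type R).

Lemma diff_msbl6 (i : 'I_3) : msbl6 (fun p => xcoord p.1 i - xcoord p.2 i).
Proof.
apply: msblB.
- exact: (measurableT_comp (@measurable_xcoord R i) measurable_fst).
- exact: (measurableT_comp (@measurable_xcoord R i) measurable_snd).
Qed.

Lemma kiso_msbl6 a : 0 < a -> msbl6 (fun p => kiso a p.2 p.1).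
Proof.
move=> a0.
have g (i : 'I_3) : msbl6 (fun p => gs a (xcoord p.1 i - xcoord p.2 i)).
  apply: (measurableT_comp _ (diff_msbl6 i)).
  have := pg_msbl 1 0 a0; congr measurable_fun.
  by apply/funext => t; rewrite /pg hornerC mul1r subr0.
have -> : (fun p : mspace3 R * mspace3 R => kiso a p.2 p.1) =
   fun p => gs a (xcoord p.1 c1 - xcoord p.2 c1) * gs a (xcoord p.1 c2 - xcoord p.2 c2) *
     gs a (xcoord p.1 c3 - xcoord p.2 c3).
  by apply/funext => p; rewrite kisoE.
by apply: msblM; [apply: msblM|]; exact: g.
Qed.

(** A Gaussian is integrable in either of its variables, uniformly in the other. *)
Lemma kiso_integrable_l a f : 0 < a -> intgr3 R f -> intgr pr (fun p => f p.1 * kiso a p.2 p.1).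
Proof.
move=> a0 fi.
have mH : msbl6 (fun p => f p.1 * kiso a p.2 p.1).
  by apply: msblM; [exact: (measurableT_comp (intgr_msbl fi) measurable_fst)|exact: kiso_msbl6].
apply/integrable12ltyP; first exact/measurable_EFinP.
have e x : (\int[leb3 R]_y `|(EFin \o (fun p => f p.1 * kiso a p.2 p.1)%R) (x, y)| =
   (`|f x| * gmass a ^+ 3)%:E)%E.
  have ki := intgrZ `|f x| (kiso_intgr x a0).
  rewrite -[in RHS](Int_kiso x a0) -IntZ; last exact: kiso_intgr.
  rewrite -(Int_EFin ki); apply: eq_integral => y _ /=.
  by rewrite normrM (gtr0_norm (kiso_gt0 _ _ _)) kisoC.
rewrite (_ : (fun x => _) = fun x => (`|f x| * gmass a ^+ 3)%:E); last exact/funext.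
have fi' : intgr3 R (fun x => `|f x| * gmass a ^+ 3).
  by have := intgrZ (gmass a ^+ 3) (intgr_norm fi); congr intgr; apply/funext => x; rewrite mulrC.
by rewrite (Int_EFin fi') ltry.
Qed.

Lemma kiso_integrable_r a f : 0 < a -> intgr3 R f -> intgr pr (fun p => f p.2 * kiso a p.2 p.1).
Proof.
move=> a0 fi.
have mH : msbl6 (fun p => f p.2 * kiso a p.2 p.1).
  by apply: msblM; [exact: (measurableT_comp (intgr_msbl fi) measurable_snd)|exact: kiso_msbl6].
apply/integrable21ltyP; first exact/measurable_EFinP.
have e y : (\int[leb3 R]_x `|(EFin \o (fun p => f p.2 * kiso a p.2 p.1)%R) (x, y)| =
   (`|f y| * gmass a ^+ 3)%:E)%E.
  have ki := intgrZ `|f y| (kiso_intgr y a0).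
  rewrite -[in RHS](Int_kiso y a0) -IntZ; last exact: kiso_intgr.
  rewrite -(Int_EFin ki); apply: eq_integral => x _ /=.
  by rewrite normrM (gtr0_norm (kiso_gt0 _ _ _)).
rewrite (_ : (fun y => _) = fun y => (`|f y| * gmass a ^+ 3)%:E); last exact/funext.
have fi' : intgr3 R (fun x => `|f x| * gmass a ^+ 3).
  by have := intgrZ (gmass a ^+ 3) (intgr_norm fi); congr intgr; apply/funext => x; rewrite mulrC.
by rewrite (Int_EFin fi') ltry.
Qed.

(** Schur's test for a kernel dominated by a Gaussian. *)
Lemma schur_integrable a C (k : mspace3 R -> mspace3 R -> R) f g : 0 < a ->
  msbl6 (fun p => k p.1 p.2) -> (forall x y, `|k x y| <= C * kiso a y x) ->
  sqint3 R f -> sqint3 R g -> intgr pr (fun p => f p.1 * g p.2 * k p.1 p.2).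
Proof.
move=> a0 mk kC fL gL.
have i1 := kiso_integrable_l a0 fL.2; have i2 := kiso_integrable_r a0 gL.2.
apply: (intgr_le _ _ (intgrZ C (intgrD i1 i2))).
- apply: msblM => //; apply: msblM.
  + exact: (measurableT_comp fL.1 measurable_fst).
  + exact: (measurableT_comp gL.1 measurable_snd).
- move=> [x y] /=; rewrite normrM -mulrDl mulrCA.
  have h : `|f x * g y| <= f x ^+ 2 + g y ^+ 2.
    rewrite normrM -(real_normK (num_real (f x))) -(real_normK (num_real (g y))).
    have := sqr_ge0 (`|f x| - `|g y|); have := sqr_ge0 (`|f x|); have := sqr_ge0 (`|g y|); nra.
  by apply: ler_pM.
Qed.

Lemma schur_exchange a C (k : mspace3 R -> mspace3 R -> R) f g : 0 < a ->
  msbl6 (fun p => k p.1 p.2) -> (forall x y, `|k x y| <= C * kiso a y x) ->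
  sqint3 R f -> sqint3 R g ->
  \int[leb3 R]_x (f x * \int[leb3 R]_y (g y * k x y)) =
  \int[leb3 R]_y (g y * \int[leb3 R]_x (f x * k x y)) /\
  intgr3 R (fun x => f x * \int[leb3 R]_y (g y * k x y)).
Proof.
move=> a0 mk kC fL gL; have Hi := schur_integrable a0 mk kC fL gL.
have C0 : 0 <= C.
  by have := le_trans (normr_ge0 _) (kC 0 0); rewrite pmulr_lge0// kiso_gt0.
have k1 x : sqint3 R (k x).
  apply: (@sqint_le _ (mspace3 R) R (leb3 R) _ (fun y => C * kiso a x y)).
  - exact: (measurableT_comp mk (pair1_measurable x)).
  - move=> y; rewrite (kisoC a y x) (ger0_norm (mulr_ge0 C0 (ltW (kiso_gt0 a y x)))).
    exact: kC.
  - by apply: sqintZ; exact: kiso_sqint.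
have k2 y : sqint3 R (k ^~ y).
  apply: (@sqint_le _ (mspace3 R) R (leb3 R) _ (fun x => C * kiso a y x)).
  - exact: (measurableT_comp mk (pair2_measurable y)).
  - move=> x; rewrite (ger0_norm (mulr_ge0 C0 (ltW (kiso_gt0 a y x)))).
    exact: kC.
  - by apply: sqintZ; exact: kiso_sqint.
have s1 x := sqint_mul gL (k1 x); have s2 y := sqint_mul fL (k2 y).
have S1 x : intgr3 R (fun y => f x * g y * k x y).
  by have := intgrZ (f x) (s1 x); congr intgr; apply/funext => y; rewrite mulrA.
have S2 y : intgr3 R (fun x => f x * g y * k x y).
  by have := intgrZ (g y) (s2 y); congr intgr; apply/funext => x; rewrite mulrCA mulrA.
have e1 x : f x * \int[leb3 R]_y (g y * k x y) = \int[leb3 R]_y (f x * g y * k x y).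
  by rewrite -(IntZ _ (s1 x)); apply: eq_Int => y; rewrite mulrA.
have e2 y : g y * \int[leb3 R]_x (f x * k x y) = \int[leb3 R]_x (f x * g y * k x y).
  by rewrite -(IntZ _ (s2 y)); apply: eq_Int => x; rewrite mulrCA mulrA.
split.
  transitivity (\int[leb3 R]_x \int[leb3 R]_y (f x * g y * k x y)); first by apply: eq_Int.
  by rewrite (Fubini3 Hi S1 S2); apply: eq_Int => y; rewrite e2.
have := integrable_fubini_F Hi; rewrite /fubini_F /intgr.
congr integrable; apply/funext => x /=; rewrite e1.
exact: (Int_EFin (S1 x)).
Qed.

Definition mollify a psi x : R :=
  (gmass a ^+ 3)^-1 * \int[leb3 R]_y (psi y * kiso a y x).

Lemma Hinf_lipschitz psi : Hinf psi -> exists L, 0 <= L /\ forall x y,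
  `|psi x - psi y| <= L * (`|x.1.1 - y.1.1| + `|x.1.2 - y.1.2| + `|x.2 - y.2|).
Proof.
move=> Hp.
have [C1 h1] := Hinf_bounded (Hinf_pder c1 Hp).
have [C2 h2] := Hinf_bounded (Hinf_pder c2 Hp).
have [C3 h3] := Hinf_bounded (Hinf_pder c3 Hp).
have C0 C (h : space3 R -> R) : (forall x, `|h x| <= C) -> 0 <= C.
  by move=> /(_ 0); apply: le_trans.
have C10 := C0 _ _ h1; have C20 := C0 _ _ h2; have C30 := C0 _ _ h3.
exists (C1 + C2 + C3); split; first by rewrite !addr_ge0.
have slice (i : 'I_3) (C : R) x (s t : R) : (forall x, `|pder i psi x| <= C) ->
    `|psi (upd x i s) - psi (upd x i t)| <= C * `|s - t|.
  move=> hC.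
  wlog st : s t / t <= s => [H|].
    by case: (leP t s) => [/H //|/ltW /H]; rewrite distrC (distrC s).
  have d (z : R) := Hreg_slice i x z (Hp 1%N).
  have [c _ ->] := MVT_segment st (fun z _ => d z) (continuous_subspaceT (is_derive_continuous d)).
  by rewrite normrM ler_wpM2r.
move=> x y.
(* From [y] to [x] along the three axes, one after the other. *)
have e1 : psi x - psi y = (psi (upd x c1 x.1.1) - psi (upd x c1 y.1.1)) +
  (psi (upd (y.1.1, x.1.2, x.2) c2 x.1.2) - psi (upd (y.1.1, x.1.2, x.2) c2 y.1.2)) +
  (psi (upd y c3 x.2) - psi (upd y c3 y.2)).
  case: x y => [[x1 x2] x3] [[y1 y2] y3]; rewrite /upd /=; ring.
rewrite e1; apply: (le_trans (ler_normD _ _)).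
apply: (@le_trans _ _ (C1 * `|x.1.1 - y.1.1| + C2 * `|x.1.2 - y.1.2| + C3 * `|x.2 - y.2|)).
  apply: lerD; last exact: slice.
  by apply: (le_trans (ler_normD _ _)); apply: lerD; exact: slice.
have := normr_ge0 (x.1.1 - y.1.1); have := normr_ge0 (x.1.2 - y.1.2); have := normr_ge0 (x.2 - y.2).
nra.
Qed.

(** A Lipschitz function moves by at most a multiple of the mean distance under the
Gaussian, which the second moment bounds by a multiple of [Num.sqrt a]. *)
Lemma mollify_close psi : Hinf psi -> exists C, 0 <= C /\
  forall a x, 0 < a -> `|mollify a psi x - psi x| <= C * Num.sqrt a.
Proof.
move=> Hp; have [L [L0 hL]] := Hinf_lipschitz Hp.
exists (3 * L); split; first by rewrite mulr_ge0.
move=> a x a0; set r := Num.sqrt a.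
have r0 : 0 < r by rewrite sqrtr_gt0.
have rr : r ^+ 2 = a by rewrite sqr_sqrtr// ltW.
set N := gmass a ^+ 3; have N0 : 0 < N by rewrite exprn_gt0// gmass_gt0.
have [mom momi] := Int_kiso_moment x a0.
have ki := kiso_intgr x a0.
have pi' : intgr3 R (fun y => psi y * kiso a x y).
  by apply: sqint_mul; [exact: Hinf_sqint|exact: kiso_sqint].
have -> : mollify a psi x - psi x = N^-1 * \int[leb3 R]_y ((psi y - psi x) * kiso a x y).
  have -> : \int[leb3 R]_y ((psi y - psi x) * kiso a x y) =
     \int[leb3 R]_y (psi y * kiso a x y) - psi x * N.
    rewrite /N -(Int_kiso x a0) -(IntZ _ ki) -(IntB pi' (intgrZ _ ki)).
    by apply: eq_Int => y; rewrite mulrBl.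
  have NN : N^-1 * (psi x * N) = psi x by rewrite mulrCA mulVf ?mulr1 ?gt_eqF.
  rewrite mulrBr NN /mollify -/N; congr (_ * _ - _).
  by apply: eq_Int => y; rewrite kisoC.
rewrite normrM normfV (gtr0_norm N0) ler_pdivrMl//.
pose Q (y : space3 R) := (y.1.1 - x.1.1) ^+ 2 + (y.1.2 - x.1.2) ^+ 2 + (y.2 - x.2) ^+ 2.
apply: (@le_trans _ _ (\int[leb3 R]_y (L * (3 / 2 * r) * kiso a x y + L * (2 * r)^-1 * (kiso a x y * Q y)))).
  apply: le_abs_Int.
  - have := intgrB pi' (intgrZ (psi x) ki); congr intgr.
    by apply/funext => y; rewrite mulrBl.
  - exact: intgrD (intgrZ _ ki) (intgrZ _ momi).
  move=> y; rewrite normrM (gtr0_norm (kiso_gt0 _ _ _)) [leRHS](_ : _ = kiso a x y *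
     (L * (3 / 2 * r + (2 * r)^-1 * Q y))); last by ring.
  rewrite [leLHS]mulrC; apply: ler_wpM2l; first exact: ltW (kiso_gt0 _ _ _).
  apply: (le_trans (hL y x)); apply: ler_wpM2l => //.
  (* [r = Num.sqrt a] balances the two terms, since the second moment is of order
  [a]. *)
  have amgm z : `|z| <= r / 2 + (2 * r)^-1 * z ^+ 2.
    have h := sqr_ge0 (r - `|z|); have rV : 0 < (2 * r)^-1 by rewrite invr_gt0 mulr_gt0.
    have := mulr_ge0 (ltW rV) h; rewrite -(real_normK (num_real z)) => h'.
    rewrite -subr_ge0 (le_trans h')// le_eqVlt; apply/orP; left; apply/eqP.
    by field; rewrite gt_eqF.
  have := amgm (y.1.1 - x.1.1); have := amgm (y.1.2 - x.1.2); have := amgm (y.2 - x.2).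
  by rewrite /Q; lra.
rewrite (IntD (intgrZ _ ki) (intgrZ _ momi)) (IntZ _ ki) (IntZ _ momi) mom (Int_kiso x a0) -/N.
rewrite le_eqVlt; apply/orP; left; apply/eqP; rewrite -rr; field.
by rewrite gt_eqF.
Qed.

End mollification.

(** * Weak uniqueness *)

Section duality.
Context {R : realType}.
Implicit Types (x y : space3 R) (a : R) (psi phi A B : space3 R -> R).

(** Interpolation: the error is uniformly of order [Num.sqrt a] and bounded in [L1],
so its square has an integral of order [Num.sqrt a]. *)
Lemma mollify_L2 psi : Hinf psi -> intgr3 R psi -> exists C, 0 <= C /\ forall a, 0 < a ->
  sqint3 R (fun x => mollify a psi x - psi x) /\
  \int[leb3 R]_x ((mollify a psi x - psi x) ^+ 2) <= C * Num.sqrt a.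
Proof.
move=> Hp ip; have [C [C0 hC]] := mollify_close Hp.
pose J := \int[leb3 R]_x `|psi x|.
have J0 : 0 <= J by apply: Rintegral_ge0 => x _.
exists (C * (2 * J)); split; first by rewrite !mulr_ge0.
move=> a a0; set N := gmass a ^+ 3; have N0 : 0 < N by rewrite exprn_gt0// gmass_gt0.
pose h psi' (x : space3 R) : R := \int[leb3 R]_y (psi' y * kiso a y x).
have s psi' x : intgr3 R psi' -> intgr3 R (fun y => psi' y * kiso a y x).
  move=> i'.
  apply: (intgr_le _ _ (intgr_norm i')).
  - apply: msblM; first exact: intgr_msbl i'.
    by have := intgr_msbl (kiso_intgr x a0); congr msbl; apply/funext => y; rewrite kisoC.
  - move=> y; rewrite normrM ler_piMr// (gtr0_norm (kiso_gt0 _ _ _)) kisoE.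
    by rewrite !mulr_ile1 ?mulr_ge0 ?gs_le1//; exact: ltW (gs_gt0 _ _).
have hi psi' : intgr3 R psi' -> intgr3 R (h psi').
  move=> i'; have := integrable_fubini_F (kiso_integrable_r a0 i').
  rewrite /fubini_F /intgr; congr integrable; apply/funext => x /=.
  exact: (Int_EFin (s _ x i')).
have ni := intgr_norm ip.
have hn : \int[leb3 R]_x h (fun y => `|psi y|) x = N * J.
  rewrite /h (Fubini3 (kiso_integrable_r a0 ni)).
  - rewrite /J -(IntZ _ ni); apply: eq_Int => y /=.
    by rewrite (IntZ _ (kiso_intgr y a0)) (Int_kiso y a0) mulrC.
  - by move=> x; exact: s ni.
  - by move=> y; exact: (intgrZ `|psi y| (kiso_intgr y a0)).
pose d x := mollify a psi x - psi x.
have di : intgr3 R d by exact: intgrB (intgrZ N^-1 (hi _ ip)) ip.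
have dC x : `|d x| <= C * Num.sqrt a by exact: hC.
have d2 x : d x ^+ 2 <= C * Num.sqrt a * `|d x|.
  by rewrite -(real_normK (num_real (d x))) expr2 ler_wpM2r.
have d2i : intgr3 R (fun x => d x ^+ 2).
  apply: (intgr_le _ _ (intgrZ (C * Num.sqrt a) (intgr_norm di))).
  - by apply: measurable_funX; exact: intgr_msbl di.
  - by move=> x; rewrite ger0_norm ?sqr_ge0.
split; first by split => //; exact: intgr_msbl di.
apply: (@le_trans _ _ (\int[leb3 R]_x (C * Num.sqrt a * `|d x|))).
  by apply: le_Int => //; apply: intgrZ; exact: intgr_norm.
rewrite (IntZ _ (intgr_norm di)) [leRHS]mulrAC.
apply: ler_wpM2l; first by rewrite mulr_ge0.
have -> : 2 * J = N^-1 * (N * J) + J.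
  by rewrite mulKf ?gt_eqF// mulr_natl.
rewrite -hn -(IntZ _ (hi _ ni)) -(IntD (intgrZ _ (hi _ ni)) ni).
apply: le_Int.
- exact: intgr_norm.
- exact: intgrD (intgrZ _ (hi _ ni)) ni.
move=> x; apply: (le_trans (ler_normB _ _)); rewrite lerD2r /mollify -/N normrM.
rewrite normfV (gtr0_norm N0); apply: ler_wpM2l; first by rewrite invr_ge0 ltW.
apply: le_abs_Int; [exact: s|exact: s ni|move=> y].
by rewrite normrM (gtr0_norm (kiso_gt0 _ _ _)).
Qed.

Lemma mollify_pairing A psi : sqint3 R A -> Hinf psi -> intgr3 R psi ->
  forall e, 0 < e -> exists2 a0, 0 < a0 & forall a, 0 < a -> a <= a0 ->
  `|\int[leb3 R]_x (A x * mollify a psi x) - \int[leb3 R]_x (A x * psi x)| <= e.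
Proof.
move=> AL Hp ip e e0; have [C [C0 hC]] := mollify_L2 Hp ip.
pose M := \int[leb3 R]_x (A x ^+ 2).
have M0 : 0 <= M by apply: Rintegral_ge0 => x _; exact: sqr_ge0.
pose l := e / (2 * (1 + M)); have l0 : 0 < l by apply: divr_gt0 => //; apply: mulr_gt0 => //; exact: ltr_pwDl.
pose r := l * e / (2 * (1 + C)); have r0 : 0 < r.
  by apply: divr_gt0; apply: mulr_gt0 => //; exact: ltr_pwDl.
exists (r ^+ 2); first by rewrite exprn_gt0.
move=> a a0 ar; have [dL d2] := hC _ a0.
have pL := Hinf_sqint Hp.
have mL : sqint3 R (mollify a psi).
  by have := sqintD dL pL; congr sqint; apply/funext => x; rewrite subrK.
rewrite -(IntB (sqint_mul AL mL) (sqint_mul AL pL)).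
have -> : \int[leb3 R]_x (A x * mollify a psi x - A x * psi x) =
    \int[leb3 R]_x (A x * (mollify a psi x - psi x)).
  by apply: eq_Int => x; rewrite mulrBr.
apply: (le_trans (Int_mul_le l0 AL dL)); rewrite -/M.
have sr : Num.sqrt a <= r.
  by rewrite -(ger0_norm (ltW r0)) -sqrtr_sqr ler_sqrt// exprn_ge0// ltW.
have h1 : l * M <= e / 2.
  rewrite /l mulrAC ler_pdivrMr ?mulr_gt0 ?ltr_pwDl//.
  rewrite [leRHS](_ : _ = e * (1 + M)); last by field.
  by rewrite ler_pM2l// lerDr.
have h2 : l^-1 * \int[leb3 R]_x ((mollify a psi x - psi x) ^+ 2) <= e / 2.
  rewrite ler_pdivrMl//; apply: (le_trans d2).
  apply: (le_trans (ler_wpM2l C0 sr)); rewrite /r mulrA ler_pdivrMr ?mulr_gt0 ?ltr_pwDl//.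
  rewrite [leRHS](_ : _ = (1 + C) * (l * e)); last by field.
  by apply: ler_wpM2r; [rewrite mulr_ge0// ltW|rewrite lerDr].
lra.
Qed.

Lemma near_zero_sum (p p' q q' e : R) :
  `|p - q| <= e / 2 -> `|p' - q'| <= e / 2 -> p + p' = 0 -> `|q + q'| <= e.
Proof.
move=> h1 h2 z; rewrite -normrN (_ : - (q + q') = (p - q) + (p' - q')); last by lra.
by apply: (le_trans (ler_normD _ _)); lra.
Qed.

Lemma pder3_kisoE a y x : 0 < a ->
  pder c3 (kiso a y) x = - (a^-1 * (x.2 - y.2)) * kiso a y x.
Proof.
move=> a0; rewrite /kiso pder_gk_fun//.
by rewrite /gk /tens /pg /dgk /= !hornerC dpg1E !mul1r /xcoord /tnth /=; ring.
Qed.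

Lemma pder3_kiso_bound a : 0 < a -> exists C, forall x y,
  `|pder c3 (kiso a y) x| <= C * kiso (2 * a) y x.
Proof.
move=> a0; have a20 : 0 < 2 * a by rewrite mulr_gt0.
have [C hC] := norm_gs_bounded a20.
exists (a^-1 * C) => x y; rewrite pder3_kisoE// normrM (gtr0_norm (kiso_gt0 _ _ _)).
rewrite normrN normrM (gtr0_norm (x := a^-1)) ?invr_gt0// -!mulrA ler_pM2l ?invr_gt0//.
rewrite !kisoE; set z1 := x.1.1 - _; set z2 := x.1.2 - _; set z3 := x.2 - _.
have g z : gs a z <= gs (2 * a) z.
  by rewrite gs_half// ler_piMl ?gs_le1// ltW// gs_gt0.
rewrite (gs_half z3)//.
have -> : `|z3| * (gs a z1 * gs a z2 * (gs (2 * a) z3 * gs (2 * a) z3)) =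
   (`|z3| * gs (2 * a) z3) * (gs a z1 * gs a z2 * gs (2 * a) z3) by ring.
have p z : 0 <= gs a z by exact: ltW (gs_gt0 _ _).
have p2 z : 0 <= gs (2 * a) z by exact: ltW (gs_gt0 _ _).
apply: ler_pM; [by rewrite mulr_ge0|by rewrite !mulr_ge0|exact: hC|].
by apply: ler_wpM2r => //; apply: ler_pM.
Qed.

(** The mollified test function is a superposition of Gaussians, so the pairing
vanishes on it, and mollification converges in the pairing. *)
Lemma gauss_duality A B phi : sqint3 R A -> sqint3 R B ->
  (forall a y, 0 < a -> \int[leb3 R]_x (A x * kiso a y x) +
     \int[leb3 R]_x (B x * pder c3 (kiso a y) x) = 0) ->
  Hinf phi -> intgr3 R phi -> intgr3 R (pder c3 phi) ->
  \int[leb3 R]_x (A x * phi x) + \int[leb3 R]_x (B x * pder c3 phi x) = 0.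
Proof.
move=> AL BL H Hp ip idp; have Hdp := Hinf_pder c3 Hp.
have zero a : 0 < a -> \int[leb3 R]_x (A x * mollify a phi x) +
    \int[leb3 R]_x (B x * mollify a (pder c3 phi) x) = 0.
  move=> a0; set N := gmass a ^+ 3.
  have Np : 0 < N by rewrite exprn_gt0// gmass_gt0.
  have N0 : N != 0 by rewrite (gt_eqF Np).
  have pL := Hinf_sqint Hp.
  have m1 : measurable_fun [set: (mspace3 R * mspace3 R)%type] (fun p => kiso a p.1 p.2).
    by have := kiso_msbl6 a0; congr measurable_fun; apply/funext => p; rewrite kisoC.
  have m3 : measurable_fun [set: (mspace3 R * mspace3 R)%type] (fun p => pder c3 (kiso a p.1) p.2).
    have -> : (fun p : mspace3 R * mspace3 R => pder c3 (kiso a p.1) p.2) =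
       fun p => a^-1 * (xcoord p.1 c3 - xcoord p.2 c3) * kiso a p.1 p.2.
      by apply/funext => p; rewrite pder3_kisoE// /xcoord /tnth /=; ring.
    by apply: msblM => //; apply: msblM; [exact: msbl_cst|exact: diff_msbl6].
  have b1 x y : `|kiso a x y| <= 1 * kiso a y x.
    by rewrite mul1r (gtr0_norm (kiso_gt0 _ _ _)) kisoC.
  have [C hC] := pder3_kiso_bound a0.
  have b3 x y : `|pder c3 (kiso a x) y| <= C * kiso (2 * a) y x by rewrite kisoC.
  have a20 : 0 < 2 * a by rewrite mulr_gt0.
  have [E1 I1] := schur_exchange a0 m1 b1 pL AL.
  have [E3 I3] := schur_exchange a20 m3 b3 pL BL.
  have mL psi : Hinf psi -> intgr3 R psi -> sqint3 R (mollify a psi).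
    move=> Hq iq; have [D [_ /(_ _ a0)[dL _]]] := mollify_L2 Hq iq.
    by have := sqintD dL (Hinf_sqint Hq); congr sqint; apply/funext => x; rewrite subrK.
  have e1 : \int[leb3 R]_x (A x * mollify a phi x) = N^-1 *
      \int[leb3 R]_y (A y * \int[leb3 R]_x (phi x * kiso a x y)).
    apply: (mulfI N0); rewrite (mulVKf N0) -(IntZ _ (sqint_mul AL (mL _ Hp ip))).
    by apply: eq_Int => x; rewrite /mollify -/N mulrCA (mulVKf N0).
  have e3 : \int[leb3 R]_x (B x * mollify a (pder c3 phi) x) = N^-1 *
      \int[leb3 R]_y (B y * \int[leb3 R]_x (phi x * pder c3 (kiso a x) y)).
    apply: (mulfI N0); rewrite (mulVKf N0) -(IntZ _ (sqint_mul BL (mL _ Hdp idp))).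
    apply: eq_Int => y; rewrite /mollify -/N mulrCA (mulVKf N0); congr (_ * _).
    have Hk : Hinf (kiso a y) by exact: gk_Hinf.
    transitivity (\int[leb3 R]_x (pder c3 phi x * kiso a y x)).
      by apply: eq_Int => x; rewrite kisoC.
    rewrite (Int_by_parts c3 Hp Hk) -IntN; last exact: Hinf_intgr2 Hp (Hinf_pder c3 Hk).
    by apply: eq_Int => x; rewrite (pder3_kisoE _ _ a0) (pder3_kisoE _ _ a0) (kisoC a x y); ring.
  rewrite e1 e3 -E1 -E3 -mulrDr -(IntD I1 I3).
  rewrite (_ : Rintegral _ _ _ = \int[leb3 R]_x 0); last first.
    by apply: eq_Int => x; rewrite -mulrDr (H a x a0) mulr0.
  by rewrite /Rintegral integral0 mulr0.
apply/eqP; rewrite -normr_le0; apply/ler_addgt0Pr => e e0; rewrite add0r.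
have e20 : 0 < e / 2 by rewrite divr_gt0.
have [r1 r10 h1] := mollify_pairing AL Hp ip e20.
have [r2 r20 h2] := mollify_pairing BL Hdp idp e20.
pose a := Num.min r1 r2; have a0 : 0 < a by rewrite lt_min r10.
have a1 : a <= r1 by rewrite ge_min lexx.
have a2 : a <= r2 by rewrite ge_min lexx orbT.
exact: (near_zero_sum (h1 a a0 a1) (h2 a a0 a2) (zero a a0)).
Qed.

End duality.

(** * The horizontal Biot-Savart law *)

Section biot_savart.
Context {R : realType}.
Implicit Types (f g h phi V w v G : space3 R -> R) (x y : space3 R) (i j : 'I_3).

Lemma Int_by_parts2 i j f g : Hinf f -> Hinf g ->
  \int[leb3 R]_x (pder i (pder j f) x * g x) = \int[leb3 R]_x (f x * pder i (pder j g) x).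
Proof.
move=> Hf Hg.
rewrite (Int_by_parts i (Hinf_pder j Hf) Hg) (Int_by_parts j Hf (Hinf_pder i Hg)) opprK.
by rewrite (pderC j i Hg).
Qed.

Lemma Int_by_parts3 i j k f g : Hinf f -> Hinf g ->
  \int[leb3 R]_x (pder i (pder j (pder k f)) x * g x) =
  - \int[leb3 R]_x (f x * pder i (pder j (pder k g)) x).
Proof.
move=> Hf Hg.
rewrite (Int_by_parts i (Hinf_pder j (Hinf_pder k Hf)) Hg).
rewrite (Int_by_parts2 j k Hf (Hinf_pder i Hg)).
by rewrite (pderC k i Hg) (pderC j i (Hinf_pder k Hg)).
Qed.

Lemma riesz_combine (s L1 L2 I1 I2 I3 I4 I5 : R) :
  L1 = I1 - s * I2 -> L2 = - I3 -> I2 = I4 -> I3 = I5 -> I1 = s * I4 + I5 -> L1 + L2 = 0.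
Proof. by move=> -> -> -> -> ->; ring. Qed.

Lemma riesz_solve (s L1 L2 I1 I2 I3 : R) :
  L1 = I1 - s * I2 -> L2 = - I3 -> L1 + L2 = 0 -> I1 = s * I2 + I3.
Proof. by move=> -> -> e; lra. Qed.

(** The difference of [V] and [sigma R_ij w - d_3 R_kl v] is harmonic in the
horizontal variables, by the horizontal Poisson equation for [V]; the vertical
derivative is put on the test function, since [R_kl v] need not be
differentiable. *)
Lemma riesz_representation (sigma : R) V w v G Gv (i j k l : 'I_3) phi :
  Hinf V -> Hinf w -> Hinf v -> (i < 2)%N -> (j < 2)%N -> (k < 2)%N -> (l < 2)%N ->
  (forall x, pder c1 (pder c1 V) x + pder c2 (pder c2 V) x =
     sigma * pder i (pder j w) x - pder c3 (pder k (pder l v)) x) ->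
  is_multiplier (symb_h i j) w G -> is_multiplier (symb_h k l) v Gv ->
  Hinf phi -> intgr3 R phi -> intgr3 R (pder c3 phi) ->
  \int[leb3 R]_x (V x * phi x) =
  sigma * \int[leb3 R]_x (G x * phi x) + \int[leb3 R]_x (Gv x * pder c3 phi x).
Proof.
move=> HV Hw Hv i2 j2 k2 l2 lap mG mGv Hp ip idp.
have GL : sqint3 R G by have [? [? [_ [/L2_sqint]]]] := mG.
have GvL : sqint3 R Gv by have [? [? [_ [/L2_sqint]]]] := mGv.
have VL := Hinf_sqint HV; have sGL := sqintZ sigma GL.
have AL : sqint3 R (fun x => V x - sigma * G x) by exact: sqintB.
have BL : sqint3 R (fun x => - Gv x) by exact: sqintN.
have split_A psi : sqint3 R psi -> \int[leb3 R]_x ((V x - sigma * G x) * psi x) =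
    \int[leb3 R]_x (V x * psi x) - sigma * \int[leb3 R]_x (G x * psi x).
  move=> pL; rewrite -(IntZ _ (sqint_mul GL pL)) -(IntB (sqint_mul VL pL) (intgrZ _ (sqint_mul GL pL))).
  by apply: eq_Int => x; ring.
have split_B psi : sqint3 R psi -> \int[leb3 R]_x (- Gv x * psi x) =
    - \int[leb3 R]_x (Gv x * psi x).
  by move=> pL; rewrite -(IntN (sqint_mul GvL pL)); apply: eq_Int => x; rewrite mulNr.
(* On Gaussians: the Liouville theorem, whose hypothesis is the equation for [V]
integrated by parts onto the kernel. *)
have key (a : R) y : 0 < a -> \int[leb3 R]_x ((V x - sigma * G x) * kiso a y x) +
    \int[leb3 R]_x (- Gv x * pder c3 (kiso a y) x) = 0.
  move=> a0.
  have wE : width a a = fun=> a by apply/funext => m; rewrite /width; case: ifP.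
  have := heat_liouville (A := fun x => V x - sigma * G x) (B := fun x => - Gv x) (y := y) AL BL a0.
  move=> /(_ _ a a0); rewrite wE; apply=> s s0.
  have w0 := width_gt0 s0 a0; set b := width s a in w0 *.
  have HK : Hinf (gk b (fun=> 1) y) by exact: gk_Hinf.
  set K := gk b _ y in HK.
  have H1 m := Hinf_sqint (Hinf_pder m (Hinf_pder m HK)).
  have H3 m := Hinf_sqint (Hinf_pder c3 (Hinf_pder m (Hinf_pder m HK))).
  have l1L : sqint3 R (lapl_hK b y) by exact: sqintD.
  have l3L : sqint3 R (lapl_hK3 b y) by exact: sqintD.
  apply: (riesz_combine (split_A _ l1L) (split_B _ l3L)
    (riesz_even y mG w0 i2 j2) (riesz_odd y mGv w0 k2 l2)).
  have q f : Hinf f -> intgr3 R (fun x => f x * K x) by move=> Hf; exact: Hinf_intgr2.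
  have HVm m := q _ (Hinf_pder m (Hinf_pder m HV)).
  have Hwij := q _ (Hinf_pder i (Hinf_pder j Hw)).
  have Hvkl := q _ (Hinf_pder c3 (Hinf_pder k (Hinf_pder l Hv))).
  transitivity (\int[leb3 R]_x (V x * pder c1 (pder c1 K) x) + \int[leb3 R]_x (V x * pder c2 (pder c2 K) x)).
    by rewrite -(IntD (sqint_mul VL (H1 c1)) (sqint_mul VL (H1 c2))); apply: eq_Int => x; rewrite mulrDr.
  apply: (etrans (esym (congr2 +%R (Int_by_parts2 c1 c1 HV HK) (Int_by_parts2 c2 c2 HV HK)))).
  apply: (etrans (esym (IntD (HVm c1) (HVm c2)))).
  transitivity (\int[leb3 R]_x (sigma * (pder i (pder j w) x * K x) - pder c3 (pder k (pder l v)) x * K x)).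
    apply: eq_Int => x; apply: (etrans (esym (mulrDl _ _ _))).
    by apply: (etrans (congr1 ( *%R^~ (K x)) (lap x))); rewrite mulrBl -mulrA.
  apply: (etrans (IntB (intgrZ sigma Hwij) Hvkl)).
  apply: (etrans (congr2 (fun p q => p - q) (IntZ sigma Hwij) (Int_by_parts3 c3 k l Hv HK))).
  by rewrite opprK; congr (_ * _ + _); exact: Int_by_parts2.
exact: (riesz_solve (split_A _ (Hinf_sqint Hp)) (split_B _ (Hinf_sqint (Hinf_pder c3 Hp)))
  (gauss_duality AL BL key Hp ip idp)).
Qed.

Lemma pderB_fun i f g : Hinf f -> Hinf g ->
  pder i (fun x => f x - g x) = fun x => pder i f x - pder i g x.
Proof. by move=> Hf Hg; apply/funext => x; exact: pderB. Qed.

Lemma pderN_fun i f : Hinf f -> pder i (fun x => - f x) = fun x => - pder i f x.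
Proof. by move=> Hf; apply/funext => x; exact: pderN. Qed.

Lemma biot_savart_algebra1 (p q r r' : R) : r' = r -> p + q = -1 * (r - q) - (- p - r').
Proof. by move=> ->; ring. Qed.

Lemma biot_savart_algebra2 (p q r r' : R) : r = r' -> p + q = 1 * (p - r) - (- r' - q).
Proof. by move=> ->; ring. Qed.

(** Since [Delta_h u_1 = - d_2 omega_3 - d_1 d_3 u_3] and [Delta_h u_2 = d_1 omega_3
- d_2 d_3 u_3] for a divergence-free field, a horizontal derivative of a
horizontal component is, up to sign, a Riesz transform of [omega3 u] minus the
vertical derivative of one of [u c3]. The latter derivative is put on the test
function. *)
Lemma biot_savart (u : vfield R) Gw Gu3 (al k : 'I_3) : (forall k, Hinf (u k)) ->
  (forall x, divergence u x = 0) -> is_riesz_h (omega3 u) Gw -> is_riesz_h (u c3) Gu3 ->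
  (al < 2)%N -> (k < 2)%N ->
  exists sigma (j : 'I_3), [/\ `|sigma| = 1, (j < 2)%N & forall phi,
    Hinf phi -> intgr3 R phi -> intgr3 R (pder c3 phi) ->
    \int[leb3 R]_x (pder al (u k) x * phi x) =
    sigma * \int[leb3 R]_x (Gw al j x * phi x) + \int[leb3 R]_x (Gu3 al k x * pder c3 phi x)].
Proof.
move=> Hu divu mw m3 al2 k2.
have Hom : Hinf (omega3 u) by apply: HinfB; apply: Hinf_pder.
have div3 : pder c3 (u c3) = fun x => - pder c1 (u c1) x - pder c2 (u c2) x.
  by apply/funext => x; have := divu x; rewrite /divergence sum3E => e; lra.
have Hp m n := Hinf_pder m (Hu n).
have Hpp m n r := Hinf_pder m (Hp n r).
have lap3 m : pder c3 (pder al (pder m (u c3))) = fun x =>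
    - pder al (pder m (pder c1 (u c1))) x - pder al (pder m (pder c2 (u c2))) x.
  rewrite (pderC c3 al (Hp m c3)) (pderC c3 m (Hu c3)) div3.
  rewrite (pderB_fun m (HinfN (Hp c1 c1)) (Hp c2 c2)) (pderN_fun m (Hp c1 c1)).
  by rewrite (pderB_fun al (HinfN (Hpp m c1 c1)) (Hpp m c2 c2)) (pderN_fun al (Hpp m c1 c1)).
have om m : pder al (pder m (omega3 u)) = fun x =>
    pder al (pder m (pder c1 (u c2))) x - pder al (pder m (pder c2 (u c1))) x.
  rewrite /omega3 (pderB_fun m (Hp c1 c2) (Hp c2 c1)).
  by rewrite (pderB_fun al (Hpp m c1 c2) (Hpp m c2 c1)).
have C m n r : pder m (pder n (pder al (u r))) = pder al (pder m (pder n (u r))).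
  by rewrite (pderC n al (Hu r)) (pderC m al (Hp n r)).
case: (ord3P k) k2 => -> // _.
- exists (-1), c2; split => //; first by rewrite normrN1.
  move=> phi; apply: (riesz_representation (sigma := -1) (Hp al c1) Hom (Hu c3)
    al2 (isT : (c2 < 2)%N) al2 (isT : (c1 < 2)%N) _ (mw al c2 al2 isT) (m3 al c1 al2 isT)).
  move=> x; apply: (etrans (congr2 +%R (congr1 (@^~ x) (C c1 c1 c1)) (congr1 (@^~ x) (C c2 c2 c1)))).
  apply: (etrans _ (esym (congr2 (fun p q => -1 * p - q) (congr1 (@^~ x) (om c2)) (congr1 (@^~ x) (lap3 c1))))).
  by apply: biot_savart_algebra1; rewrite (pderC c1 c2 (Hu c2)).
- exists 1, c1; split => //; first by rewrite normr1.
  move=> phi; apply: (riesz_representation (sigma := 1) (Hp al c2) Hom (Hu c3)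
    al2 (isT : (c1 < 2)%N) al2 (isT : (c2 < 2)%N) _ (mw al c1 al2 isT) (m3 al c2 al2 isT)).
  move=> x; apply: (etrans (congr2 +%R (congr1 (@^~ x) (C c1 c1 c2)) (congr1 (@^~ x) (C c2 c2 c2)))).
  apply: (etrans _ (esym (congr2 (fun p q => 1 * p - q) (congr1 (@^~ x) (om c1)) (congr1 (@^~ x) (lap3 c2))))).
  by apply: biot_savart_algebra2; rewrite (pderC c1 c2 (Hu c1)).
Qed.

End biot_savart.

(** * Time slices of solutions and pointwise bounds *)

Section solution_slices.
Context {R : realType}.

Lemma Ck_slice (J : interval R) k (f : R -> space3 R -> R) t :
  t \in J -> Ck J k f -> continuous (f t).
Proof.
move=> tJ ck x.
have /subspace_continuousP /(_ (t, x) tJ) cf : {within [set p : R * space3 R | p.1 \in J],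
    continuous (fun p : R * space3 R => f p.1 p.2)} by case: k ck => [|k] [].
apply: (cvg_comp (fun y => (t, y)) (fun p => f p.1 p.2) _ cf) => P wP.
case: wP => -[A B] /= [At Bx] AB; apply: filterS Bx => y By.
by apply: (AB (t, y)); [split => //=; exact: nbhs_singleton At|exact: tJ].
Qed.

Lemma smooth_Hreg (J : interval R) (f : R -> space3 R -> R) t k : t \in J ->
  smooth J f -> (forall s, L2 (pders s (f t))) -> Hreg k (f t).
Proof.
move=> tJ sf Lf; have ck := sf k; elim: k f sf Lf ck => [|k IH] f sf Lf ck.
  by split; [exact: Ck_slice tJ ck|exact: L2_sqint (Lf [::])|].
split; [exact: Ck_slice tJ ck|exact: L2_sqint (Lf [::])|move=> i].
have [_ [_ _ /(_ i)[df ckf]]] := ck.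
split; first by move=> x; exact: df.
apply: (IH (fun t => pder i (f t))) => //.
- by move=> n; have [_ [_ _ /(_ i)[_ ?]]] := sf n.+1.
- move=> s; have := Lf (rcons s i).
  by rewrite /pders -cats1 foldr_cat.
Qed.

Lemma smooth_Hinf (J : interval R) (v : R -> vfield R) t k : t \in J ->
  smooth_field J v -> Hinf (v t k).
Proof.
move=> tJ [sv Lv] n; apply: (smooth_Hreg (f := fun t => v t k) n tJ) => [|s]; first exact: sv.
exact: Lv.
Qed.

End solution_slices.

Section norms.
Context {R : realType}.
Implicit Types (v : vfield R) (x : space3 R).

Lemma sqrt_sum_ge (I : finType) (P : pred I) (F : I -> R) i : P i ->
  (forall j, 0 <= F j) -> F i <= \sum_(j | P j) F j.
Proof. by move=> Pi F0; rewrite (bigD1 i)//= lerDl sumr_ge0. Qed.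

Lemma norm_le_sqrt (p s : R) : p ^+ 2 <= s -> `|p| <= Num.sqrt s.
Proof. by move=> ps; rewrite -sqrtr_sqr; apply: ler_wsqrtr. Qed.

Lemma grad_le v (k i : 'I_3) x : `|pder i (v k) x| <= norm_grad v x.
Proof.
apply: norm_le_sqrt.
apply: (@le_trans _ _ (\sum_(i < 3) pder i (v k) x ^+ 2)).
  by apply: (sqrt_sum_ge (F := fun i => pder i (v k) x ^+ 2)) => // j; exact: sqr_ge0.
apply: (sqrt_sum_ge (F := fun k => \sum_(i < 3) pder i (v k) x ^+ 2)) => // j.
by apply: sumr_ge0 => i' _; exact: sqr_ge0.
Qed.

Lemma grad_h_le v (k i : 'I_3) x : (i < 2)%N -> `|pder i (v k) x| <= norm_grad_h v x.
Proof.
move=> i2; apply: norm_le_sqrt.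
apply: (@le_trans _ _ (\sum_(i < 3 | (i < 2)%N) pder i (v k) x ^+ 2)).
  by apply: (sqrt_sum_ge (F := fun i => pder i (v k) x ^+ 2)) => // j; exact: sqr_ge0.
apply: (sqrt_sum_ge (F := fun k => \sum_(i < 3 | (i < 2)%N) pder i (v k) x ^+ 2)) => // j.
by apply: sumr_ge0 => i' _; exact: sqr_ge0.
Qed.

(** The norm only contains the second derivatives whose inner direction is
horizontal; the others are reached by Schwarz's theorem. *)
Lemma grad_grad_h_le v (k i j : 'I_3) x : Hinf (v k) -> (i < 2)%N || (j < 2)%N ->
  `|pder i (pder j (v k)) x| <= norm_grad_grad_h v x.
Proof.
move=> Hv; wlog j2 : i j / (j < 2)%N => [H /orP[i2|j2]|_].
- by rewrite (pderC i j Hv); apply: H => //; rewrite i2 orbT.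
- by apply: H => //; rewrite j2 orbT.
apply: norm_le_sqrt.
apply: (@le_trans _ _ (\sum_(j < 3 | (j < 2)%N) pder i (pder j (v k)) x ^+ 2)).
  by apply: (sqrt_sum_ge (F := fun j => pder i (pder j (v k)) x ^+ 2)) => // j'; exact: sqr_ge0.
apply: (@le_trans _ _ (\sum_(i < 3) \sum_(j < 3 | (j < 2)%N) pder i (pder j (v k)) x ^+ 2)).
  apply: (sqrt_sum_ge (F := fun i => \sum_(j < 3 | (j < 2)%N) pder i (pder j (v k)) x ^+ 2)) => // j'.
  by apply: sumr_ge0 => i' _; exact: sqr_ge0.
apply: (sqrt_sum_ge (F := fun k => \sum_(i < 3) \sum_(j < 3 | (j < 2)%N) pder i (pder j (v k)) x ^+ 2)) => // k'.
by apply: sumr_ge0 => i' _; apply: sumr_ge0 => j' _; exact: sqr_ge0.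
Qed.

Lemma riesz_le (G : 'I_3 -> 'I_3 -> space3 R -> R) (i j : 'I_3) x :
  (i < 2)%N -> (j < 2)%N -> `|G i j x| <= norm_riesz_h G x.
Proof.
move=> i2 j2; apply: norm_le_sqrt.
apply: (@le_trans _ _ (\sum_(j < 3 | (j < 2)%N) G i j x ^+ 2)).
  by apply: (sqrt_sum_ge (F := fun j => G i j x ^+ 2)) => // j'; exact: sqr_ge0.
apply: (sqrt_sum_ge (F := fun i => \sum_(j < 3 | (j < 2)%N) G i j x ^+ 2)) => // j'.
by apply: sumr_ge0 => i' _; exact: sqr_ge0.
Qed.

Lemma sqrt_msbl (f : space3 R -> R) : msbl3 R f -> msbl3 R (fun x => Num.sqrt (f x)).
Proof.
move=> mf; apply: (measurableT_comp _ mf).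
by apply: continuous_measurable_fun; exact: sqrt_continuous.
Qed.

Lemma sqr_msbl (f : space3 R -> R) : msbl3 R f -> msbl3 R (fun x => f x ^+ 2).
Proof. by move=> mf; apply: measurable_funX. Qed.

Lemma norm_msbl v : (forall k, Hinf (v k)) -> [/\ msbl3 R (norm_grad v),
  msbl3 R (norm_grad_h v) & msbl3 R (norm_grad_grad_h v)].
Proof.
move=> Hv; split; apply: sqrt_msbl; apply: msbl_sum => k _; apply: msbl_sum => i _.
- by apply: sqr_msbl; apply: Hinf_msbl; exact: Hinf_pder.
- by apply: sqr_msbl; apply: Hinf_msbl; exact: Hinf_pder.
- apply: msbl_sum => j _; apply: sqr_msbl; apply: Hinf_msbl; apply: Hinf_pder.
  exact: Hinf_pder.
Qed.

End norms.

(** * The energy identity *)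

Section trilinear.
Context {R : realType}.
Implicit Types (f g h : space3 R -> R) (u v w z : vfield R) (i k al : 'I_3).

Definition Hfield v := forall k, Hinf (v k).

(** In [triJ] two derivatives fall on [z], as in the Laplacian. Integrating one of
them by parts yields [triT], where each factor carries one derivative, and
[triS], where both fall on [w]. *)
Definition triT v w z al i k : R :=
  \int[leb3 R]_x (pder al (v i) x * pder i (w k) x * pder al (z k) x).
Definition triJ v w z al i k : R :=
  \int[leb3 R]_x (v i x * pder i (w k) x * pder al (pder al (z k)) x).
Definition triS v w z al i k : R :=
  \int[leb3 R]_x (v i x * pder i (pder al (w k)) x * pder al (z k) x).

Lemma Int_leibniz i f g h : Hinf f -> Hinf g -> Hinf h ->
  \int[leb3 R]_x (pder i f x * g x * h x) =
  - \int[leb3 R]_x (f x * (pder i g x * h x + g x * pder i h x)).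
Proof.
move=> Hf Hg Hh; have := Int_by_parts i Hf (HinfM Hg Hh) => e.
transitivity (\int[leb3 R]_x (pder i f x * (g x * h x))); first by apply: eq_Int => x; rewrite mulrA.
by rewrite e; congr (- _); apply: eq_Int => x; rewrite (pderM i x Hg Hh).
Qed.

Lemma triJE v w z al i k : Hfield v -> Hfield w -> Hfield z ->
  triJ v w z al i k = - triT v w z al i k - triS v w z al i k.
Proof.
move=> Hv Hw Hz; rewrite /triJ.
have Hwi := Hinf_pder i (Hw k); have Hza := Hinf_pder al (Hz k).
transitivity (\int[leb3 R]_x (pder al (pder al (z k)) x * v i x * pder i (w k) x)).
  by apply: eq_Int => x; ring.
rewrite (Int_leibniz al Hza (Hv i) Hwi) -opprD; congr (- _).
rewrite /triT /triS -IntD; last 2 first.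
- exact: Hinf_intgr3 (Hinf_pder al (Hv i)) Hwi Hza.
- exact: Hinf_intgr3 (Hv i) (Hinf_pder i (Hinf_pder al (Hw k))) Hza.
by apply: eq_Int => x; rewrite (pderC al i (Hw k)); ring.
Qed.

Lemma leibniz_split (a p q p' q' : R) : a * p' * q + a * q' * p = a * (p' * q + p * q').
Proof. by ring. Qed.

Lemma zero_combination (p q r : R) : p = 0 -> q = 0 -> r = 0 -> - 2^-1 * p + q - 2^-1 * r = 0.
Proof. by move=> -> -> ->; ring. Qed.

Lemma energy_algebra (t1 t2 t3 t4 s1 s2 s3 s4 : R) :
  (- t1 - s1) - (- t2 - s2) + (- t3 - s3) - (- t4 - s4) - (- t1 + t2 - t3 + t4) =
  - 2^-1 * (s1 + s1) + (s2 + s4) - 2^-1 * (s3 + s3).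
Proof. by field. Qed.

(** Transport by a divergence-free field is antisymmetric. *)
Lemma triS_sum0 v w z al k : Hfield v -> Hfield w -> Hfield z ->
  (forall x, divergence v x = 0) ->
  \sum_(i < 3) (triS v w z al i k + triS v z w al i k) = 0.
Proof.
move=> Hv Hw Hz dv; have Hwa := Hinf_pder al (Hw k); have Hza := Hinf_pder al (Hz k).
have Hp := HinfM Hwa Hza.
have e i : triS v w z al i k + triS v z w al i k =
    - \int[leb3 R]_x (pder i (v i) x * (pder al (w k) x * pder al (z k) x)).
  rewrite /triS -IntD; last 2 first.
  - exact: Hinf_intgr3 (Hv i) (Hinf_pder i Hwa) Hza.
  - exact: Hinf_intgr3 (Hv i) (Hinf_pder i Hza) Hwa.
  rewrite (Int_by_parts i (Hv i) Hp) opprK; apply: eq_Int => x.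
  by rewrite (pderM i x Hwa Hza); exact: leibniz_split.
rewrite (eq_bigr _ (fun i _ => e i)) sumrN -Int_sum; last first.
  by move=> i _; exact: Hinf_intgr2 (Hinf_pder i (Hv i)) Hp.
rewrite (_ : Rintegral _ _ _ = \int[leb3 R]_x (0 : R)).
  by rewrite /Rintegral integral0 oppr0.
by apply: eq_Int => x; rewrite -mulr_suml -/(divergence v x) dv mul0r.
Qed.

Lemma advect_lapl v w z : Hfield v -> Hfield w -> Hfield z ->
  let l x := \sum_(k < 3) advect v w k x * lapl_h (z k) x in
  intgr3 R l /\ \int[leb3 R]_x l x =
    \sum_(al < 3 | (al < 2)%N) \sum_(k < 3) \sum_(i < 3) triJ v w z al i k.
Proof.
move=> Hv Hw Hz l.
have lE x : l x = \sum_(al < 3 | (al < 2)%N) \sum_(k < 3) \sum_(i < 3)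
    (v i x * pder i (w k) x * pder al (pder al (z k)) x).
  rewrite exchange_big /l; apply: eq_bigr => k _; rewrite /advect /lapl_h mulr_sumr.
  by apply: eq_bigr => al _; rewrite mulr_suml.
have ti al i k : intgr3 R (fun x => v i x * pder i (w k) x * pder al (pder al (z k)) x).
  by apply: Hinf_intgr3 => //; [exact: Hinf_pder|apply: Hinf_pder; exact: Hinf_pder].
have ti1 al k := intgr_sum (index_enum _) (P := xpredT) (fun i _ => ti al i k).
have ti2 al := intgr_sum (index_enum _) (P := xpredT) (fun k _ => ti1 al k).
have ti3 := intgr_sum (index_enum _) (P := fun al : 'I_3 => (al < 2)%N) (fun al _ => ti2 al).
split; first by move: ti3; congr intgr; apply/funext => x; rewrite lE.
transitivity (\int[leb3 R]_x (\sum_(al < 3 | (al < 2)%N) \sum_(k < 3) \sum_(i < 3)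
    (v i x * pder i (w k) x * pder al (pder al (z k)) x))); first by apply: eq_Int.
rewrite Int_sum; last by move=> al _; exact: ti2.
apply: eq_bigr => al _; rewrite Int_sum; last by move=> k _; exact: ti1.
by apply: eq_bigr => k _; rewrite Int_sum.
Qed.

(** After the integration by parts the terms [triS] cancel: in the two equations for
[u] and [b] the transport terms are antisymmetric on their own, while the two
terms transported by [b] cancel each other. *)
Lemma energy_identity u b : Hfield u -> Hfield b ->
  (forall x, divergence u x = 0) -> (forall x, divergence b x = 0) ->
  intgr3 R (mhd_lhs u b) /\ \int[leb3 R]_x mhd_lhs u b x =
    \sum_(al < 3 | (al < 2)%N) \sum_(k < 3) \sum_(i < 3)
      (- triT u u u al i k + triT b b u al i k - triT u b b al i k + triT b u b al i k).
Proof.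
move=> Hu Hb du db.
have [i1 e1] := advect_lapl Hu Hu Hu; have [i2 e2] := advect_lapl Hb Hb Hu.
have [i3 e3] := advect_lapl Hu Hb Hb; have [i4 e4] := advect_lapl Hb Hu Hb.
set l1 := (fun x => _) in i1 e1; set l2 := (fun x => _) in i2 e2.
set l3 := (fun x => _) in i3 e3; set l4 := (fun x => _) in i4 e4.
have lE x : mhd_lhs u b x = l1 x - l2 x + l3 x - l4 x.
  rewrite /mhd_lhs /l1 /l2 /l3 /l4 -!sumrB -big_split -sumrB /=.
  by apply: eq_bigr => k _.
split.
  have := intgrB (intgrD (intgrB i1 i2) i3) i4; congr intgr.
  by apply/funext => x; rewrite lE.
transitivity (\int[leb3 R]_x (l1 x - l2 x + l3 x - l4 x)); first by apply: eq_Int.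
apply: (etrans (etrans (IntB (intgrD (intgrB i1 i2) i3) i4) (congr2 (fun p q => p - q)
  (etrans (IntD (intgrB i1 i2) i3) (congr2 +%R
    (etrans (IntB i1 i2) (congr2 (fun p q => p - q) e1 e2)) e3)) e4))).
rewrite -sumrB -big_split -sumrB /=; apply: eq_bigr => al _.
rewrite -sumrB -big_split -sumrB /=; apply: eq_bigr => k _.
have s1 := triS_sum0 al k Hu Hu Hu du; have s2 := triS_sum0 al k Hb Hb Hu db.
have s3 := triS_sum0 al k Hu Hb Hb du.
rewrite -sumrB -big_split -sumrB /=.
apply/eqP; rewrite -subr_eq0 -sumrB; apply/eqP.
transitivity (- 2^-1 * \sum_(i < 3) (triS u u u al i k + triS u u u al i k) +
  \sum_(i < 3) (triS b b u al i k + triS b u b al i k) -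
  2^-1 * \sum_(i < 3) (triS u b b al i k + triS u b b al i k)); last first.
  exact: (zero_combination s1 s2 s3).
rewrite !mulr_sumr -big_split -sumrB /=; apply: eq_bigr => i _.
by rewrite !triJE//; exact: energy_algebra.
Qed.

End trilinear.

(** * Control by the right-hand side *)

Section bounds.
Context {R : realType}.
Variables (u b : vfield R) (Gw Gu3 : 'I_3 -> 'I_3 -> space3 R -> R).
Hypotheses (Hu : Hfield u) (Hb : Hfield b).
Hypotheses (du : forall x, divergence u x = 0).
Hypotheses (mw : is_riesz_h (omega3 u) Gw) (m3 : is_riesz_h (u c3) Gu3).

Let rhs := mhd_rhs u b Gw Gu3.

Let ngh0 (v : vfield R) x : 0 <= norm_grad v x. Proof. exact: sqrtr_ge0. Qed.
Let nh0 (v : vfield R) x : 0 <= norm_grad_h v x. Proof. exact: sqrtr_ge0. Qed.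
Let ngg0 (v : vfield R) x : 0 <= norm_grad_grad_h v x. Proof. exact: sqrtr_ge0. Qed.
Let nr0 (G : 'I_3 -> 'I_3 -> space3 R -> R) x : 0 <= norm_riesz_h G x.
Proof. exact: sqrtr_ge0. Qed.

Lemma rhs_terms x : exists p1 p2 p3 p4, [/\ rhs x = p1 + p2 + p3 + p4,
  [/\ p1 = `|u c3 x| * (norm_grad u x * norm_grad_grad_h u x + norm_grad b x * norm_grad_grad_h b x),
      p2 = `|b c3 x| * (norm_grad u x * norm_grad_grad_h b x + norm_grad b x * norm_grad_grad_h u x),
      p3 = norm_grad_h b x ^+ 2 * norm_riesz_h Gw x &
      p4 = norm_riesz_h Gu3 x * norm_grad_grad_h b x * norm_grad_h b x] &
  [/\ 0 <= p1, 0 <= p2, 0 <= p3 & 0 <= p4]].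
Proof.
do 4 eexists; split; [by []|by split|split].
- by rewrite mulr_ge0// addr_ge0// mulr_ge0.
- by rewrite mulr_ge0// addr_ge0// mulr_ge0.
- by rewrite mulr_ge0// sqr_ge0.
- by rewrite !mulr_ge0.
Qed.

Lemma rhs_ge0 x : 0 <= rhs x.
Proof.
by have [p1 [p2 [p3 [p4 [-> _ [? ? ? ?]]]]]] := rhs_terms x; rewrite !addr_ge0.
Qed.

Lemma riesz_sqint (f : space3 R -> R) (G : 'I_3 -> 'I_3 -> space3 R -> R) (i j : 'I_3) :
  is_riesz_h f G -> (i < 2)%N -> (j < 2)%N -> sqint3 R (G i j).
Proof. by move=> mG i2 j2; have [? [? [_ [/L2_sqint]]]] := mG i j i2 j2. Qed.

Lemma norm_riesz_msbl (f : space3 R -> R) (G : 'I_3 -> 'I_3 -> space3 R -> R) :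
  is_riesz_h f G -> msbl3 R (norm_riesz_h G).
Proof.
move=> mG; apply: sqrt_msbl; apply: msbl_sum => i i2; apply: msbl_sum => j j2.
by apply: sqr_msbl; have [] := riesz_sqint mG i2 j2.
Qed.

Lemma rhs_msbl : msbl3 R rhs.
Proof.
have [u1 u2 u3] := norm_msbl Hu; have [b1 b2 b3] := norm_msbl Hb.
have g1 := norm_riesz_msbl mw; have g2 := norm_riesz_msbl m3.
have uc := msbl_norm (Hinf_msbl (Hu c3)); have bc := msbl_norm (Hinf_msbl (Hb c3)).
rewrite /rhs /mhd_rhs.
exact: (msblD (msblD (msblD (msblM uc (msblD (msblM u1 u3) (msblM b1 b3)))
  (msblM bc (msblD (msblM u1 b3) (msblM b1 u3)))) (msblM (sqr_msbl b2) g1))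
  (msblM (msblM g2 b3) b2)).
Qed.

Let I : \bar R := (\int[leb3 R]_x (rhs x)%:E)%E.

Let I0 : (0 <= I)%E.
Proof. by apply: integral_ge0 => x _; rewrite lee_fin rhs_ge0. Qed.

(** [controlled n r]: the number [r] is at most [n] times the right-hand side,
whether the latter is finite or not. *)
Definition controlled (n : nat) (r : R) : Prop := (`|r|%:E <= n%:R%:E * I)%E.

Lemma controlledD m n r s : controlled m r -> controlled n s -> controlled (m + n) (r + s).
Proof.
move=> hr hs; rewrite /controlled natrD EFinD ge0_muleDl ?lee_fin//.
by apply: (@le_trans _ _ (`|r| + `|s|)%:E); [rewrite lee_fin ler_normD|rewrite EFinD leeD].
Qed.

Lemma controlledN n r : controlled n r -> controlled n (- r).
Proof. by rewrite /controlled normrN. Qed.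

Lemma controlled0 : controlled 0 0.
Proof. by rewrite /controlled normr0 mul0e. Qed.

Lemma controlled_sum (J : Type) (s : seq J) (P : pred J) (n : nat) (F : J -> R) :
  (forall j, P j -> controlled n (F j)) ->
  controlled (\sum_(j <- s | P j) n) (\sum_(j <- s | P j) F j).
Proof.
move=> h; elim: s => [|j s IH]; first by rewrite !big_nil; exact: controlled0.
by rewrite !big_cons; case: ifP => // Pj; apply: controlledD => //; exact: h.
Qed.

Lemma controlled_Int (n : nat) (r : space3 R -> R) : intgr3 R r ->
  (forall x, `|r x| <= n%:R * rhs x) -> controlled n (\int[leb3 R]_x r x).
Proof.
move=> ri rn; rewrite /controlled /I -ge0_integralZl_EFin//; last 2 first.
- by move=> x _; rewrite lee_fin rhs_ge0.
- by apply/measurable_EFinP; exact: rhs_msbl.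
apply: (@le_trans _ _ (\int[leb3 R]_x `|r x|%:E)%E).
  by rewrite (Int_EFin (intgr_norm ri)) lee_fin; exact: le_normr_Rintegral.
apply: ge0_le_integral => //.
- by apply/measurable_EFinP; exact: intgr_msbl (intgr_norm ri).
- apply/measurable_EFinP; apply: (@measurable_funM _ (mspace3 R) R _ (fun=> n%:R) rhs) => //; exact: rhs_msbl.
- by move=> x _; rewrite -EFinM lee_fin.
Qed.

(** What remains of [\int d_i v_3 * d_p w_k * d_q z_l] after integrating by parts to
free [v_3] is bounded by the right-hand side. This holds for the four triples
that occur. *)
Definition admissible (v w z : vfield R) : Prop := [/\ Hfield v, Hfield w, Hfield z &
  forall x, `|v c3 x| * (norm_grad_grad_h w x * norm_grad z x + norm_grad w x * norm_grad_grad_h z x)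
    <= 2 * rhs x].

Let adm1 (c s o p1 p2 p3 p4 : R) : p1 = c * (s + o) -> 0 <= c * o ->
  0 <= p2 -> 0 <= p3 -> 0 <= p4 -> c * (s + s) <= 2 * (p1 + p2 + p3 + p4).
Proof. by move=> ->; rewrite !mulrDr => *; lra. Qed.

Let adm2 (p1 p2 p3 p4 s : R) : p2 = s -> 0 <= p1 -> 0 <= p2 -> 0 <= p3 -> 0 <= p4 ->
  s <= 2 * (p1 + p2 + p3 + p4).
Proof. by move=> <- *; lra. Qed.

Lemma admissible_uuu : admissible u u u.
Proof.
split; [exact: Hu|exact: Hu|exact: Hu|move=> x].
have [p1 [p2 [p3 [p4 [-> [e1 _ _ _] [h1 h2 h3 h4]]]]]] := rhs_terms x.
rewrite [X in _ * (X + _)]mulrC; apply: (adm1 e1 _ h2 h3 h4).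
exact: mulr_ge0 (normr_ge0 _) (mulr_ge0 (ngh0 b x) (ngg0 b x)).
Qed.

Lemma admissible_ubb : admissible u b b.
Proof.
split; [exact: Hu|exact: Hb|exact: Hb|move=> x].
have [p1 [p2 [p3 [p4 [-> [e1 _ _ _] [h1 h2 h3 h4]]]]]] := rhs_terms x.
rewrite [X in _ * (X + _)]mulrC.
apply: (adm1 (etrans e1 (congr1 _ (addrC _ _))) _ h2 h3 h4).
exact: mulr_ge0 (normr_ge0 _) (mulr_ge0 (ngh0 u x) (ngg0 u x)).
Qed.

Lemma admissible_bub : admissible b u b.
Proof.
split; [exact: Hb|exact: Hu|exact: Hb|move=> x].
have [p1 [p2 [p3 [p4 [-> [_ e2 _ _] [h1 h2 h3 h4]]]]]] := rhs_terms x.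
apply: (adm2 (etrans e2 (congr1 ( *%R _) _)) h1 h2 h3 h4).
exact: (etrans (addrC _ _) (congr1 (+%R^~ _) (mulrC _ _))).
Qed.

Lemma admissible_bbu : admissible b b u.
Proof.
split; [exact: Hb|exact: Hb|exact: Hu|move=> x].
have [p1 [p2 [p3 [p4 [-> [_ e2 _ _] [h1 h2 h3 h4]]]]]] := rhs_terms x.
apply: (adm2 (etrans e2 (congr1 ( *%R _) _)) h1 h2 h3 h4).
exact: (congr1 (+%R^~ _) (mulrC _ _)).
Qed.

(** Integrating by parts moves the derivative off the third component. The two
conditions on the directions keep one of the two derivatives horizontal in each
resulting second derivative. *)
Lemma controlled_third v w z (i p q k l : 'I_3) : admissible v w z ->
  (i < 2)%N || (p < 2)%N -> (i < 2)%N || (q < 2)%N ->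
  controlled 2 (\int[leb3 R]_x (pder i (v c3) x * pder p (w k) x * pder q (z l) x)).
Proof.
move=> [Hv Hw Hz adm] ip iq.
have Hwp := Hinf_pder p (Hw k); have Hzq := Hinf_pder q (Hz l).
rewrite (Int_leibniz i (Hv c3) Hwp Hzq); apply: controlledN; apply: controlled_Int.
  apply: Hinf_intgr2 => //; apply: HinfD; apply: HinfM => //; exact: Hinf_pder.
move=> x; apply: (le_trans _ (adm x)); rewrite normrM; apply: ler_wpM2l => //.
apply: (le_trans (ler_normD _ _)); rewrite !normrM.
apply: lerD; apply: ler_pM => //.
- exact: grad_grad_h_le.
- exact: grad_le.
- exact: grad_le.
- exact: grad_grad_h_le.
Qed.

Let riesz_product_le (s g p q r n : R) : `|s| = 1 -> `|g| <= r -> `|p| <= n -> `|q| <= n ->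
  `|s * (g * (p * q))| <= n ^+ 2 * r.
Proof.
move=> s1 gr pn qn; rewrite !normrM s1 mul1r mulrC expr2.
exact: (ler_pM (mulr_ge0 (normr_ge0 p) (normr_ge0 q)) (normr_ge0 g)
  (ler_pM (normr_ge0 p) (normr_ge0 q) pn qn) gr).
Qed.

Let riesz_leibniz_le (g p q p' q' r n m : R) : `|g| <= r -> `|p| <= n -> `|q| <= n ->
  `|p'| <= m -> `|q'| <= m -> `|g * (p' * q + p * q')| <= 2 * (r * m * n).
Proof.
move=> gr pn qn pm qm; rewrite normrM.
have h1 := ler_pM (normr_ge0 p') (normr_ge0 q) pm qn.
have h2 := ler_pM (normr_ge0 q') (normr_ge0 p) qm pn.
have h : `|p' * q + p * q'| <= 2 * (m * n).
  by apply: (le_trans (ler_normD _ _)); rewrite !normrM [`|p| * _]mulrC; lra.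
have := ler_pM (normr_ge0 g) (normr_ge0 _) gr h.
by move/le_trans; apply; rewrite le_eqVlt; apply/orP; left; apply/eqP; ring.
Qed.

(** Here no third component is visible; the Biot-Savart law produces [omega3 u] and
[u c3], and the derivative left on the test function falls on one of the two
factors from [b]. *)
Lemma controlled_horizontal (al k p q m n : 'I_3) : (al < 2)%N -> (k < 2)%N ->
  (p < 2)%N -> (q < 2)%N ->
  controlled 2 (\int[leb3 R]_x (pder al (u k) x * (pder p (b m) x * pder q (b n) x))).
Proof.
move=> al2 k2 p2 q2.
have [sigma [j [s1 j2 rep]]] := biot_savart Hu du mw m3 al2 k2.
have Hp := Hinf_pder p (Hb m); have Hq := Hinf_pder q (Hb n).
have H3p := Hinf_pder c3 Hp; have H3q := Hinf_pder c3 Hq.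
have Hphi := HinfM Hp Hq.
have dphiE x : pder c3 (fun x => pder p (b m) x * pder q (b n) x) x =
  pder c3 (pder p (b m)) x * pder q (b n) x + pder p (b m) x * pder c3 (pder q (b n)) x.
  exact: pderM.
have ip := Hinf_intgr2 Hp Hq.
have idp : intgr3 R (pder c3 (fun x => pder p (b m) x * pder q (b n) x)).
  rewrite (_ : pder c3 _ = fun x => pder c3 (pder p (b m)) x * pder q (b n) x +
    pder p (b m) x * pder c3 (pder q (b n)) x); last exact/funext.
  by apply: intgrD; exact: Hinf_intgr2.
rewrite (rep _ Hphi ip idp).
have GL := riesz_sqint mw al2 j2; have G3L := riesz_sqint m3 al2 k2.
have i1 := sqint_mul GL (Hinf_sqint Hphi).
have i2 := sqint_mul G3L (Hinf_sqint (Hinf_pder c3 Hphi)).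
rewrite -(IntZ _ i1) -(IntD (intgrZ sigma i1) i2).
apply: controlled_Int; first exact: intgrD (intgrZ sigma i1) i2.
move=> x; rewrite dphiE.
have [p1 [p2' [p3 [p4 [-> [_ _ e3 e4] [h1 h2 h3 h4]]]]]] := rhs_terms x.
apply: (@le_trans _ _ (p3 + 2 * p4)); last by lra.
apply: (le_trans (ler_normD _ _)); apply: lerD.
- rewrite e3; exact: (riesz_product_le s1 (riesz_le _ _ al2 j2) (grad_h_le _ _ _ p2) (grad_h_le _ _ _ q2)).
- rewrite e4; apply: (riesz_leibniz_le (riesz_le _ _ al2 k2) (grad_h_le _ _ _ p2) (grad_h_le _ _ _ q2)).
  + exact: (grad_grad_h_le x (Hb m) (p2 : (c3 < 2)%N || (p < 2)%N)).
  + exact: (grad_grad_h_le x (Hb n) (q2 : (c3 < 2)%N || (q < 2)%N)).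
Qed.

Let controlled_eq n (f g : space3 R -> R) : f =1 g ->
  controlled n (\int[leb3 R]_x g x) -> controlled n (\int[leb3 R]_x f x).
Proof. by move=> /funext ->. Qed.

(** A third component in [i] or [k] appears as [v c3] or as [w c3], and comes first
after exchanging [v] and [w] in the second case. *)
Lemma controlled_triT v w z (al i k : 'I_3) : admissible v w z -> admissible w v z ->
  (al < 2)%N -> ~~ ((i < 2)%N && (k < 2)%N) -> controlled 2 (triT v w z al i k).
Proof.
move=> a1 a2 al2; rewrite negb_and => h.
have al2r j : (j < 2)%N || (al < 2)%N by rewrite al2 orbT.
have [i2|ni] := boolP (i < 2)%N; last first.
  have -> : i = c3 by move: ni; case: (ord3P i) => ->.
  by apply: (controlled_third _ _ a1); rewrite al2.
have -> : k = c3 by move: h; rewrite i2; case: (ord3P k) => ->.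
apply: (controlled_eq (g := fun x => pder i (w c3) x * pder al (v i) x * pder al (z c3) x)); last exact: (controlled_third _ _ a2).
by move=> x; rewrite [pder i _ _ * _]mulrC.
Qed.

Lemma controlled_bbu (al i k : 'I_3) : (al < 2)%N -> controlled 2 (triT b b u al i k).
Proof.
move=> al2; have [/andP[i2 k2]|h] := boolP ((i < 2)%N && (k < 2)%N); last first.
  exact: (controlled_triT admissible_bbu admissible_bbu).
apply: (controlled_eq (g := fun x => pder al (u k) x * (pder al (b i) x * pder i (b k) x))); last exact: controlled_horizontal.
by move=> x; rewrite mulrC.
Qed.

Lemma controlled_ubb (al i k : 'I_3) : (al < 2)%N -> controlled 2 (triT u b b al i k).
Proof.
move=> al2; have [/andP[i2 k2]|h] := boolP ((i < 2)%N && (k < 2)%N); last first.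
  exact: (controlled_triT admissible_ubb admissible_bub).
apply: (controlled_eq (g := fun x => pder al (u i) x * (pder i (b k) x * pder al (b k) x))); last exact: controlled_horizontal.
by move=> x; rewrite mulrA.
Qed.

Lemma controlled_bub (al i k : 'I_3) : (al < 2)%N -> controlled 2 (triT b u b al i k).
Proof.
move=> al2; have [/andP[i2 k2]|h] := boolP ((i < 2)%N && (k < 2)%N); last first.
  exact: (controlled_triT admissible_bub admissible_ubb).
apply: (controlled_eq (g := fun x => pder i (u k) x * (pder al (b i) x * pder al (b k) x))); last exact: controlled_horizontal.
by move=> x; rewrite mulrCA mulrA.
Qed.

Let cayley_hamilton (m p q r s : R) : p + s + m = 0 ->
  p * p * p + q * r * p + (p * q * q + q * s * q) + (r * p * r + s * r * r + (r * q * s + s * s * s))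
  = - (m * p * p + m * q * q + m * r * r + m * s * s - m * p * s + m * q * r).
Proof. by move=> h; rewrite (_ : m = - (p + s)); [ring|lra]. Qed.

(** In each of the two directions [al], five of the nine terms contain a third
component. *)
Lemma controlled_uuu_horizontal : controlled 12
  (\sum_(al < 3 | (al < 2)%N) \sum_(k < 3 | (k < 2)%N) \sum_(i < 3 | (i < 2)%N) triT u u u al i k).
Proof.
pose m x := pder c3 (u c3) x.
have Hm : Hinf m by exact: Hinf_pder.
have Hd (i k : 'I_3) : Hinf (pder i (u k)) by exact: Hinf_pder.
have I3 (i k j l : 'I_3) := Hinf_intgr3 Hm (Hd i k) (Hd j l).
have ti al i k : intgr3 R (fun x => pder al (u i) x * pder i (u k) x * pder al (u k) x).
  exact: Hinf_intgr3.
have ti1 al k := intgr_sum (index_enum _) (P := fun i : 'I_3 => (i < 2)%N) (fun i _ => ti al i k).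
have ti2 al := intgr_sum (index_enum _) (P := fun k : 'I_3 => (k < 2)%N) (fun k _ => ti1 al k).
have ct (p q k l : 'I_3) : (p < 2)%N -> (q < 2)%N ->
    controlled 2 (\int[leb3 R]_x (m x * pder p (u k) x * pder q (u l) x)).
  by move=> p2 q2; apply: (controlled_third _ _ admissible_uuu).
suff -> : \sum_(al < 3 | (al < 2)%N) \sum_(k < 3 | (k < 2)%N) \sum_(i < 3 | (i < 2)%N) triT u u u al i k =
   - ((\int[leb3 R]_x (m x * pder c1 (u c1) x * pder c1 (u c1) x))
   + (\int[leb3 R]_x (m x * pder c1 (u c2) x * pder c1 (u c2) x))
   + (\int[leb3 R]_x (m x * pder c2 (u c1) x * pder c2 (u c1) x))
   + (\int[leb3 R]_x (m x * pder c2 (u c2) x * pder c2 (u c2) x))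
   - (\int[leb3 R]_x (m x * pder c1 (u c1) x * pder c2 (u c2) x))
   + (\int[leb3 R]_x (m x * pder c1 (u c2) x * pder c2 (u c1) x))).
  apply: controlledN; rewrite -[12%N]/(2 + 2 + 2 + 2 + 2 + 2)%N.
  apply: controlledD; last exact: ct.
  apply: controlledD; last by apply: controlledN; exact: ct.
  by do 3 (apply: controlledD; last exact: ct); exact: ct.
have S1 := intgrD (I3 c1 c1 c1 c1) (I3 c1 c2 c1 c2).
have S2 := intgrD S1 (I3 c2 c1 c2 c1); have S3 := intgrD S2 (I3 c2 c2 c2 c2).
have S4 := intgrB S3 (I3 c1 c1 c2 c2); have S5 := I3 c1 c2 c2 c1.
rewrite -(IntD (I3 c1 c1 c1 c1) (I3 c1 c2 c1 c2)) -(IntD S1 (I3 c2 c1 c2 c1)).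
rewrite -(IntD S2 (I3 c2 c2 c2 c2)) -(IntB S3 (I3 c1 c1 c2 c2)) -(IntD S4 S5) -(IntN (intgrD S4 S5)).
transitivity (\int[leb3 R]_x (\sum_(al < 3 | (al < 2)%N) \sum_(k < 3 | (k < 2)%N)
    \sum_(i < 3 | (i < 2)%N) (pder al (u i) x * pder i (u k) x * pder al (u k) x))).
  rewrite Int_sum; last by move=> al _; exact: ti2.
  apply: eq_bigr => al _; rewrite Int_sum; last by move=> k _; exact: ti1.
  by apply: eq_bigr => k _; rewrite Int_sum.
apply: eq_Int => x.
have s2 (F : 'I_3 -> 'I_3 -> R) : \sum_(k < 3 | (k < 2)%N) \sum_(i < 3 | (i < 2)%N) F k i =
    F c1 c1 + F c1 c2 + (F c2 c1 + F c2 c2) by rewrite !sum3hE.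
apply: (etrans (etrans (sum3hE _) (congr2 +%R (s2 _) (s2 _)))).
have dx : pder c1 (u c1) x + pder c2 (u c2) x + m x = 0.
  by have := du x; rewrite /divergence sum3E.
exact: (cayley_hamilton (pder c1 (u c2) x) (pder c2 (u c1) x) dx).
Qed.

Let split_third (F : 'I_3 -> 'I_3 -> R) : \sum_(k < 3) \sum_(i < 3) F i k =
  \sum_(k < 3 | (k < 2)%N) \sum_(i < 3 | (i < 2)%N) F i k +
  (\sum_(i < 3) F i c3 + \sum_(k < 3 | (k < 2)%N) F c3 k).
Proof. by rewrite !sum3E !sum3hE; ring. Qed.

Lemma controlled_uuu : controlled 32
  (\sum_(al < 3 | (al < 2)%N) \sum_(k < 3) \sum_(i < 3) triT u u u al i k).
Proof.
rewrite (eq_bigr _ (fun al _ => split_third (triT u u u al))) big_split /=.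
rewrite -[32%N]/(12 + (10 + 10))%N; apply: controlledD; first exact: controlled_uuu_horizontal.
have t al i k := @controlled_triT u u u al i k admissible_uuu admissible_uuu.
rewrite sum3hE; apply: controlledD; rewrite -[10%N]/(6 + 4)%N; apply: controlledD.
all: rewrite ?sum3E ?sum3hE -?[6%N]/(2 + 2 + 2)%N -?[4%N]/(2 + 2)%N.
all: by repeat apply: controlledD; exact: t.
Qed.

(** Of the constant, [108 = 18 * 6] comes from the eighteen triples of indices, each
with three terms containing [b]. *)
Lemma controlled_energy : controlled 140
  (\sum_(al < 3 | (al < 2)%N) \sum_(k < 3) \sum_(i < 3)
    (- triT u u u al i k + triT b b u al i k - triT u b b al i k + triT b u b al i k)).
Proof.
have e al i k : - triT u u u al i k + triT b b u al i k - triT u b b al i k + triT b u b al i k =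
  - triT u u u al i k + (triT b b u al i k - triT u b b al i k + triT b u b al i k).
  by rewrite !addrA.
under eq_bigr => al _.
  under eq_bigr => k _ do rewrite (eq_bigr _ (fun i _ => e al i k)) big_split sumrN.
  rewrite big_split sumrN; over.
rewrite big_split sumrN -[140%N]/(32 + 108)%N; apply: controlledD.
  exact: controlledN controlled_uuu.
rewrite (_ : 108%N = \sum_(al < 3 | (al < 2)%N) \sum_(k < 3) \sum_(i < 3) 6)%N; last first.
  by rewrite sum3hE !sum3E.
apply: controlled_sum => al al2; apply: controlled_sum => k _; apply: controlled_sum => i _.
rewrite -[6%N]/(2 + 2 + 2)%N; apply: controlledD; last exact: controlled_bub.
by apply: controlledD; [exact: controlled_bbu|exact: controlledN (controlled_ubb _ _ al2)].
Qed.

End bounds.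

Unset Implicit Arguments.
Set Strict Implicit.
Set Printing Implicit Defensive.

Theorem proposition1p3 (R : realType) :
  exists2 C : R, 0 <= C &
    forall (J : interval R) (u b : R -> vfield R) (p : R -> space3 R -> R),
      smooth_MHD_solution J u b p ->
    forall t : R, t \in J ->
    forall Gw Gu3 : 'I_3 -> 'I_3 -> space3 R -> R,
      is_riesz_h (omega3 (u t)) Gw ->
      is_riesz_h (u t c3) Gu3 ->
      (\int[leb3 R]_x (mhd_lhs (u t) (b t) x)%:E
         <= C%:E * \int[leb3 R]_x (mhd_rhs (u t) (b t) Gw Gu3 x)%:E)%E.
Proof.
exists 140%:R => // J u b p [_ [su sb] _ div _] t tJ Gw Gu3 mw m3.
have Hu : Hfield (u t) by move=> k; exact: smooth_Hinf tJ su.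
have Hb : Hfield (b t) by move=> k; exact: smooth_Hinf tJ sb.
have du x : divergence (u t) x = 0 by have [] := div t x tJ.
have db x : divergence (b t) x = 0 by have [] := div t x tJ.
have [li e] := energy_identity Hu Hb du db.
rewrite (Int_EFin li) e.
have := controlled_energy Hu Hb du mw m3; rewrite /controlled; apply: le_trans.
by rewrite lee_fin ler_norm.
Qed.
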